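(* Let $\delta\in(0,n]$. (i) If $w\in\mathcal A_{p,\delta}$ with $p\in(1,\infty)$ and $q\in[\frac{p\delta}{n},\infty)$, then there exists a constant $K>0$ such that for all $f\in L^1_{\rm loc}(\mathbb R^n)$, $$\int_{\mathbb R^n}|\mathcal Mf(x)|^q w(x)\,d\mathcal H^\delta_\infty\le K\int_{\mathbb R^n}|f(x)|^q w(x)\,d\mathcal H^\delta_\infty.$$ (ii) If $w\in\mathcal A_{1,\delta}$ and $q\in(\frac{\delta}{n},\infty)$, then there exists a constant $K>0$ such that for all $f\in L^1_{\rm loc}(\mathbb R^n)$, $$\int_{\mathbb R^n}|\mathcal Mf(x)|^q w(x)\,d\mathcal H^\delta_\infty\le K\int_{\mathbb R^n}|f(x)|^q w(x)\,d\mathcal H^\delta_\infty.$$ (iii) If $w\in\mathcal A_{p,\delta}$ with $p\in[1,\infty)$ and $q\in[\frac{p\delta}{n},\infty)$, then there exists a constant $K>0$ such that for all $f\in L^1_{\rm loc}(\mathbb R^n)$ and all $t\in(0,\infty)$, $$w_{\mathcal H^\delta_\infty}\left(\left\{x\in\mathbb R^n:\ \mathcal Mf(x)>t\right\}\right)\le\frac{K}{t^q}\int_{\mathbb R^n}|f(x)|^q w(x)\,d\mathcal H^\delta_\infty.$$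
   Context: A cube $Q\subset\mathbb R^n$ is a left-open right-closed cube with sides parallel to the axes; $l(Q)$ is its edge length. $L^1_{\rm loc}(\mathbb R^n)$ is the set of (Lebesgue measurable) locally Lebesgue integrable functions, and $\mathcal Mf(x):=\sup_{Q\ni x}\frac1{|Q|}\int_Q|f(y)|\,dy$ is the classical Hardy-Littlewood maximal operator (supremum over cubes containing $x$). For $\delta\in(0,n]$ and $E\subset\mathbb R^n$, the Hausdorff content is $\mathcal H^\delta_\infty(E):=\inf\{\sum_i l(Q_i)^\delta:\ E\subset\bigcup_i Q_i\}$, the infimum over all finite or countable coverings of $E$ by cubes. For $E\subset\mathbb R^n$ and a non-negative function $g$ (no measurability required) the Choquet integral is $\int_E g\,d\mathcal H^\delta_\infty:=\int_0^\infty \mathcal H^\delta_\infty(\{x\in E: g(x)>t\})\,dt$. ''Almost everywhere'' with respect to $\mathcal H^\delta_\infty$ means outside a set of zero $\mathcal H^\delta_\infty$-content. A capacitary weight is a non-negative function $w$ with $\int_E w\,d\mathcal H^\delta_\infty<\infty$ for all compact $E$ and $w\in(0,\infty)$ $\mathcal H^\delta_\infty$-almost everywhere; $w_{\mathcal H^\delta_\infty}(F):=\int_F w\,d\mathcal H^\delta_\infty$ for $F\subset\mathbb R^n$. For $p\in(1,\infty)$, $w\in\mathcal A_{p,\delta}$ means $w$ is a capacitary weight with $[w]_{\mathcal A_{p,\delta}}:=\sup_Q\{\frac1{\mathcal H^\delta_\infty(Q)}\int_Qw\,d\mathcal H^\delta_\infty\}\{\frac1{\mathcal H^\delta_\infty(Q)}\int_Qw^{-\frac1{p-1}}d\mathcal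 H^\delta_\infty\}^{p-1}<\infty$ (supremum over all cubes). $w\in\mathcal A_{1,\delta}$ means $w$ is a capacitary weight with $[w]_{\mathcal A_{1,\delta}}:=\inf\{K\in(0,\infty):\ \mathcal M_{\mathcal H^\delta_\infty}w\le Kw\ \ \mathcal H^\delta_\infty\text{-a.e.}\}<\infty$, where $\mathcal M_{\mathcal H^\delta_\infty}f(x):=\sup_{Q\ni x}\frac1{\mathcal H^\delta_\infty(Q)}\int_Q|f|\,d\mathcal H^\delta_\infty$. *)

(* Defs.v *)
From HB Require Import structures.
From mathcomp Require Import all_boot all_order all_algebra.
From mathcomp Require Import all_classical all_reals all_analysis measurable_realfun.

Set Implicit Arguments.
Unset Strict Implicit.
Unset Printing Implicit Defensive.

Import Order.TTheory GRing.Theory Num.Theory.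
Import numFieldNormedType.Exports.

Local Open Scope classical_set_scope.
Local Open Scope ring_scope.

(* The cube with corner a and edge length l is the product of the left-open
   right-closed intervals ]a_i, a_i + l]; it is nondegenerate (l > 0). *)
Record cube (R : realType) (n : nat) := Cube {
  corner : 'rV[R]_n;
  edge : R;
  edge_gt0 : 0 < edge }.

Definition cube_set (R : realType) (n : nat) (Q : cube R n) : set 'rV[R]_n :=
  [set x | forall i : 'I_n,
     corner Q ord0 i < x ord0 i <= corner Q ord0 i + edge Q].

Coercion cube_set : cube >-> set.

Section cube_content.
Local Open Scope ereal_scope.
Context (R : realType) (n : nat).
Implicit Types (g : R -> R) (E : set 'rV[R]_n).

(* The index set D ranges over all subsets of nat, so that coverings may be
   finite (possibly empty) or countably infinite. *)
Definition cube_content g E : \bar R :=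
  ereal_inf [set s | exists (D : set nat) (Q : nat -> cube R n),
    E `<=` \bigcup_(i in D) (Q i : set 'rV[R]_n) /\
    s = \esum_(i in D) (g (edge (Q i)))%:E].

Variable g : R -> R.
Hypothesis g_ge0 : forall r, (0 < r -> 0 <= g r)%R.

Let gedge_ge0 (Q : cube R n) : 0 <= (g (edge Q))%:E.
Proof. by rewrite lee_fin g_ge0// edge_gt0. Qed.

Lemma cube_content_ge0 E : 0 <= cube_content g E.
Proof.
apply: le_ereal_inf_tmp => _ [D [Q [_ ->]]].
by apply: esum_ge0.
Qed.

Lemma cube_content0 : cube_content g set0 = 0.
Proof.
apply/eqP; rewrite eq_le cube_content_ge0 andbT.
apply: ereal_inf_lbound; exists set0, (fun=> @Cube R n 0%R 1%R ltr01).
by split=> //; rewrite esum_set0.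
Qed.

Lemma le_cube_content : {homo cube_content g : A B / A `<=` B >-> A <= B}.
Proof.
move=> A B AB; apply: ereal_inf_le_tmp => _ [D [Q [BQ ->]]].
by exists D, Q; split => //; exact: subset_trans BQ.
Qed.

Lemma cube_content_sigma_subadditive : sigma_subadditive (cube_content g).
Proof.
move=> A; have [[i ioo]|] := pselect (exists i, cube_content g (A i) = +oo).
  rewrite (eseries_pinfty _ _ ioo) ?leey// => k _.
  by rewrite -ltNye (lt_le_trans _ (cube_content_ge0 _)).
rewrite -forallNE => Afin; apply/lee_addgt0Pr => e e0.
have /choice[D] : forall k, exists Dk, exists Q : nat -> cube R n,
    A k `<=` \bigcup_(i in Dk) (Q i : set 'rV[R]_n) /\
    \esum_(i in Dk) (g (edge (Q i)))%:E
      <= cube_content g (A k) + (e / (2 ^ k.+1)%:R)%:E.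
  move=> k; have fA : cube_content g (A k) \is a fin_num.
    by rewrite ge0_fin_numE ?cube_content_ge0// ltey; exact/eqP/Afin.
  have ek0 : (0 < e / (2 ^ k.+1)%:R)%R by rewrite divr_gt0// ltr0n expn_gt0.
  have [_ [Dk [Q [AQ ->]]] /ltW le] := lb_ereal_inf_adherent ek0 fA.
  by exists Dk, Q.
move=> /choice[Q DQ].
have /card_esym/ppcard_eqP[f] := card_nat2.
pose K := [set k : nat | D (f k).1 (f k).2].
pose G := fun ij : nat * nat => (g (edge (Q ij.1 ij.2)))%:E.
have G0 ij : 0 <= G ij by exact: gedge_ge0.
have step1 : cube_content g (\bigcup_k A k) <= \esum_(k in K) G (f k).
  apply: ereal_inf_lbound; exists K, (fun k => Q (f k).1 (f k).2).
  split=> // x [i _ Aix]; have [j Dj Qx] := (DQ i).1 _ Aix.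
  by exists (f^-1%FUN (i, j)); rewrite /K /= invK ?inE.
apply: (le_trans step1).
have -> : \esum_(k in K) G (f k) = \esum_(i in setT) \esum_(j in D i) G (i, j).
  rewrite (esum_esum (a := fun i j => G (i, j)))//.
  rewrite [RHS](reindex_esum K _ f)//=.
  split.
  - by move=> k Kk.
  - by move=> x y _ _; apply: (@inj _ _ _ f); rewrite ?inE.
  - move=> [i j] [_ Dj]; exists (f^-1%FUN (i, j)); rewrite /K /= invK ?inE//.
rewrite -nneseries_esumT; last by move=> k; apply: esum_ge0 => j _; exact: G0.
apply: (@le_trans _ _
    (\sum_(k <oo) (cube_content g (A k) + (e / (2 ^ k.+1)%:R)%:E))%E).
  apply: lee_nneseries => k _; last exact: (DQ k).2.
  by move=> _; apply: esum_ge0 => j _; exact: G0.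
apply: epsilon_trick; last exact: ltW.
by move=> k; exact: cube_content_ge0.
Qed.

End cube_content.

Section hausdorff_content.
Local Open Scope ereal_scope.
Context (R : realType) (n : nat).
Implicit Types (delta p t : R) (E : set 'rV[R]_n) (g w : 'rV[R]_n -> \bar R).

Definition hausdorff_content delta E : \bar R :=
  cube_content (fun l => (l `^ delta)%R) E.

Definition choquet delta E g : \bar R :=
  \int[lebesgue_measure]_(t in `]0%R, +oo[%classic)
    hausdorff_content delta [set x | E x /\ t%:E < g x].

Definition weighted_content delta w E : \bar R := choquet delta E w.

Definition ae_content delta (P : set 'rV[R]_n) : Prop :=
  hausdorff_content delta [set x | ~ P x] = 0.

(* Weights may take the values 0 and +oo on a set of zero content. *)
Definition capacitary_weight delta w : Prop :=
  [/\ forall x, 0 <= w x,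
      forall E, compact E -> choquet delta E w < +oo &
      ae_content delta [set x | 0 < w x < +oo]].

Definition choquet_avg delta (Q : cube R n) g : \bar R :=
  (hausdorff_content delta Q)^-1 * choquet delta Q g.

Definition content_maximal delta g (x : 'rV[R]_n) : \bar R :=
  ereal_sup [set choquet_avg delta Q (fun y => `|g y|) |
    Q in [set Q : cube R n | (Q : set 'rV[R]_n) x]].

(* The power w^(-1/(p-1)) is read as +oo where w = 0 and as 0 where
   w = +oo. *)
Definition Ap_const delta p w : \bar R :=
  if p == 1%R then
    ereal_inf [set K%:E | K in [set K : R | (0 < K)%R /\
      ae_content delta [set x | content_maximal delta w x <= K%:E * w x]]]
  else
    ereal_sup [set choquet_avg delta Q w *
        (choquet_avg delta Q (fun x => (w x)^-1 `^ (p - 1)^-1)) `^ (p - 1) |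
      Q in [set: cube R n]].

Definition capacitary_Ap delta p w : Prop :=
  capacitary_weight delta w /\ Ap_const delta p w < +oo.

End hausdorff_content.

Section lebesgue_Rn.
Local Open Scope ereal_scope.
Context (R : realType) (n : nat).

(* Lebesgue outer measure, by coverings with cubes of volume l^n *)
Definition lebesgue_outer : set 'rV[R]_n -> \bar R :=
  cube_content (fun l => (l ^+ n)%R).

Lemma cube_volume_ge0 (l : R) : (0 < l -> 0 <= l ^+ n)%R.
Proof. by move=> /ltW; exact: exprn_ge0. Qed.

HB.instance Definition _ := isOuterMeasure.Build R 'rV[R]_n lebesgue_outer
  (cube_content0 n cube_volume_ge0) (cube_content_ge0 cube_volume_ge0)
  (@le_cube_content R n _) (cube_content_sigma_subadditive cube_volume_ge0).

(* 'rV[R]_n equipped with the Lebesgue-measurable sets, i.e. the sets that are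
   Caratheodory measurable for the Lebesgue outer measure *)
Definition lebesgue_Rn : Type := caratheodory_type lebesgue_outer.

HB.instance Definition _ := Measurable.on lebesgue_Rn.

Definition lebesgue_measure_Rn : set lebesgue_Rn -> \bar R := lebesgue_outer.

HB.instance Definition _ := isMeasure.Build _ lebesgue_Rn R lebesgue_measure_Rn
  (@caratheodory_measure0 R 'rV[R]_n lebesgue_outer)
  (@caratheodory_measure_ge0 R 'rV[R]_n lebesgue_outer)
  (@caratheodory_measure_sigma_additive R 'rV[R]_n lebesgue_outer).

Definition L1loc (f : 'rV[R]_n -> \bar R) : Prop :=
  measurable_fun setT (f : lebesgue_Rn -> \bar R) /\
  forall K : set 'rV[R]_n, compact K ->
    \int[lebesgue_measure_Rn]_(y in K) `|f y| < +oo.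

Definition HL_maximal_Rn (f : 'rV[R]_n -> \bar R) (x : 'rV[R]_n) : \bar R :=
  ereal_sup [set (lebesgue_measure_Rn Q)^-1 *
      \int[lebesgue_measure_Rn]_(y in Q) `|f y| |
    Q in [set Q : cube R n | (Q : set 'rV[R]_n) x]].

End lebesgue_Rn.

(* Main.v *)
(* With d = n / delta, the Lebesgue integral over a cube Q is at most a constant times
   the d-th power of the Choquet integral of |f|^(1/d), and |Q| is the d-th power of the
   content of Q; so M f is dominated by (M_H |f|^(1/d))^d, where M_H is the maximal
   operator of the content, and everything reduces to weighted bounds for M_H.

   The Choquet integral is only subadditive, but on families of cubes whose total content
   inside any dyadic cube is a bounded multiple of the content of that cube it is also
   superadditive up to a constant. Maximal dyadic cubes on which a weighted average is
   large need not form such a family; they are replaced by slightly larger ones that do,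
   using the A_infinity property of the weight v: a subset of a cube carrying a fixed
   proportion of the content carries a fixed proportion of the weight. This gives the weak
   type of the maximal operator M_v with averages (1 / v(Q)) int_Q, and iterating it over
   geometric levels gives sparse families, hence the strong type.

   For p > 1, Lerner's trick bounds M_H h by M_w ((M_sigma h)^(r-1))^(1/(r-1)) with sigma
   the dual weight, and the two weighted maximal operators are bounded. For p = 1 the
   condition gives M_H h <= K M_w (h w) directly. *)
Require Import Defs.
From HB Require Import structures.
From mathcomp Require Import all_boot all_order all_algebra.
From mathcomp Require Import all_classical all_reals all_analysis measurable_realfun.
From mathcomp Require Import ring lra.

Set Implicit Arguments.
Unset Strict Implicit.
Unset Printing Implicit Defensive.

Import Order.TTheory GRing.Theory Num.Theory.
Import numFieldNormedType.Exports.

Local Open Scope classical_set_scope.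
Local Open Scope ring_scope.
Local Open Scope ereal_scope.

(** With r = n q / delta the condition on q becomes p <= r in (i) and (iii), and 1 < r in (ii). The
    inclusion of A_p in A_r then covers every admissible q, the endpoint q = p delta / n included; p
    = r = 1 is the one case left to the weak type. The obstacle is that for Choquet integrals
    Hölder, Jensen and duality are not at hand. Each is replaced by a pointwise inequality with two
    terms and a free parameter, integrated at the cost of a factor 2: [young] for averages,
    [content_le_dual_pair] between a weight and its dual, [powR_le_interpolation] between exponents.
    The parameter is chosen to absorb one term or to balance both. Accordingly the maximal operators
    average an integrand [F] that already contains the weight. Stopping cubes need maximal elements.
    These exist because the weight is unbounded along dyadic ancestors ([weight_growth]), while a
    finite integral bounds the weight of every good cube. Absorbing half of a sum needs that sum to
    be finite, hence the truncation to finitely many generations, with constants independent of the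
    truncation. *)

(** * Sums over countable index sets *)

Section countable_sums.
Context {R : realType} {T : countType}.
Implicit Types (D : set T) (a : T -> \bar R).

Let enum_term D a (k : nat) : \bar R :=
  if @pickle_inv T k is Some i then (if i \in D then a i else 0) else 0.

Let enum_term_ge0 D a k : (forall i, 0 <= a i) -> 0 <= enum_term D a k.
Proof. by rewrite /enum_term => a0; case: (pickle_inv _) => // i; case: ifP. Qed.

Let esum_enum_term D a : (forall i, 0 <= a i) ->
  \esum_(i in D) a i = \sum_(k <oo) enum_term D a k.
Proof.
move=> a0; rewrite nneseries_esumT; last by move=> k; exact: enum_term_ge0.
have -> : \esum_(k in [set: nat]) enum_term D a k =
    \esum_(k in pickle @` D) enum_term D a k.
  rewrite [RHS]esum_mkcond; apply: eq_esum => k _; case: ifPn => // /negP kD.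
  rewrite /enum_term; case E: (@pickle_inv T k) => [i|//].
  case: ifPn => // iD; exfalso; apply: kD; rewrite inE; exists i.
    by move: iD; rewrite inE.
  by have := @pickle_invK T k; rewrite /oapp E.
rewrite esum_image; last by move=> x y _ _; exact: (pcan_inj pickleK).
by apply: eq_esum => i Di; rewrite /enum_term pickleK_inv mem_set.
Qed.

Lemma integral_esum d (X : measurableType d)
    (mu : {measure set X -> \bar R}) (A : set X) D (f : T -> X -> \bar R) :
  measurable A -> (forall i, measurable_fun A (f i)) ->
  (forall i x, 0 <= f i x) ->
  \int[mu]_(x in A) (\esum_(i in D) f i x) =
  \esum_(i in D) \int[mu]_(x in A) f i x.
Proof.
move=> mA mf f0; rewrite esum_enum_term; last by move=> i; exact: integral_ge0.
under eq_integral do rewrite esum_enum_term//.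
rewrite integral_nneseries//.
- apply: eq_eseriesr => k _; rewrite /enum_term.
  case: (pickle_inv _) => [i|]; last exact: integral0.
  by case: ifP => // _; exact: integral0.
- move=> k; rewrite /enum_term; case: (pickle_inv _) => [i|]; last exact: measurable_cst.
  by case: (i \in D) => //; exact: measurable_cst.
- by move=> k x _; exact: enum_term_ge0.
Qed.

Lemma measurable_esum d (X : measurableType d) (A : set X) D (f : T -> X -> \bar R) :
  measurable A -> (forall i, measurable_fun A (f i)) ->
  (forall i x, 0 <= f i x) ->
  measurable_fun A (fun x => \esum_(i in D) f i x).
Proof.
move=> mA mf f0.
rewrite (_ : (fun x => _) = fun x => \sum_(k <oo) enum_term D (f^~ x) k); last first.
  by apply/funext => x; rewrite esum_enum_term.
apply: ge0_emeasurable_sum => k x *; first exact: enum_term_ge0.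
rewrite /enum_term; case: (pickle_inv _) => [i|]; last exact: measurable_cst.
by case: (i \in D) => //; exact: measurable_cst.
Qed.

Lemma cube_content_esum n (g : R -> R) (A : set 'rV[R]_n) D (B : T -> set 'rV[R]_n) :
  (forall r : R, (0 < r)%R -> (0 <= g r)%R) ->
  A `<=` \bigcup_(i in D) B i ->
  cube_content g A <= \esum_(i in D) cube_content g (B i).
Proof.
move=> g0 AB; rewrite esum_enum_term; last by move=> i; exact: cube_content_ge0.
pose C k := if @pickle_inv T k is Some i then (if i \in D then B i else set0) else set0.
apply: (@le_trans _ _ (cube_content g (\bigcup_k C k))).
  apply: le_cube_content => x /AB [i Di Bx]; exists (pickle i) => //.
  by rewrite /C pickleK_inv mem_set.
apply: (le_trans (cube_content_sigma_subadditive g0 _)).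
rewrite le_eqVlt; apply/orP; left; apply/eqP; apply: eq_eseriesr => k _.
rewrite /C /enum_term.
by case: (pickle_inv _) => [i|]; last rewrite cube_content0//; case: ifP; rewrite ?cube_content0.
Qed.

End countable_sums.

Section esum_extra.
Context {R : realType} {T U : choiceType}.
Implicit Types (D : set T).

Lemma le_esum_subset D D' (a : T -> \bar R) :
  D `<=` D' -> \esum_(i in D) a i <= \esum_(i in D') a i.
Proof.
move=> DD'; apply: ge_ereal_sup => _ [X [finX XD] <-].
by apply: esum_ge; exists X => //; split => //; exact: subset_trans DD'.
Qed.

Lemma esumZl D (k : R) (a : T -> \bar R) : (0 <= k)%R -> (forall i, 0 <= a i) ->
  \esum_(i in D) (k%:E * a i) = k%:E * \esum_(i in D) a i.
Proof.
rewrite [(0 <= k)%R]le_eqVlt => /predU1P[<-|k0] a0.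
  by rewrite mul0e esum1// => i _; rewrite mul0e.
suff H (l : R) (b : T -> \bar R) : (0 < l)%R -> (forall i, 0 <= b i) ->
    \esum_(i in D) (l%:E * b i) <= l%:E * \esum_(i in D) b i.
  apply/eqP; rewrite eq_le H//=.
  have ka0 i : 0 <= k%:E * a i by rewrite mule_ge0// lee_fin ltW.
  have ik0 : (0 < k^-1)%R by rewrite invr_gt0.
  have := H _ _ ik0 ka0.
  rewrite (@eq_esum _ _ D _ a); last first.
    by move=> i _; rewrite muleA -EFinM mulVf ?gt_eqF// mul1e.
  rewrite -(@lee_pmul2l _ k%:E) ?fin_numE ?lte_fin//.
  by rewrite [leRHS]muleA -EFinM mulfV ?gt_eqF// mul1e.
move=> l0 b0; apply: ge_ereal_sup => _ [X [finX XD] <-].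
rewrite -ge0_mule_fsumr// lee_pmul2l ?lte_fin//.
by apply: esum_ge; exists X.
Qed.

Lemma esum_swap (D : set T) (E : set U) (a : T -> U -> \bar R) :
  (forall i j, 0 <= a i j) ->
  \esum_(i in D) \esum_(j in E) a i j = \esum_(j in E) \esum_(i in D) a i j.
Proof.
move=> a0; rewrite (@esum_esum _ _ _ D (fun=> E))// (@esum_esum _ _ _ E (fun=> D))//.
rewrite (reindex_esum (E `*`` fun=> D) _ (fun x => (x.2, x.1)))//; split=> //=.
- by move=> [i j] [/=].
- by move=> [i1 i2] [j1 j2] /= _ _ [] -> ->.
- by move=> [i j] [/= Di Ej]; exists (j, i).
Qed.

Lemma esum_le_unique D (a : T -> \bar R) (c : \bar R) :
  0 <= c -> (forall i j, D i -> D j -> i = j) ->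
  (forall i, D i -> 0 <= a i <= c) -> \esum_(i in D) a i <= c.
Proof.
move=> c0 uD ac; have [->|/set0P[i Di]] := eqVneq D set0; first by rewrite esum_set0.
have -> : D = [set i] by apply/seteqP; split => [j Dj|j ->//]; exact: uD.
by have /andP[a0 ac'] := ac _ Di; rewrite esum_set1.
Qed.

Lemma esum_ge_term D (a : T -> \bar R) i : D i -> (forall i, 0 <= a i) ->
  a i <= \esum_(j in D) a j.
Proof.
move=> Di a0; rewrite -[leLHS](@esum_set1 R T i)//.
by apply: le_esum_subset => _ ->.
Qed.
End esum_extra.

Lemma esum_finType (R : realType) (J : finType) (a : J -> \bar R) :
  (forall j, 0 <= a j) -> \esum_(j in [set: J]) a j = \sum_j a j.
Proof.
move=> a0; rewrite esum_fset//; last exact: finite_finset.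
rewrite [RHS]fsbig_seq ?index_enum_uniq//; apply: eq_fsbigl.
by apply/seteqP; split => x //= _; exact: mem_index_enum.
Qed.

Lemma integral_itv_oc_cst (R : realType) (a b : R) (h : \bar R) : (a <= b)%R ->
  \int[lebesgue_measure]_(s in (`]a, b]%classic : set R)) h = (b - a)%:E * h.
Proof.
move=> ab; have E : lebesgue_measure (`]a, b]%classic : set R) = (b - a)%:E.
  rewrite lebesgue_measure_itv/= lte_fin; case: ltP => [_|ba]; first by rewrite EFinB.
  by congr EFin; apply/esym/eqP; rewrite subr_eq0 eq_le ab ba.
rewrite muleC -E; exact: integral_cst.
Qed.

Lemma powR_exprn (R : realType) (a e : R) (j : nat) : (0 <= a)%R ->
  ((a ^+ j) `^ e = (a `^ e) ^+ j)%R.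
Proof. by move=> a0; rewrite -(powR_mulrn _ a0) powRAC -(powR_mulrn _ (powR_ge0 a e)). Qed.

(** * The Choquet integral: comparison, subadditivity, scaling *)

Section choquet_integral.
Context {R : realType} {n : nat} (delta : R).
Local Notation T := 'rV[R]_n.
Local Notation H := (@hausdorff_content R n delta).
Local Notation I := (@choquet R n delta).
Implicit Types (E A B : set T) (F G : T -> \bar R).

Let gauge_ge0 (r : R) : (0 < r)%R -> (0 <= r `^ delta)%R.
Proof. by move=> _; exact: powR_ge0. Qed.

Lemma hausdorff_content_ge0 E : 0 <= H E.
Proof. exact: cube_content_ge0. Qed.

Lemma hausdorff_content0 : H (@set0 T) = 0.
Proof. exact: cube_content0. Qed.

Lemma le_hausdorff_content : {homo H : A B / A `<=` B >-> A <= B}.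
Proof. exact: le_cube_content. Qed.

Lemma hausdorff_content_esum (J : countType) (D : set J) (B : J -> set T) A :
  A `<=` \bigcup_(i in D) B i -> H A <= \esum_(i in D) H (B i).
Proof. exact: cube_content_esum. Qed.

Lemma hausdorff_contentU A B : H (A `|` B) <= H A + H B.
Proof.
have -> : H A + H B = \esum_(b in [set: bool]) H (if b then A else B).
  by rewrite esum_finType ?big_bool// => b; exact: hausdorff_content_ge0.
apply: hausdorff_content_esum => x [Ax|Bx]; [by exists true|by exists false].
Qed.

Lemma hausdorff_content_level_le E F s t : (s <= t)%R ->
  H [set x | E x /\ t%:E < F x] <= H [set x | E x /\ s%:E < F x].
Proof.
move=> st; apply: le_hausdorff_content => x [Ex tF]; split => //.
by apply: le_lt_trans tF; rewrite lee_fin.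
Qed.

(** The content of a level set is nonincreasing in [t], so its superlevel sets are intervals, for
    arbitrary [E] and [F]. *)
Lemma measurable_hausdorff_content_level (D : set R) E F : measurable D ->
  measurable_fun D (fun t : R => H [set x | E x /\ t%:E < F x]).
Proof.
move=> mD; apply: (measurability _ (ErealGenOInfty.measurableE R)).
move=> _ [_ [r ->] <-]; apply: measurableI => //.
apply: is_interval_measurable => s t /=.
rewrite !in_itv/= !andbT => Hs Ht u /andP[su ut]; rewrite in_itv/= andbT.
by apply: lt_le_trans Ht _; exact: hausdorff_content_level_le.
Qed.

Lemma choquet_ge0 E F : 0 <= I E F.
Proof. by apply: integral_ge0 => t _; exact: hausdorff_content_ge0. Qed.

Lemma choquet_le_content E E' F G :
  (forall t : R, (0 < t)%R ->
    H [set x | E x /\ t%:E < F x] <= H [set x | E' x /\ t%:E < G x]) ->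
  I E F <= I E' G.
Proof.
move=> FG; apply: ge0_le_integral => //.
- by move=> t _; exact: hausdorff_content_ge0.
- exact: measurable_hausdorff_content_level.
- exact: measurable_hausdorff_content_level.
- by move=> t; rewrite /= in_itv/= andbT => t0; exact: FG.
Qed.

Lemma hausdorff_content_null A N : H N = 0 -> H (A `|` N) <= H A.
Proof. by move=> N0; rewrite (le_trans (hausdorff_contentU _ _))// N0 adde0. Qed.

Lemma le_choquet_ae N E E' F G : H N = 0 ->
  (forall x, E x -> ~ N x -> E' x /\ F x <= G x) -> I E F <= I E' G.
Proof.
move=> N0 FG; apply: choquet_le_content => t t0.
apply: le_trans (hausdorff_content_null _ N0); apply: le_hausdorff_content => x [Ex tF].
have [Nx|Nx] := pselect (N x); [by right|left].
by have [E'x FGx] := FG _ Ex Nx; split => //; exact: lt_le_trans FGx.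
Qed.

Lemma le_choquet E E' F G : E `<=` E' -> (forall x, E x -> F x <= G x) -> I E F <= I E' G.
Proof.
move=> EE' FG; apply: (le_choquet_ae hausdorff_content0) => x Ex _.
by split; [exact: EE'|exact: FG].
Qed.

Let mH E F := @measurable_hausdorff_content_level `]0%R, +oo[%classic E F (measurable_itv _).

Let esum_choquet (J : countType) (D : set J) (E : J -> set T) (F : J -> T -> \bar R) :
  \esum_(i in D) I (E i) (F i) = \int[lebesgue_measure]_(t in `]0%R, +oo[)
    \esum_(i in D) H [set x | E i x /\ t%:E < F i x].
Proof.
have H0 i t : 0 <= H [set x | E i x /\ t%:E < F i x] by exact: hausdorff_content_ge0.
exact: (esym (integral_esum lebesgue_measure D (measurable_itv _) (fun i => @mH (E i) (F i)) H0)).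
Qed.

Let measurable_esum_level (J : countType) (D : set J) (E : J -> set T) (F : J -> T -> \bar R) :
  measurable_fun (`]0%R, +oo[%classic : set R)
    (fun t : R => \esum_(i in D) H [set x | E i x /\ t%:E < F i x]).
Proof.
have H0 i t : 0 <= H [set x | E i x /\ t%:E < F i x] by exact: hausdorff_content_ge0.
exact: (measurable_esum D (measurable_itv _) (fun i => @mH (E i) (F i)) H0).
Qed.

(** Countable subadditivity of the content, applied at each height [t] separately. The same
    principle gives subadditivity in the domain, [choquetD], and the splitting by levels in
    [strong_type]. *)
Lemma le_choquet_sup (J : countType) (D : set J) E F (E' : J -> set T) (F' : J -> T -> \bar R) :
  (forall x (t : R), E x -> (0 < t)%R -> t%:E < F x ->
    exists2 i, D i & E' i x /\ t%:E < F' i x) ->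
  I E F <= \esum_(i in D) I (E' i) (F' i).
Proof.
move=> EF.
rewrite esum_choquet.
apply: ge0_le_integral => //.
- by move=> t _; exact: hausdorff_content_ge0.
- exact: measurable_hausdorff_content_level.
- exact: measurable_esum_level.
move=> t; rewrite /= in_itv/= andbT => t0; apply: hausdorff_content_esum => x [Ex tF].
by have [i Di [E'x tF']] := EF _ _ Ex t0 tF; exists i.
Qed.

Lemma choquet_subadditive (J : countType) (D : set J) E F (E' : J -> set T) :
  E `<=` \bigcup_(i in D) E' i -> I E F <= \esum_(i in D) I (E' i) F.
Proof.
move=> EE'; apply: le_choquet_sup => x t Ex t0 tF.
by have [i Di E'x] := EE' _ Ex; exists i.
Qed.

(** The hypothesis on arbitrary sets [A] is applied to each level set of [F] and integrated over the
    height. *)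
Lemma choquet_superadditive (J : countType) (D : set J) (E : set T) F (E' : J -> set T) (C : R) :
  (0 <= C)%R ->
  (forall A, \esum_(i in D) H (A `&` E' i) <= C%:E * H A) ->
  (forall i, D i -> E' i `<=` E) ->
  \esum_(i in D) I (E' i) F <= C%:E * I E F.
Proof.
move=> C0 HC E'E.
rewrite esum_choquet.
have -> : C%:E * I E F =
    \int[lebesgue_measure]_(t in `]0%R, +oo[) (C%:E * H [set x | E x /\ t%:E < F x]).
  rewrite ge0_integralZl_EFin//; last exact: mH.
  by move=> t _; exact: hausdorff_content_ge0.
apply: ge0_le_integral => //.
- by move=> t _; apply: esum_ge0 => i _; exact: hausdorff_content_ge0.
- exact: measurable_esum_level.
- by apply: measurable_funeM; exact: mH.
move=> t _; apply: le_trans (HC _); apply: le_esum => i Di; apply: le_hausdorff_content.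
by move=> x [E'x tF]; do !split => //; exact: E'E E'x.
Qed.

Lemma choquet_chebyshev E F (t : R) : (0 < t)%R ->
  t%:E * H [set x | E x /\ t%:E < F x] <= I E F.
Proof.
move=> t0.
have -> : t%:E * H [set x | E x /\ t%:E < F x] =
   \int[lebesgue_measure]_(s in `]0%R, t]%classic) H [set x | E x /\ t%:E < F x].
  by rewrite integral_itv_oc_cst ?ltW// subr0.
apply: (@le_trans _ _ (\int[lebesgue_measure]_(s in `]0%R, t]%classic) H [set x | E x /\ s%:E < F x])).
  apply: ge0_le_integral => //.
  - by move=> s _; exact: hausdorff_content_ge0.
  - exact: measurable_hausdorff_content_level.
  - by move=> s; rewrite /= in_itv/= => /andP[_ st]; exact: hausdorff_content_level_le.
apply: ge0_subset_integral => //.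
- exact: measurable_hausdorff_content_level.
- by move=> s _; exact: hausdorff_content_ge0.
- by move=> s /=; rewrite !in_itv/= => /andP[->].
Qed.

Lemma choquet_eq0 E F : I E F = 0 -> H [set x | E x /\ 0 < F x] = 0.
Proof.
move=> I0; apply/eqP; rewrite eq_le hausdorff_content_ge0 andbT.
rewrite [leRHS](_ : 0 = \esum_(k in [set: nat]) H [set x | E x /\ (k.+1%:R^-1)%:E < F x]).
  apply: hausdorff_content_esum => x [Ex]; case Fx: (F x) => [r| |]//.
   - rewrite lte_fin => r0.
    exists (Num.truncn r^-1) => //=; split => //; rewrite Fx lte_fin.
    by rewrite invf_plt ?posrE// truncnS_gt.
  - by move=> _; exists 0%N => //=; split => //; rewrite Fx ltry.
rewrite esum1// => k _.
have k0 : (0 < k.+1%:R^-1 :> R)%R by rewrite invr_gt0.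
have := choquet_chebyshev E F k0; rewrite I0.
apply: contraTeq => Hn0; rewrite -ltNge mule_gt0//.
by rewrite lt_neqAle hausdorff_content_ge0 eq_sym Hn0.
Qed.

Lemma choquet_cst_le E (c : R) : (0 <= c)%R -> I E (fun=> c%:E) <= c%:E * H E.
Proof.
move=> c0.
apply: (@le_trans _ _ (\int[lebesgue_measure]_(s in `]0%R, +oo[%classic) (((fun=> H E) \_ `]0%R, c]%classic) s))).
  apply: ge0_le_integral => //.
  - by move=> s _; exact: hausdorff_content_ge0.
  - exact: measurable_hausdorff_content_level.
  - by apply: measurable_funTS; apply/(measurable_restrictT _ _).1; [exact: measurable_itv|exact: measurable_cst].
  move=> s; rewrite /= in_itv/= andbT => s0; rewrite patchE; case: ifPn.
    by move=> _; apply: le_hausdorff_content => x [].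
  rewrite notin_setE/= in_itv/= s0/= => /negP; rewrite -ltNge => cs.
  rewrite [X in H X](_ : _ = set0) ?hausdorff_content0//.
  by apply/seteqP; split => x //= [_]; rewrite lte_fin ltNge ltW.
rewrite -integral_mkcondr setIidr; last by move=> s /=; rewrite !in_itv/= => /andP[->].
by rewrite integral_itv_oc_cst// subr0.
Qed.

(** Change of variables t = k s in the height. *)
Lemma choquetZ E F (k : R) : (0 < k)%R -> I E (fun x => k%:E * F x) = k%:E * I E F.
Proof.
move=> k0; rewrite /choquet.
pose phi (s : R) : R := (k * s)%R.
have mphi : measurable_fun [set: R] phi by exact: mulrl_measurable.
pose pf := [the {measure set (measurableTypeR R) -> \bar R} of
  pushforward (@lebesgue_measure R) (phi : measurableTypeR R -> measurableTypeR R)].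
pose mu := [the {measure set (measurableTypeR R) -> \bar R} of mscale (NngNum (ltW k0)) (pf mphi)].
(* Lebesgue measure is k times its image under s -> k s: both agree on half-open intervals, and
   uniqueness does the rest. *)
have muE (A : set R) : measurable A -> lebesgue_measure A = mu A.
  apply: lebesgue_measure_unique => _ [[a b] _ <-].
  change (lebesgue_measure (`]a, b]%classic : set R) =
    k%:E * lebesgue_measure ((phi @^-1` (`]a, b]%classic : set R)) : set R)).
  have -> : phi @^-1` (`]a, b]%classic : set R) = (`](a / k)%R, (b / k)%R]%classic : set R).
    apply/seteqP; split => s; rewrite /phi /= !in_itv/= ltr_pdivrMr// ler_pdivlMr//;
    by rewrite mulrC.
  rewrite !lebesgue_measure_itv/= !lte_fin ltr_pM2r ?invr_gt0//.
  case: ifPn => _; last by rewrite mule0.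
  by rewrite -!EFinB -EFinM; congr EFin; field; rewrite gt_eqF.
rewrite (@eq_measure_integral _ _ _ _ mu); last by move=> A mA _; exact: muE.
rewrite ge0_integral_mscale//; first last.
- by move=> t _; exact: hausdorff_content_ge0.
- exact: measurable_hausdorff_content_level.
congr (_ * _); rewrite ge0_integral_pushforward//; first last.
- by move=> t _; exact: hausdorff_content_ge0.
- exact: measurable_hausdorff_content_level.
have -> : phi @^-1` (`]0%R, +oo[%classic : set R) = (`]0%R, +oo[%classic : set R).
  by apply/seteqP; split => s; rewrite /phi /= !in_itv/= !andbT pmulr_rgt0.
apply: eq_integral => t _ /=; congr H; apply/seteqP; split => x /= [Ex].
- by rewrite /phi EFinM lte_pmul2l.
- by rewrite /phi EFinM lte_pmul2l.
Qed.

(** If t < F + G then t < 2 F or t < 2 G; this is the origin of the factor 2 in all two-term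
    estimates below. *)
Lemma choquetD E F G : (forall x, E x -> 0 <= F x) -> (forall x, E x -> 0 <= G x) ->
  I E (fun x => F x + G x) <= 2%:E * I E F + 2%:E * I E G.
Proof.
move=> F0 G0; rewrite -!choquetZ//.
pose FG (b : bool) (x : T) := 2%:E * (if b then F x else G x).
have -> : I E (fun x => 2%:E * F x) + I E (fun x => 2%:E * G x) =
    \esum_(b in [set: bool]) I E (FG b).
  by rewrite esum_finType ?big_bool// => b; exact: choquet_ge0.
apply: le_choquet_sup => x t Ex t0 tFG.
have [tF|] := ltP t%:E (2%:E * F x); first by exists true.
have [tG|] := ltP t%:E (2%:E * G x); first by exists false.
move: (F0 _ Ex) (G0 _ Ex) tFG; case: (F x) => [f| |]//; case: (G x) => [g| |]//.
- rewrite -EFinD -!EFinM !lee_fin lte_fin; lra.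
- by rewrite mulry gtr0_sg// mul1e leye_eq.
- by move=> _ _ _ _; rewrite mulry gtr0_sg// mul1e leye_eq.
- by move=> _ _ _ _; rewrite mulry gtr0_sg// mul1e leye_eq.
Qed.
End choquet_integral.

(* Induction on the dimension: slice the covering at a fixed last coordinate and
   integrate over that coordinate. *)
Lemma box_volume_le_esum (R : realType) (n : nat) (a b : nat -> R) (D : set nat)
    (c d : nat -> nat -> R) :
  (forall j, (a j <= b j)%R) -> (forall i j, (c i j <= d i j)%R) ->
  (forall x : nat -> R, (forall j, (j < n)%N -> (a j < x j <= b j)%R) ->
    exists2 i, D i & forall j, (j < n)%N -> (c i j < x j <= d i j)%R) ->
  (\prod_(j < n) (b j - a j))%:E <= \esum_(i in D) (\prod_(j < n) (d i j - c i j))%:E.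
Proof.
move=> ab cd; elim: n D => [|n IH] D cov.
  have [|i Di _] := cov a => //.
  rewrite big_ord0; apply: (le_trans _ (esum_ge_term Di _)); first by rewrite big_ord0.
  by move=> k; rewrite big_ord0 lee_fin ler01.
pose v i := (\prod_(j < n) (d i j - c i j))%R.
have v0 i : (0 <= v i)%R by apply: prodr_ge0 => j _; rewrite subr_ge0.
pose g i : R -> \bar R := (fun=> (v i)%:E) \_ (`]c i n, d i n]%classic : set R).
have g0 i s : 0 <= g i s by rewrite /g patchE; case: ifP => // _; rewrite lee_fin.
have mg i : measurable_fun setT (g i).
  by apply/(measurable_restrictT _ _).1; [exact: measurable_itv|exact: measurable_cst].
have slice s : (a n < s <= b n)%R ->
    (\prod_(j < n) (b j - a j))%:E <= \esum_(i in D) g i s.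
  move=> sab; rewrite [leRHS](_ : _ =
    \esum_(i in D `&` [set i | c i n < s <= d i n]%R) (v i)%:E).
    apply: IH => x xab; have [|i Di xi] := cov (fun j => if j == n then s else x j).
      move=> j; rewrite ltnS leq_eqVlt; case: eqVneq => [->//|jn /=]; exact: xab.
    exists i; last first.
      by move=> j jn; have := xi j (ltnW jn); rewrite (ltn_eqF jn).
    by split => //; have := xi n (ltnSn n); rewrite eqxx.
  rewrite esum_mkcondr; apply: eq_esum => i _; rewrite /g patchE.
  rewrite (_ : (i \in _) = (s \in (`]c i n, d i n]%classic : set R)))//.
rewrite big_ord_recr/= mulrC EFinM -integral_itv_oc_cst//.
apply: (@le_trans _ _ (\int[lebesgue_measure]_(s in (`]a n, b n]%classic : set R))
    \esum_(i in D) g i s)).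
  apply: ge0_le_integral => //.
  - by move=> s _; rewrite lee_fin; apply: prodr_ge0 => j _; rewrite subr_ge0.
  - by apply: measurable_esum => // i; apply: measurable_funTS; exact: mg.
rewrite integral_esum//; last by move=> i; apply: measurable_funTS; exact: mg.
apply: le_esum => i _; rewrite big_ord_recr/= mulrC EFinM -integral_itv_oc_cst//.
rewrite [leRHS]integral_mkcond.
by apply: ge0_subset_integral => //; exact: mg.
Qed.

Lemma cube_volume_le_esum (R : realType) (n : nat) (Q : cube R n) (D : set nat)
    (P : nat -> cube R n) :
  (Q : set 'rV[R]_n) `<=` \bigcup_(i in D) (P i : set 'rV[R]_n) ->
  (edge Q ^+ n)%:E <= \esum_(i in D) (edge (P i) ^+ n)%:E.
Proof.
(* Dimension 0 is separated because [inord] needs a successor; there every volume is 1 and the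
   covering is nonempty. *)
case: n => [|n] in Q P *; move=> QP.
  have [|i Di _] := QP 0%R; first by case.
  have := esum_ge_term (a := fun i => (edge (P i) ^+ 0)%:E) Di.
  by rewrite !expr0; apply=> k; rewrite expr0 lee_fin.
pose co (Q : cube R n.+1) j := corner Q ord0 (inord j).
have prodE (Q' : cube R n.+1) : (edge Q' ^+ n.+1 =
    \prod_(j < n.+1) (co Q' j + edge Q' - co Q' j))%R.
  under eq_bigr do rewrite addrAC subrr add0r.
  by rewrite prodr_const card_ord.
rewrite prodE [leRHS](_ : _ = \esum_(i in D)
    (\prod_(j < n.+1) (co (P i) j + edge (P i) - co (P i) j))%:E); last first.
  by apply: eq_esum => i _; rewrite prodE.
apply: (@box_volume_le_esum _ _ (co Q) (fun j => co Q j + edge Q)%R D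
  (fun i => co (P i)) (fun i j => co (P i) j + edge (P i))%R) => [j|i j|x xQ]; rewrite ?lerDl ?ltW ?edge_gt0//.
have [|i Di Pi] := QP (\row_j x j).
  move=> j; rewrite mxE; have := xQ j (ltn_ord j); by rewrite /co inord_val.
by exists i => // j jn; have := Pi (inord j); rewrite mxE inordK.
Qed.

(** * Lebesgue measure and Hausdorff content of cubes *)

Section contents_of_cubes.
Context {R : realType} {n : nat} (delta : R).
Hypotheses (delta_gt0 : (0 < delta)%R) (delta_le_n : (delta <= n%:R)%R).
Local Notation T := 'rV[R]_n.
Local Notation H := (@hausdorff_content R n delta).

Lemma lebesgue_outer_cube (Q : cube R n) : lebesgue_outer Q = (edge Q ^+ n)%:E.
Proof.
apply/eqP; rewrite eq_le; apply/andP; split.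
  apply: ereal_inf_lbound; exists [set 0%N], (fun=> Q); split.
    by move=> x Qx; exists 0%N.
  rewrite esum_set1// lee_fin exprn_ge0// ltW ?edge_gt0//.
by apply: le_ereal_inf_tmp => _ [D [P [QP ->]]]; exact: cube_volume_le_esum.
Qed.

(** Each term is at most the total r, so x_i^s <= r^(s-1) x_i. *)
Lemma esum_powR_le (J : choiceType) (D : set J) (x : J -> R) (s : R) :
  (forall i, (0 <= x i)%R) -> (1 <= s)%R ->
  \esum_(i in D) (x i `^ s)%:E <= (\esum_(i in D) (x i)%:E) `^ s.
Proof.
move=> x0 s1; set X := \esum_(i in D) (x i)%:E.
have X0 : 0 <= X by apply: esum_ge0 => i _; rewrite lee_fin.
have s0 : (0 < s)%R by apply: lt_le_trans s1.
case EX : X X0 => [r| |]// r0; last by rewrite poweRyr ?gt_eqF// leey.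
have xr i : D i -> (x i <= r)%R.
  by move=> Di; rewrite -lee_fin -EX; exact: (esum_ge_term (a := EFin \o x) Di).
have rr : (r `^ s)%:E = (r `^ (s - 1))%:E * r%:E.
  rewrite -EFinM; congr EFin; rewrite lee_fin in r0.
  rewrite -{3}(@powRr1 _ r)// -powRD; first by congr powR; rewrite subrK.
  by rewrite subrK gt_eqF.
rewrite poweR_EFin rr -EX -esumZl ?powR_ge0//.
apply: le_esum => i Di; rewrite -EFinM lee_fin.
have -> : (x i `^ s = x i `^ (s - 1) * x i)%R.
  rewrite -{3}(@powRr1 _ (x i))// -powRD; first by congr powR; rewrite subrK.
  by rewrite subrK gt_eqF.
by rewrite ler_wpM2r// ge0_ler_powR ?nnegrE ?subr_ge0// ?(le_trans _ (xr _ Di))// xr.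
Qed.

Lemma le_poweR (r : R) (x y : \bar R) : (0 <= r)%R -> 0 <= x -> x <= y -> x `^ r <= y `^ r.
Proof.
move=> r0 x0 xy; apply: gt0_ler_poweR => //; rewrite in_itv/= ?x0 ?leey//.
by rewrite (le_trans x0 xy).
Qed.

Lemma poweRVK (r : R) (x : \bar R) : (0 < r)%R -> 0 <= x -> (x `^ r^-1) `^ r = x.
Proof. by move=> r0 x0; rewrite -poweRrM mulVf ?gt_eqF// poweRe1. Qed.

Lemma poweRKV (r : R) (x : \bar R) : (0 < r)%R -> 0 <= x -> (x `^ r) `^ r^-1 = x.
Proof. by move=> r0 x0; rewrite -poweRrM mulfV ?gt_eqF// poweRe1. Qed.

(** For every covering, l^n = (l^delta)^(n/delta), and n/delta >= 1 allows the power to be taken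
    outside the sum. *)
Lemma lebesgue_outer_le_hausdorff (E : set T) :
  lebesgue_outer E <= H E `^ (n%:R / delta).
Proof.
have nd1 : (1 <= n%:R / delta)%R by rewrite ler_pdivlMr// mul1r.
have nd0 : (0 < n%:R / delta)%R by apply: lt_le_trans nd1.
have L0 : 0 <= lebesgue_outer E.
  by apply: cube_content_ge0 => r r0; rewrite exprn_ge0// ltW.
rewrite -(poweRVK nd0 L0); apply: le_poweR; [exact: ltW|exact: poweR_ge0|].
apply: le_ereal_inf_tmp => _ [D [P [EP ->]]].
have S0 : 0 <= \esum_(i in D) (edge (P i) `^ delta)%:E.
  by apply: esum_ge0 => i _; rewrite lee_fin powR_ge0.
rewrite -(poweRKV nd0 S0); apply: le_poweR; [by rewrite invr_ge0 ltW|by []|].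
apply: (@le_trans _ _ (\esum_(i in D) (edge (P i) ^+ n)%:E)).
  by apply: ereal_inf_lbound; exists D, P.
apply: le_trans (esum_powR_le _ _ nd1); last by move=> i; exact: powR_ge0.
apply: le_esum => i _; rewrite lee_fin -powRrM mulrCA divff ?gt_eqF// mulr1.
by rewrite powR_mulrn// ltW// edge_gt0.
Qed.

(** The lower bound comes from volume: l^n = |Q| <= H(Q)^(n/delta). *)
Lemma hausdorff_content_cube (Q : cube R n) : H Q = (edge Q `^ delta)%:E.
Proof.
apply/eqP; rewrite eq_le; apply/andP; split.
  apply: ereal_inf_lbound; exists [set 0%N], (fun=> Q); split.
    by move=> x Qx; exists 0%N.
  by rewrite esum_set1// lee_fin powR_ge0.
have n0 : (0 < n%:R :> R)%R by apply: lt_le_trans delta_le_n.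
have nd0 : (0 < n%:R / delta)%R by rewrite divr_gt0.
have := lebesgue_outer_le_hausdorff Q; rewrite lebesgue_outer_cube => QH.
rewrite -(poweRKV nd0 (hausdorff_content_ge0 _ _)).
have -> : (edge Q `^ delta)%:E = (edge Q ^+ n)%:E `^ (n%:R / delta)^-1.
  rewrite poweR_EFin -powR_mulrn ?ltW ?edge_gt0// -powRrM; congr (powR _ _)%:E.
  by field; rewrite !gt_eqF.
apply: le_poweR => //; first by rewrite invr_ge0 ltW.
by rewrite lee_fin exprn_ge0// ltW ?edge_gt0.
Qed.
End contents_of_cubes.

(* The pair (k, m) encodes the dyadic cube with corner 2^k m and edge 2^k. *)
Definition dyadic (n : nat) : Type := (int * {ffun 'I_n -> int})%type.
HB.instance Definition _ n := Countable.on (dyadic n).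

(** * Dyadic cubes *)

Section dyadic_cubes.
Context {R : realType} {n : nat}.
Local Notation T := 'rV[R]_n.
Implicit Types (P Q S : dyadic n) (x y : T) (j k : int).

Lemma exp2z_gt0 k : (0 < (2 : R) ^ k)%R.
Proof. by rewrite exprz_gt0. Qed.

Definition dcube P : cube R n :=
  Cube (\row_i ((P.2 i)%:~R * 2 ^ P.1)%R) (exp2z_gt0 P.1).

(** For left-open intervals, m < x / 2^k <= m + 1 forces m to be the ceiling minus 1. *)
Definition cell k x : dyadic n :=
  (k, [ffun i => (Num.ceil (x ord0 i / 2 ^ k) - 1)%R]).

(** Levels are compared explicitly so that the order is antisymmetric in dimension 0 too, where all
    cubes are the same set. *)
Definition dle P Q : Prop :=
  (P.1 <= Q.1)%R /\ (dcube P : set T) `<=` (dcube Q : set T).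

Lemma mem_dcubeP P x : (dcube P : set T) x <-> cell P.1 x = P.
Proof.
have k0 := exp2z_gt0 P.1; case: P => k m /= in k0 *; split.
- move=> /= xP; congr pair; apply/ffunP => i; rewrite ffunE.
  apply/eqP; rewrite subr_eq; apply/eqP; apply: ceil_def.
  have := xP i; rewrite /= mxE addrK ltr_pdivlMr// ler_pdivrMr// intrD.
  by rewrite mulrDl mul1r.
- move=> [<-] i; rewrite /= mxE ffunE.
  have := ceil_itv (x ord0 i / 2 ^ k); rewrite ltr_pdivlMr// ler_pdivrMr//.
  by move=> /andP[-> /le_trans]; apply; rewrite intrB mulrBl mul1r subrK.
Qed.

Lemma cell_mem k x : (dcube (cell k x) : set T) x.
Proof. exact/mem_dcubeP. Qed.

(** 2^k is an integer multiple m of 2^j, so the endpoints of coarse intervals lie on the fine grid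
    and a fine interval cannot straddle one; [h1] and [h2] are this integrality argument. *)
Lemma cell_coarser j k x y : (j <= k)%R -> cell j x = cell j y -> cell k x = cell k y.
Proof.
move=> jk xy; have j0 := exp2z_gt0 j.
have [m mE] : exists m : nat, ((2 : R) ^ k = m%:R * 2 ^ j)%R.
  exists (2 ^ `|k - j|)%N; rewrite natrX -[RHS]/(_ * _)%R.
  have -> : ((2 : R) ^+ `|k - j| = 2 ^ (k - j))%R.
    by rewrite -[RHS]/(_ ^ _)%R -{2}(@gez0_abs (k - j)) ?subr_ge0.
  by rewrite -expfzDr ?subrK.
have yP := cell_mem j y; rewrite -xy in yP; have xP := cell_mem j x.
have xR := cell_mem k x.
apply/esym/(mem_dcubeP (cell k x) y) => i; move: (yP i) (xP i) (xR i).
rewrite /= !mxE !ffunE mE.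
set a := (Num.ceil (_ / 2 ^ j) - 1)%R; set c := (Num.ceil (_ / _) - 1)%R.
clearbody a c.
move=> /andP[y1 y2] /andP[x1 x2] /andP[x3 x4].
have h1 : (c * m%:Z <= a)%R.
  rewrite -ltzD1 -(@ltr_int R) -(@ltr_pM2r _ (2 ^ j)%R)//.
  rewrite intrD intrM mulrDl mul1r -mulrA; exact: lt_le_trans x3 x2.
have h2 : (a + 1 <= c * m%:Z + m%:Z)%R.
  rewrite lezD1 -(@ltr_int R) -(@ltr_pM2r _ (2 ^ j)%R)//.
  rewrite intrD intrM mulrDl -mulrA; exact: lt_le_trans x1 x4.
move: h1 h2; rewrite -!(@ler_int R) !intrD !intrM -!pmulrn => h1 h2.
have := ler_wpM2r (ltW j0) h1; have := ler_wpM2r (ltW j0) h2.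
by move=> h3 h4; apply/andP; split; lra.
Qed.

Lemma dle_refl P : dle P P. Proof. by split. Qed.

Lemma dle_trans P Q S : dle P Q -> dle Q S -> dle P S.
Proof.
by move=> [a b] [c d]; split; [exact: le_trans c|exact: subset_trans d].
Qed.

Lemma dle_of_meet P Q x : (P.1 <= Q.1)%R ->
  (dcube P : set T) x -> (dcube Q : set T) x -> dle P Q.
Proof.
move=> PQ /mem_dcubeP xP /mem_dcubeP xQ; split => // y /mem_dcubeP yP.
by apply/mem_dcubeP; rewrite -xQ; apply: (cell_coarser PQ); rewrite yP.
Qed.

Lemma dle_total P Q x : (dcube P : set T) x -> (dcube Q : set T) x -> dle P Q \/ dle Q P.
Proof.
move=> xP xQ; have [PQ|/ltW QP] := leP P.1 Q.1.
- by left; exact: dle_of_meet xP xQ.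
- by right; exact: dle_of_meet xQ xP.
Qed.

Lemma dcube_inj P Q x : P.1 = Q.1 -> (dcube P : set T) x -> (dcube Q : set T) x -> P = Q.
Proof. by move=> PQ /mem_dcubeP <- /mem_dcubeP <-; rewrite PQ. Qed.

Lemma dcube_nonempty P : exists x, (dcube P : set T) x.
Proof.
exists (\row_i (corner (dcube P) ord0 i + edge (dcube P)))%R => i.
by rewrite !mxE lexx ltrDl edge_gt0.
Qed.

Lemma dle_anti P Q : dle P Q -> dle Q P -> P = Q.
Proof.
move=> [PQ PQs] [QP _]; have [x Px] := dcube_nonempty P.
by apply: (dcube_inj (x := x)) => //; [apply/eqP; rewrite eq_le PQ|exact: PQs].
Qed.

Lemma exists_exp2z_itv (l : R) : (0 < l)%R -> exists k, (l <= 2 ^ k < 2 * l)%R.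
Proof.
move=> l0; have ln2 : (0 < ln (2 : R))%R by rewrite ln_gt0// ltr1n.
have lE : (l = 2 `^ (ln l / ln 2))%R.
  by rewrite /powR pnatr_eq0/= divfK ?gt_eqF// lnK// posrE.
exists (Num.ceil (ln l / ln 2)); rewrite -powR_intmul//.
have /andP[h1 h2] := ceil_itv (ln l / ln 2).
apply/andP; split; first by rewrite {1}lE ler_powR ?ler1n.
rewrite [X in (_ < _ * X)%R]lE.
have -> : (2 * 2 `^ (ln l / ln 2) = (2 : R) `^ (1 + ln l / ln 2))%R.
  by rewrite powRD ?powRr1// pnatr_eq0 implybT.
rewrite /powR pnatr_eq0/= ltr_expR ltr_pM2r//.
by move: h1; rewrite intrD ltrBlDr addrC.
Qed.

(** As 2^k is at least the edge of [Q], each side of [Q] meets at most two consecutive dyadic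
    intervals; the bit [e i] tells which of them is used in coordinate i. *)
Lemma dyadic_cover (Q : cube R n) : exists k (P : {ffun 'I_n -> bool} -> dyadic n),
  [/\ (edge Q <= 2 ^ k < 2 * edge Q)%R, forall e, (P e).1 = k &
      (Q : set T) `<=` \bigcup_(e in [set: {ffun 'I_n -> bool}]) (dcube (P e) : set T)].
Proof.
have [k kQ] := exists_exp2z_itv (edge_gt0 Q); have k0 := exp2z_gt0 k.
pose b i := (Num.ceil (corner Q ord0 i / 2 ^ k) - 1)%R.
exists k, (fun e : {ffun 'I_n -> bool} => (k, [ffun i => (b i + (nat_of_bool (e i))%:Z)%R])); split => // x Qx.
exists [ffun i => (Num.ceil (x ord0 i / 2 ^ k) - 1)%R != b i] => //.
apply/mem_dcubeP => /=; congr pair; apply/ffunP => i; rewrite !ffunE.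
case: eqVneq => [->|ne]; first by rewrite addr0.
have /andP[x1 x2] := Qx i; apply/eqP; rewrite eq_le; apply/andP; split.
- rewrite /b subrK lerBlDr.
  have -> : (Num.ceil (corner Q ord0 i / 2 ^ k) + 1 =
      Num.ceil (corner Q ord0 i / 2 ^ k + 1))%R.
    by rewrite ceilDrz// ceil1.
  apply: le_ceil; rewrite ler_pdivrMr// mulrDl divfK ?gt_eqF// mul1r.
  by apply: (le_trans x2); rewrite lerD2l; case/andP: kQ.
- rewrite /= lezD1 lt_neqAle eq_sym ne /b lerD2r/=; apply: le_ceil.
  by rewrite ler_pM2r ?invr_gt0// ltW.
Qed.
End dyadic_cubes.

Lemma esum_swap_cond {R : realType} {T U : choiceType} (D : set T) (E : set U)
    (r : T -> U -> Prop) (a : T -> U -> \bar R) : (forall i j, 0 <= a i j) ->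
  \esum_(i in D) \esum_(j in E `&` [set j | r i j]) a i j =
  \esum_(j in E) \esum_(i in D `&` [set i | r i j]) a i j.
Proof.
move=> a0.
transitivity (\esum_(i in D) \esum_(j in E) (if `[< r i j >] then a i j else 0)).
  apply: eq_esum => i _; rewrite esum_mkcondr; apply: eq_esum => j _.
  by rewrite (_ : (j \in _) = `[< r i j >])//; apply/idP/asboolP => [/set_mem|/mem_set].
rewrite esum_swap; last by move=> i j; case: ifP.
apply: eq_esum => j _; rewrite [RHS]esum_mkcondr; apply: eq_esum => i _.
by rewrite (_ : (i \in _) = `[< r i j >])//; apply/idP/asboolP => [/set_mem|/mem_set].
Qed.

(** * Packing conditions and superadditivity up to a constant *)

Section packing.
Context {R : realType} {n : nat} (delta : R).
Hypotheses (delta_gt0 : (0 < delta)%R) (delta_le_n : (delta <= n%:R)%R).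
Local Notation T := 'rV[R]_n.
Local Notation H := (@hausdorff_content R n delta).
Local Notation I := (@choquet R n delta).
Local Notation dcube := (@dcube R n).
Local Notation dle := (@dle R n).
Implicit Types (P Q S : dyadic n).

(* A cube is covered by [2^n] dyadic cubes of at most twice its edge length. *)
Definition dyadic_ratio : R := (#|{ffun 'I_n -> bool}|%:R * 2 `^ delta)%R.
Local Notation kappa := dyadic_ratio.

Lemma dyadic_ratio_gt0 : (0 < kappa)%R.
Proof.
rewrite mulr_gt0 ?powR_gt0// ltr0n; apply/card_gt0P.
by exists [ffun => true].
Qed.

(* The packing condition bounds the mass of the cubes inside a given dyadic cube;
   the last hypothesis says that a dyadic cube lies in at most one cube of the family
   whose distinguished part [E i] it meets. *)
Lemma hausdorff_content_superadditive (J : countType) (D : set J) (P : J -> dyadic n)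
    (E : J -> set T) (A : R) : (0 <= A)%R ->
  (forall S, \esum_(i in D `&` [set i | dle (P i) S]) H (dcube (P i)) <= A%:E * H (dcube S)) ->
  (forall i, D i -> E i `<=` dcube (P i)) ->
  (forall S i j, D i -> D j -> dle S (P i) -> dle S (P j) ->
    dcube S `&` E i !=set0 -> dcube S `&` E j !=set0 -> i = j) ->
  forall F, \esum_(i in D) H (F `&` E i) <= (kappa * (A + 1))%:E * H F.
Proof.
move=> A0 pack EP uniq F.
have H0 B : 0 <= H B by exact: hausdorff_content_ge0.
have step (L : countType) (X : set L) (S : L -> dyadic n) :
    F `<=` \bigcup_(l in X) dcube (S l) ->
    \esum_(i in D) H (F `&` E i) <= (A + 1)%:E * \esum_(l in X) H (dcube (S l)).
  move=> FS.
  (* If [P i] lies in some [S l], its whole content is charged there, and packing bounds these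
     charges by A times the content of [S l]. Otherwise [F] and [E i] meet only inside cubes [S l]
     contained in [P i], and [uniq] lets each [S l] be charged by a single i. Hence A + 1. *)
  apply: (@le_trans _ _ (\esum_(i in D)
    (\esum_(l in X `&` [set l | dle (S l) (P i) /\ dcube (S l) `&` E i !=set0]) H (dcube (S l)) +
     \esum_(l in X `&` [set l | dle (P i) (S l)]) H (dcube (P i))))).
    apply: le_esum => i Di.
    have [[l [Xl PS]]|noS] := pselect (exists l, X l /\ dle (P i) (S l)).
      apply: (@le_trans _ _ (H (dcube (P i)))).
        by apply: le_hausdorff_content => x [_ /EP]; exact.
      apply: (@le_trans _ _ (\esum_(l in X `&` [set l | dle (P i) (S l)]) H (dcube (P i)))).
        by apply: (esum_ge_term (a := fun=> H (dcube (P i))) (i := l)) => //; split.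
      by rewrite leeDr// esum_ge0.
    apply: (@le_trans _ _ (\esum_(l in X `&`
        [set l | dle (S l) (P i) /\ dcube (S l) `&` E i !=set0]) H (dcube (S l)))); last first.
      by rewrite leeDl// esum_ge0.
    apply: hausdorff_content_esum => x [Fx Ex]; have [l Xl Sx] := FS _ Fx.
    exists l => //; split => //; split; last by exists x.
    have [SP|PS] := dle_total Sx (EP _ Di _ Ex); first by [].
    by exfalso; apply: noS; exists l.
  rewrite esumD; try by move=> i _; exact: esum_ge0.
  rewrite (@esum_swap_cond _ _ _ D X (fun i l => dle (S l) (P i) /\ dcube (S l) `&` E i !=set0) (fun i l => H (dcube (S l))))//.
  rewrite (@esum_swap_cond _ _ _ D X (fun i l => dle (P i) (S l)) (fun i l => H (dcube (P i))))//.
  rewrite -esumD; try by move=> l _; exact: esum_ge0.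
  rewrite -esumZl ?addr_ge0//; apply: le_esum => l Xl.
  rewrite [leLHS]addeC EFinD ge0_muleDl ?lee_fin// mul1e; apply: leeD; first exact: pack.
  apply: esum_le_unique => // [i j [Di [dSi Ei]] [Dj [dSj Ej]]|i _]; last by rewrite H0 lexx.
  exact: uniq dSi dSj Ei Ej.
rewrite mulrC EFinM -muleA -lee_pdivrMl ?ltr_pwDr//.
rewrite -lee_pdivrMl ?dyadic_ratio_gt0//; apply: le_ereal_inf_tmp => _ [X [Q [FQ ->]]].
rewrite lee_pdivrMl ?dyadic_ratio_gt0// lee_pdivrMl ?ltr_pwDr//.
have /choice[k /choice[S SP]] : forall l, exists k (P : {ffun 'I_n -> bool} -> dyadic n),
  [/\ (edge (Q l) <= 2 ^ k < 2 * edge (Q l))%R, forall e, (P e).1 = k &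
      (Q l : set T) `<=` \bigcup_(e in [set: {ffun 'I_n -> bool}]) dcube (P e)].
  by move=> l; exact: dyadic_cover.
apply: (le_trans (@step (nat * {ffun 'I_n -> bool})%type (X `*` setT) (fun z => S z.1 z.2) _)).
  move=> x /FQ [l Xl Qx]; have [_ _ /(_ _ Qx) [e _ Sx]] := SP l.
  by exists (l, e).
rewrite lee_pmul2l ?lte_fin ?ltr_pwDr//.
rewrite -(@esum_esum _ _ _ X (fun=> setT) (fun l e => H (dcube (S l e))))//.
rewrite -esumZl ?(ltW dyadic_ratio_gt0)//; last by move=> l; rewrite lee_fin powR_ge0.
apply: le_esum => l Xl; rewrite esum_finType//.
have [/andP[_ k2] Sk _] := SP l.
apply: (@le_trans _ _ (\sum_(e : {ffun 'I_n -> bool}) (2 `^ delta * edge (Q l) `^ delta)%:E)).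
  apply: lee_sum => e _; have e0 := ltW (edge_gt0 (Q l)).
  rewrite hausdorff_content_cube// lee_fin -powRM//.
  by apply: ge0_ler_powR; rewrite ?nnegrE ?mulr_ge0// ?(ltW delta_gt0)// ltW//= Sk ?exp2z_gt0.
by rewrite sumEFin sumr_const -EFinM /dyadic_ratio mulr_natl mulrnAl.
Qed.

Lemma choquet_superadditive_packing (J : countType) (D : set J) (P : J -> dyadic n)
    (E : J -> set T) (A : R) (U : set T) F : (0 <= A)%R ->
  (forall S, \esum_(i in D `&` [set i | dle (P i) S]) H (dcube (P i)) <= A%:E * H (dcube S)) ->
  (forall i, D i -> E i `<=` dcube (P i)) ->
  (forall S i j, D i -> D j -> dle S (P i) -> dle S (P j) ->
    dcube S `&` E i !=set0 -> dcube S `&` E j !=set0 -> i = j) ->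
  (forall i, D i -> E i `<=` U) ->
  \esum_(i in D) I (E i) F <= (kappa * (A + 1))%:E * I U F.
Proof.
move=> A0 pack EP uniq EU; apply: choquet_superadditive => //.
  by rewrite mulr_ge0 ?addr_ge0// ltW// dyadic_ratio_gt0.
exact: hausdorff_content_superadditive pack EP uniq.
Qed.
End packing.

Lemma finite_subset_chain (T : choiceType) (F : set (set T)) (Y : set T) :
  finite_set Y -> total_on F subset -> Y `<=` \bigcup_(X in F) X ->
  Y = set0 \/ exists2 X, F X & Y `<=` X.
Proof.
move=> /finite_seqP[s ->] totF; elim: s => [|y s IH] sF; first by left; rewrite set_nil.
right; have [X FX Xy] := sF y (mem_head _ _).
have [|s0|[Z FZ sZ]] := IH.
- by move=> z zs; apply: sF; rewrite /= inE zs orbT.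
- exists X => // z /=; rewrite inE => /predU1P[->//|zs].
  by have : [set` s] z by []; rewrite s0.
- have [XZ|ZX] := totF _ _ FX FZ.
  + exists Z => // z /=; rewrite inE => /predU1P[->|/sZ//]; exact: XZ.
  + by exists X => // z /=; rewrite inE => /predU1P[->//|/sZ/ZX].
Qed.

(** * Weights with the A_infinity property *)

Section weights.
Context {R : realType} {n : nat} (delta : R).
Hypotheses (delta_gt0 : (0 < delta)%R) (delta_le_n : (delta <= n%:R)%R).
Local Notation T := 'rV[R]_n.
Local Notation H := (@hausdorff_content R n delta).
Local Notation I := (@choquet R n delta).
Local Notation dcube := (@dcube R n).
Local Notation dle := (@dle R n).
Local Notation kappa := (@dyadic_ratio R n delta).
Implicit Types (P Q S : dyadic n).

(** What the stopping-time arguments require of a weight. Both members of a Muckenhoupt pair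
    qualify, and so do A_1 weights. *)
Record regular_weight (v : T -> \bar R) : Prop := {
  weight_ge0 : forall x, 0 <= v x;
  weight_cube : forall Q : cube R n, 0 < I Q v < +oo;
  weight_ainfty : forall theta : R, (0 < theta)%R -> exists2 B : R, (0 < B)%R &
    forall (Q : cube R n) (F : set T), F `<=` (Q : set T) ->
      theta%:E * H Q <= H F -> I Q v <= B%:E * I F v }.

Lemma content_dcubeE P : H (dcube P) = (((2 : R) ^ P.1) `^ delta)%:E.
Proof. by rewrite hausdorff_content_cube. Qed.

(** The children with indices 2m and 2m + 1 in all coordinates are distinct since n >= 1, so one of
    them differs from [P]. This supplies siblings off a chain of ancestors. *)
Lemma exists_child S P : exists P', [/\ P'.1 = (S.1 - 1)%R, dle P' S & P' <> P].
Proof.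
have n0 : (0 < n)%N by rewrite -(ltr0n R) (lt_le_trans delta_gt0).
case: S => k m /=.
have sub (b : bool) : dle ((k - 1)%R, [ffun i => (2 * m i + b%:Z)%R]) (k, m).
  split; first by rewrite /= lerBlDr lerDl.
  move=> x xP i; move: (xP i) => {xP}; rewrite /= !mxE !ffunE.
  have -> : ((2 : R) ^ k = 2 * 2 ^ (k - 1))%R.
    by rewrite -{2}(expr1z (2 : R)) -expfzDr// addrC subrK.
  have := exp2z_gt0 (R := R) (k - 1); set J := (2 ^ (k - 1))%R => J0.
  rewrite intrD intrM -!pmulrn; case: b => /=; rewrite ?addr0; move=> /andP[x1 x2]; apply/andP; split; nra.
have [->|h] := pselect (P = ((k - 1)%R, [ffun i => (2 * m i + false%:Z)%R])).
  exists ((k - 1)%R, [ffun i => (2 * m i + true%:Z)%R]); split => //.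
  move=> [] /ffunP/(_ (Ordinal n0)); rewrite !ffunE => /addrI //.
by exists ((k - 1)%R, [ffun i => (2 * m i + false%:Z)%R]); split => // /esym.
Qed.

Lemma two_powR_gt1 : (1 < 2 `^ delta :> R)%R.
Proof. by rewrite /powR pnatr_eq0/= expR_gt1 mulr_gt0// ln_gt0// ltr1n. Qed.

(** With one cube per level, the contents of those inside [S] form part of a geometric progression
    of ratio 2^delta that ends at the content of [S]. *)
Lemma dyadic_levels_packing (P : nat -> dyadic n) (k : int) (N : nat) S :
  (forall i, (P i).1 = (k + i%:Z)%R) ->
  \esum_(i in `I_N `&` [set i | dle (P i) S]) H (dcube (P i)) <=
    ((2 `^ delta - 1)^-1 * 2 `^ delta)%:E * H (dcube S).
Proof.
move=> Pk; pose r : R := (2 `^ delta)%R.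
have r1 : (0 < r - 1)%R by rewrite subr_gt0 two_powR_gt1.
rewrite -/r content_dcubeE; have [kS|Sk] := leP k S.1; last first.
  rewrite esum1 ?mule_ge0 ?lee_fin ?powR_ge0 ?mulr_ge0 ?invr_ge0 ?powR_ge0 ?ltW//.
  move=> i [_ [/= + _]]; rewrite Pk => ki; exfalso.
  by move: (le_lt_trans ki Sk); rewrite gtrDl.
pose M := `|S.1 - k|%N.
have ME : S.1 = (k + M%:Z)%R by rewrite /M gez0_abs ?subr_ge0// subrKC.
have powE (i : nat) : (((2 : R) ^ (k + i%:Z)) `^ delta = ((2 ^ k) `^ delta) * r ^+ i)%R.
  rewrite expfzDr// powRM ?ltW ?exp2z_gt0//; congr (_ * _)%R.
  exact: powR_exprn.
apply: (@le_trans _ _ (\esum_(i in `I_M.+1) (((2 ^ k) `^ delta) * r ^+ i)%:E)).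
  apply: (@le_trans _ _ (\esum_(i in `I_M.+1) H (dcube (P i)))).
    apply: le_esum_subset => i [_ [/= + _]]; rewrite Pk ME.
    by rewrite lerD2l lez_nat ltnS.
  by apply: le_esum => i _; rewrite content_dcubeE Pk powE.
rewrite esum_fset//; last by move=> i _; rewrite lee_fin mulr_ge0 ?exprn_ge0 ?powR_ge0.
rewrite -fsbig_ord sumEFin lee_fin -mulr_sumr ME powE.
rewrite mulrCA ler_pM2l ?powR_gt0 ?exp2z_gt0// -mulrA ler_pdivlMl//.
rewrite -subrX1 exprS. by rewrite gerBl.
Qed.

Variables (v : T -> \bar R) (rv : regular_weight v).

Lemma weight_cube_fin (Q : cube R n) : I Q v \is a fin_num.
Proof. by have /andP[v0 voo] := weight_cube rv Q; rewrite ge0_fin_numE// ltW. Qed.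

(** The smaller cube carries at least the proportion m^(-delta) of the content of the larger one. *)
Lemma weight_doubling (m : R) : (0 < m)%R -> exists2 B : R, (0 < B)%R &
  forall Q Q' : cube R n, (Q : set T) `<=` (Q' : set T) -> (edge Q' <= m * edge Q)%R ->
    I Q' v <= B%:E * I Q v.
Proof.
move=> m0; have [] := @weight_ainfty _ rv (m `^ (- delta))%R; first exact: powR_gt0.
move=> B B0 BP; exists B => // Q Q' QQ' mQ; apply: BP => //.
rewrite !hausdorff_content_cube// lee_fin powRN ler_pdivrMl ?powR_gt0//.
have e0 (Q0 : cube R n) := ltW (edge_gt0 Q0).
rewrite -powRM ?e0 ?(ltW m0)//.
by apply: ge0_ler_powR; rewrite ?nnegrE ?mulr_ge0 ?e0 ?(ltW m0) ?(ltW delta_gt0).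
Qed.

(* Along a chain of dyadic ancestors of [P], the siblings of the chain members are
   disjoint and packed, and doubling gives each of them a weight comparable to at
   least that of [P]; superadditivity makes the weight of the ancestors unbounded. *)
Lemma weight_growth P (M : R) : exists N : nat, forall Q, dle P Q -> I (dcube Q) v <= M%:E ->
  (Q.1 <= P.1 + N%:Z)%R.
Proof.
have [x Px] := dcube_nonempty (R := R) P.
pose Pi (i : nat) := cell (P.1 + i%:Z)%R x.
have P0 : Pi 0%N = P by rewrite /Pi addr0; exact/mem_dcubeP.
have Pmono i j : (i <= j)%N -> dle (Pi i) (Pi j).
  by move=> ij; apply: (dle_of_meet (x := x)); rewrite /= ?lerD2l ?lez_nat//; exact: cell_mem.
have /choice[P' P'P] : forall i, exists P', [/\ P'.1 = ((Pi i.+1).1 - 1)%R, dle P' (Pi i.+1) & P' <> Pi i].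
  by move=> i; exact: exists_child.
have P'1 i : (P' i).1 = (P.1 + i%:Z)%R.
  by have [-> _ _] := P'P i; rewrite /= -addn1 PoszD addrA addrK.
(* For a < b the cube [P' a] lies in [Pi b], whereas [P' b] is another cube of the level of
   [Pi b]. *)
have disj i j y : (dcube (P' i) : set T) y -> (dcube (P' j) : set T) y -> i = j.
  suff h a b : (a < b)%N -> (dcube (P' a) : set T) y -> (dcube (P' b) : set T) y -> False.
    by case: (ltngtP i j) => // ij yi yj; exfalso; [exact: h ij yi yj|exact: h ij yj yi].
  move=> ab ya yb; have [_ [_ sub] _] := P'P a; have [_ _ ne] := P'P b; apply: ne.
  have lev : (P' b).1 = (Pi b).1 by rewrite P'1.
  exact: dcube_inj lev yb ((Pmono _ _ ab).2 _ (sub _ ya)).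
have [B B0 BP] := @weight_doubling 2 (ltr0n _ _).
pose A : R := ((2 `^ delta - 1)^-1 * 2 `^ delta)%R.
have A0 : (0 <= A)%R.
  by rewrite mulr_ge0 ?powR_ge0// invr_ge0 ltW// subr_gt0 two_powR_gt1.
pose C := (kappa * (A + 1))%R.
have C0 : (0 < C)%R by rewrite mulr_gt0 ?dyadic_ratio_gt0 ?ltr_pwDr.
have sumle N : \esum_(i in `I_N) I (dcube (P' i)) v <= C%:E * I (dcube (Pi N)) v.
  apply: choquet_superadditive_packing => //.
  - by move=> S; exact: dyadic_levels_packing.
  - by move=> i _ y.
  - move=> S i j _ _ [_ Si] [_ Sj] _ _; have [y Sy] := dcube_nonempty (R := R) S.
    by apply: (disj _ _ y); [exact: Si|exact: Sj].
  - move=> i iN; have [_ [_ sub] _] := P'P i.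
    by apply: subset_trans sub _; exact: (Pmono _ _ iN).2.
have vP' i : I (dcube P) v <= B%:E * I (dcube (P' i)) v.
  have [lev [_ sub] _] := P'P i.
  apply: (@le_trans _ _ (I (dcube (Pi i.+1)) v)).
    by apply: le_choquet => //; rewrite -P0; exact: (Pmono _ _ (leq0n _)).2.
  apply: BP => //=; rewrite P'1 (_ : Posz i.+1 = (i%:Z + 1)%R); last by rewrite -addn1 PoszD.
  by rewrite addrA expfzDr// expr1z mulrC.
have v0 : (0 < fine (I (dcube P) v))%R by rewrite fine_gt0//; exact: weight_cube.
(* [sumle] and [vP'] give N v(P) / B <= C v(Pi N); this N pushes v(Pi N) above M. *)
pose N := (Num.truncn (C * B * M / fine (I (dcube P) v))%R).+1.
have vN : M%:E < I (dcube (Pi N)) v.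
  have : (B^-1 * fine (I (dcube P) v) *+ N)%:E <= C%:E * I (dcube (Pi N)) v.
    apply: le_trans (sumle N).
    rewrite esum_fset//; last by move=> i _; exact: choquet_ge0.
    rewrite -fsbig_ord; apply: (@le_trans _ _ (\sum_(i < N) (B^-1 * fine (I (dcube P) v))%:E)).
      by rewrite sumEFin sumr_const card_ord.
    by apply: lee_sum => i _; rewrite EFinM fineK ?weight_cube_fin// lee_pdivrMl.
  rewrite -lee_pdivrMl//; apply: lt_le_trans.
  rewrite -EFinM lte_fin ltr_pdivlMl// -mulr_natl -ltr_pdivrMr ?mulr_gt0 ?invr_gt0//.
  have -> : (C * M / (B^-1 * fine (I (dcube P) v)) = C * B * M / fine (I (dcube P) v))%R.
    by field; rewrite !gt_eqF.
  exact: truncnS_gt.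
exists N => Q [PQ1 PQ] QM; rewrite leNgt; apply/negP => NQ.
suff : M%:E < I (dcube Q) v by rewrite ltNge QM.
apply: (lt_le_trans vN); apply: le_choquet => //.
by apply: (dle_of_meet (x := x) _ (cell_mem _ _) (PQ _ Px)).2; rewrite /= ltW.
Qed.

End weights.

(** * Maximal cubes and packed subfamilies *)

Section packed_subfamilies.
Context {R : realType} {n : nat} (delta : R).
Hypotheses (delta_gt0 : (0 < delta)%R) (delta_le_n : (delta <= n%:R)%R).
Local Notation T := 'rV[R]_n.
Local Notation H := (@hausdorff_content R n delta).
Local Notation I := (@choquet R n delta).
Local Notation dcube := (@dcube R n).
Local Notation dle := (@dle R n).
Implicit Types (P Q S : dyadic n).
Variables (v : T -> \bar R) (rv : regular_weight delta v).

(** By [weight_growth] only boundedly many levels of ancestors of [P] can have weight at most M, so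
    the highest ancestor in [G] exists. *)
Lemma exists_maximal_cube (G : dyadic n -> Prop) (M : R) :
  (forall P, G P -> I (dcube P) v <= M%:E) ->
  forall P, G P -> exists Q, [/\ G Q, dle P Q & forall S, G S -> dle Q S -> S = Q].
Proof.
move=> GM P GP; have [N PN] := weight_growth delta_gt0 delta_le_n rv P M.
have [x Px] := dcube_nonempty (R := R) P.
pose p (i : nat) := `[< G (cell (P.1 + i%:Z)%R x) >].
have p0 : exists i, p i.
  by exists 0%N; apply/asboolP; rewrite addr0 ((mem_dcubeP P x).1 Px).
have up (i : nat) : dle P (cell (P.1 + i%:Z)%R x).
  by apply: (dle_of_meet _ Px (cell_mem _ _)); rewrite /= lerDl.
have pN i : p i -> (i <= N)%N.
  by move=> /asboolP Gi; have := PN _ (up i) (GM _ Gi); rewrite /= lerD2l lez_nat.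
have [i /asboolP Gi imax] := ex_maxnP p0 pN.
exists (cell (P.1 + i%:Z)%R x); split => // S GS [Si /(_ _ (cell_mem _ _)) Sx].
move: Si; rewrite /= => Si.
have PS : (P.1 <= S.1)%R by apply: le_trans Si; rewrite lerDl.
have SE : S.1 = (P.1 + `|S.1 - P.1|%N%:Z)%R by rewrite gez0_abs ?subr_ge0// subrKC.
apply: (dcube_inj (x := x)) => //; last exact: cell_mem.
apply/eqP; rewrite eq_le Si andbT /= SE lerD2l lez_nat; apply: imax.
by apply/asboolP; rewrite -SE ((mem_dcubeP S x).1 Sx).
Qed.

(* Greedy selection: a subfamily maximal for the packing condition with constant 2.
   By maximality a rejected cube lies in a dyadic cube that is already overfull. *)
Lemma exists_packed_subfamily (D : set (dyadic n)) : exists X, [/\ X `<=` D,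
  forall S, \esum_(Q in X `&` [set Q | dle Q S]) H (dcube Q) <= 2%:E * H (dcube S) &
  forall Q, D Q -> ~ X Q -> exists2 S, dle Q S &
    H (dcube S) < \esum_(Q in X `&` [set Q | dle Q S]) H (dcube Q)].
Proof.
have H0 A : 0 <= H A by exact: hausdorff_content_ge0.
pose pk (X : set (dyadic n)) := X `<=` D /\ forall S,
  \esum_(Q in X `&` [set Q | dle Q S]) H (dcube Q) <= 2%:E * H (dcube S).
(* Packing passes to unions of chains: a sum is the supremum of its finite subsums, and a finite
   part of the union lies in one member of the chain. *)
have [|X [[XD Xpk] Xmax]] := @Zorn_bigcup _ pk.
  move=> F Fpk totF; split; first by move=> Q [Y FY YQ]; exact: (Fpk _ FY).1.
  move=> S; apply: ge_ereal_sup => _ [Y [finY YS] <-].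
  have [|->|[Z FZ YZ]] := finite_subset_chain finY totF.
  - by move=> Q /YS [].
  - by rewrite fsbig_set0 mule_ge0// lee_fin.
  - apply: le_trans ((Fpk _ FZ).2 S); apply: esum_ge; exists Y => //.
    by split => // Q YQ; split; [exact: YZ|exact: (YS _ YQ).2].
exists X; split => // Q DQ XQ; apply: contrapT => noS.
(* If no cube above [Q] were overfull, adding [Q] would raise a sum of at most H(S) by at most H(S),
   which constant 2 permits. *)
apply: (Xmax (X `|` [set Q])).
  split; first by move=> P XP; left.
  by move=> /(_ Q) h; apply: XQ; apply: h; right.
split; first by move=> P [/XD//|->].
move=> S; have [QS|nQS] := pselect (dle Q S); last first.
  rewrite (_ : _ `&` _ = X `&` [set Q | dle Q S])//.
  apply/seteqP; split => P [XP PS]; split => //; last by left.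
  by case: XP => // PQ; exfalso; apply: nQS; rewrite -PQ.
rewrite (esumID [set Q])//.
have -> : 2%:E * H (dcube S) = H (dcube S) + H (dcube S).
  by rewrite (_ : 2%R = 1 + 1)%R// EFinD ge0_muleDl// mul1e.
apply: leeD.
  apply: (@le_trans _ _ (\esum_(P in [set Q]) H (dcube P))).
    by apply: le_esum_subset => P [].
  by rewrite esum_set1//; apply: le_hausdorff_content; exact: QS.2.
have [|SX] := leP (\esum_(P in X `&` [set P | dle P S]) H (dcube P)) (H (dcube S)).
  by apply: le_trans; apply: le_esum_subset => P [[[XP|PQ] PS] nPQ].
by exfalso; apply: noS; exists S.
Qed.

Variable F : T -> \bar R.

Definition good (t : R) P : Prop := t%:E * I (dcube P) v <= I (dcube P) F.

Lemma le_good (s t : R) P : (s <= t)%R -> good t P -> good s P.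
Proof. by move=> st; apply: le_trans; rewrite lee_wpmul2r ?choquet_ge0// lee_fin. Qed.

End packed_subfamilies.

(** * Stopping cubes for one level *)

Section stopping_time.
Context {R : realType} {n : nat} (delta : R).
Hypotheses (delta_gt0 : (0 < delta)%R) (delta_le_n : (delta <= n%:R)%R).
Local Notation T := 'rV[R]_n.
Local Notation H := (@hausdorff_content R n delta).
Local Notation I := (@choquet R n delta).
Local Notation dcube := (@dcube R n).
Local Notation dle := (@dle R n).
Local Notation kappa := (@dyadic_ratio R n delta).
Implicit Types (P Q S : dyadic n).
Variables (v : T -> \bar R) (rv : regular_weight delta v).

Definition disjoint_cubes (X : set (dyadic n)) :=
  forall P Q x, X P -> X Q -> (dcube P : set T) x -> (dcube Q : set T) x -> P = Q.

(** A Carleson condition with the content in place of a measure. *)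
Definition packed (A : R) (X : set (dyadic n)) :=
  forall S, \esum_(Q in X `&` [set Q | dle Q S]) H (dcube Q) <= A%:E * H (dcube S).

Lemma packed_content (X : set (dyadic n)) (A : R) (B : set T) : (0 <= A)%R ->
  disjoint_cubes X -> packed A X ->
  \esum_(Q in X) H (B `&` dcube Q) <= (kappa * (A + 1))%:E * H B.
Proof.
move=> A0 dX pX; apply: (hausdorff_content_superadditive delta_gt0 delta_le_n (P := id) (E := fun Q => dcube Q)) => //; first by move=> i _ x.
move=> S P Q XP XQ [_ SP] [_ SQ] _ _; have [x Sx] := dcube_nonempty (R := R) S.
exact: dX XP XQ (SP _ Sx) (SQ _ Sx).
Qed.

Lemma packed_choquet (X : set (dyadic n)) (A : R) (U : set T) F : (0 <= A)%R ->
  disjoint_cubes X -> packed A X -> (forall Q, X Q -> dcube Q `<=` U) ->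
  \esum_(Q in X) I (dcube Q) F <= (kappa * (A + 1))%:E * I U F.
Proof.
move=> A0 dX pX XU; apply: (choquet_superadditive_packing delta_gt0 delta_le_n (P := id) (E := fun Q => dcube Q)) => //; first by move=> i _ x.
move=> S P Q XP XQ [_ SP] [_ SQ] _ _; have [x Sx] := dcube_nonempty (R := R) S.
exact: dX XP XQ (SP _ Sx) (SQ _ Sx).
Qed.

(* Let [X] be a packed subfamily of the maximal cubes good at level [t]. By the
   A_infinity property a dyadic cube overfull with cubes of [X] has its weight controlled
   by theirs, hence is good at level [eta * t]. The maximal elements among [X] and the
   overfull cubes form the required family. *)
Lemma stopping_cubes : exists2 eta : R, (0 < eta <= 1)%R &
  forall (F : T -> \bar R) (t M : R), (0 < t)%R ->
  (forall P, good delta v F (eta * t)%R P -> I (dcube P) v <= M%:E) ->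
  exists X : set (dyadic n), [/\ forall P, X P -> good delta v F (eta * t)%R P,
    disjoint_cubes X, packed 2 X &
    forall P, good delta v F t P -> exists2 Q, X Q & dle P Q].
Proof.
have H0 A : 0 <= H A by exact: hausdorff_content_ge0.
have k0 := @dyadic_ratio_gt0 R n delta.
pose K := (kappa * (2 + 1))%R; have K0 : (0 < K)%R by rewrite mulr_gt0.
(* In an overfull S the cubes of X have union U with H(S) < sum H(Q) <= K H(U), so U carries the
   proportion 1/K. *)
have [|B B0 BP] := @weight_ainfty _ _ _ _ rv K^-1%R; first by rewrite invr_gt0.
(* For overfull S, t v(S) <= B t sum v(Q) <= B sum F(Q) <= B K F(S). The added 1 makes eta <= 1, so
   cubes good at level t stay good at level eta t. *)
exists (1 + B * K)^-1%R.
  rewrite invr_gt0 ltr_pwDl//= ?(ltW (mulr_gt0 B0 K0))//.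
  by rewrite invf_le1 ?lerDl ?(ltW (mulr_gt0 B0 K0))// ltr_pwDl// ltW// mulr_gt0.
set eta := (1 + B * K)^-1%R; move=> F t M t0 goodM.
have eta1 : (eta <= 1)%R.
  by rewrite invf_le1 ?lerDl ?(ltW (mulr_gt0 B0 K0))// ltr_pwDl// ltW// mulr_gt0.
have goodt P : good delta v F t P -> good delta v F (eta * t)%R P.
  by apply: le_good; rewrite ler_piMl// ltW.
pose D := [set P | good delta v F t P /\ forall S, good delta v F t S -> dle P S -> S = P].
have [X [XD Xpk Xrej]] := exists_packed_subfamily delta D.
have disjD : disjoint_cubes D.
  move=> P Q x [gP Pm] [gQ Qm] Px Qx; have [PQ|QP] := dle_total Px Qx.
  - by rewrite (Pm _ gQ PQ).
  - by rewrite (Qm _ gP QP).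
have disjX : disjoint_cubes X by move=> P Q x /XD DP /XD; exact: disjD.
pose full := [set S | H (dcube S) < \esum_(Q in X `&` [set Q | dle Q S]) H (dcube Q)].
have fullgood S : full S -> good delta v F (eta * t)%R S.
  move=> fS; pose Y := X `&` [set Q | dle Q S].
  have dY : disjoint_cubes Y by move=> P Q x [XP _] [XQ _]; exact: disjX.
  have pY : packed 2 Y.
    move=> Q; apply: le_trans (Xpk Q); apply: le_esum_subset.
    by move=> P [[XP _] PQ].
  have sF : \esum_(Q in Y) I (dcube Q) F <= K%:E * I (dcube S) F.
    by apply: packed_choquet => // Q [_ []].
  have sv : I (dcube S) v <= B%:E * \esum_(Q in Y) I (dcube Q) v.
    pose U := \bigcup_(Q in Y) (dcube Q : set T).
    apply: (@le_trans _ _ (B%:E * I U v)); last first.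
      by rewrite lee_pmul2l//; apply: choquet_subadditive.
    apply: BP; first by move=> x [Q [_ [_ QS]] Qx]; exact: QS.
    rewrite lee_pdivrMl//; apply: (le_trans (ltW fS)).
    apply: le_trans (packed_content U _ dY pY) => //.
    apply: le_esum => Q YQ; apply: le_hausdorff_content => x Qx; split => //.
    by exists Q.
  have st : t%:E * (\esum_(Q in Y) I (dcube Q) v) <= \esum_(Q in Y) I (dcube Q) F.
    rewrite -(esumZl _ (ltW t0)); last by move=> Q; exact: choquet_ge0.
    by apply: le_esum => Q [/XD[gQ _] _].
  rewrite /good /eta EFinM -muleA lee_pdivrMl ?ltr_pwDl ?(ltW (mulr_gt0 B0 K0))//.
  apply: (@le_trans _ _ (t%:E * (B%:E * (\esum_(Q in Y) I (dcube Q) v)))).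
    by rewrite lee_pmul2l.
  rewrite muleCA; apply: (@le_trans _ _ (B%:E * (K%:E * I (dcube S) F))).
    by rewrite lee_pmul2l//; exact: le_trans st sF.
  rewrite muleA -EFinM; apply: lee_wpmul2r; first exact: choquet_ge0.
  by rewrite lee_fin lerDr.
pose G := X `|` full.
have Ggood P : G P -> good delta v F (eta * t)%R P.
  by move=> [/XD[/goodt//]|/fullgood].
pose W := [set P | G P /\ forall S, G S -> dle P S -> S = P].
have disjW : disjoint_cubes W.
  move=> P Q x [gP Pm] [gQ Qm] Px Qx; have [PQ|QP] := dle_total Px Qx.
  - by rewrite (Pm _ gQ PQ).
  - by rewrite (Qm _ gP QP).
have Gmax P : G P -> exists2 Q, W Q & dle P Q.
  move=> GP; have [Q [GQ PQ Qm]] := exists_maximal_cube delta_gt0 delta_le_n rv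
    (fun P GP => goodM P (Ggood P GP)) GP.
  by exists Q.
exists W; split => //.
- by move=> P [/Ggood].
- move=> S; apply: le_trans (Xpk S).
  (* A cube of W belongs to X or is overfull, so its content is at most the X-mass inside it;
     disjointness of W means that each cube of X is charged once. *)
  apply: (@le_trans _ _ (\esum_(P in W `&` [set P | dle P S])
      \esum_(Q in X `&` [set Q | dle Q P]) H (dcube Q))).
    apply: le_esum => P [[[XP|fP] _] _]; last exact: ltW.
    by apply: (esum_ge_term (a := fun Q => H (dcube Q)) (i := P)) => //; split => //; exact: dle_refl.
  rewrite (@esum_swap_cond _ _ _ (W `&` [set P | dle P S]) X (fun P Q => dle Q P) (fun P Q => H (dcube Q)))//.
  rewrite [leRHS]esum_mkcondr; apply: le_esum => Q XQ.
  case: ifPn => [_|/negP QS].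
    apply: esum_le_unique => //; last by move=> P _; rewrite H0 lexx.
    move=> P P' [[WP _] [_ QP]] [[WP' _] [_ QP']].
    have [x Qx] := dcube_nonempty (R := R) Q.
    exact: disjW WP WP' (QP _ Qx) (QP' _ Qx).
  rewrite esum1// => P [[_ PS] QP]; exfalso; apply: QS; apply/mem_set.
  exact: dle_trans QP PS.
- move=> P gP; have [Q [gQ PQ Qm]] := exists_maximal_cube delta_gt0 delta_le_n rv
    (fun P gP => goodM P (goodt P gP)) gP.
  have [XQ|XQ] := pselect (X Q).
    have [Q' WQ' QQ'] := Gmax Q (or_introl XQ).
    by exists Q' => //; exact: dle_trans QQ'.
  have [//|S QS fS] := Xrej Q _ XQ.
  have [Q' WQ' SQ'] := Gmax S (or_intror fS).
  by exists Q' => //; apply: dle_trans SQ'; exact: dle_trans QS.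
Qed.
End stopping_time.

(** * Sparse families and their cores *)

Section sparse_families.
Context {R : realType} {n : nat} (delta : R).
Hypotheses (delta_gt0 : (0 < delta)%R) (delta_le_n : (delta <= n%:R)%R).
Local Notation T := 'rV[R]_n.
Local Notation H := (@hausdorff_content R n delta).
Local Notation I := (@choquet R n delta).
Local Notation dcube := (@dcube R n).
Local Notation dle := (@dle R n).
Local Notation kappa := (@dyadic_ratio R n delta).
Implicit Types (P Q S : dyadic n).

Variable X : nat -> set (dyadic n).
Hypotheses (dX : forall j, @disjoint_cubes R n (X j)) (pX : forall j, @packed R n delta 2 (X j)).
Hypothesis nested : forall j P, X j.+1 P -> exists2 Q, X j Q & dle P Q.
Hypothesis halved : forall j P, X j P ->
  \esum_(Q in X j.+1 `&` [set Q | dle Q P]) H (dcube Q) <= 2^-1%:E * H (dcube P).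

Let s j S := \esum_(Q in X j `&` [set Q | dle Q S]) H (dcube Q).
Let inside j S := exists P, [/\ X j P, dle S P & S <> P].
Let H0 A : 0 <= H A. Proof. exact: hausdorff_content_ge0. Qed.
Let s0 j S : 0 <= s j S. Proof. exact: esum_ge0. Qed.

Lemma nested_le i j P : (i <= j)%N -> X j P -> exists2 Q, X i Q & dle P Q.
Proof.
elim: j P => [|j IH] P; first by rewrite leqn0 => /eqP -> XP; exists P => //; exact: dle_refl.
rewrite leq_eqVlt => /predU1P[->|]; first by move=> XP; exists P => //; exact: dle_refl.
rewrite ltnS => ij /nested [Q XQ PQ]; have [S XS QS] := IH _ ij XQ.
by exists S => //; exact: dle_trans QS.
Qed.

Let disj_dle j P Q S : X j P -> X j Q -> dle S P -> dle S Q -> P = Q.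
Proof.
move=> XP XQ [_ SP] [_ SQ]; have [x Sx] := dcube_nonempty (R := R) S.
exact: dX XP XQ (SP _ Sx) (SQ _ Sx).
Qed.

Let s_half j S : ~ inside j S -> 2%:E * s j.+1 S <= s j S.
Proof.
move=> nin.
apply: (@le_trans _ _ (2%:E * \esum_(P in X j `&` [set P | dle P S])
    \esum_(Q in X j.+1 `&` [set Q | dle Q P]) H (dcube Q))); last first.
  rewrite -esumZl//; last by move=> P; exact: esum_ge0.
  apply: le_esum => P [XP _]; rewrite -lee_pdivlMl//; exact: halved.
rewrite lee_pmul2l//.
rewrite (@esum_swap_cond _ _ _ (X j `&` [set P | dle P S]) (X j.+1) (fun P Q => dle Q P) (fun P Q => H (dcube Q)))//.
rewrite /s esum_mkcondr; apply: le_esum => Q XQ; case: ifPn => [/set_mem/= QS|_]; last exact: esum_ge0.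
have [P XP QP] := nested XQ; have [x Qx] := dcube_nonempty (R := R) Q.
apply: (esum_ge_term (a := fun=> H (dcube Q)) (i := P)) => //; split => //; split => //.
have [//|SP] := dle_total (QP.2 _ Qx) (QS.2 _ Qx).
have [<-|SneP] := pselect (S = P); first exact: dle_refl.
by exfalso; apply: nin; exists P.
Qed.

Let s_inside j S : inside j S -> s j S = 0.
Proof.
move=> [P [XP SP SneP]]; apply: esum1 => Q [XQ QS]; exfalso; apply: SneP.
have QP : Q = P by apply: (disj_dle XQ XP (@dle_refl R n Q)); exact: dle_trans SP.
by apply: (@dle_anti R n) => //; rewrite -QP.
Qed.

(** Generations having a cube strictly larger than S around S contribute nothing inside S. From the
    first other generation on the sums halve, so the total is at most twice the first one, itself at
    most 2 H(S). The induction carries both bounds, with the starting generation free. *)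
Lemma sparse_packing m S : \sum_(j < m) s j S <= 4%:E * H (dcube S).
Proof.
suff h d j0 : \sum_(i < d) s (j0 + i)%N S <= 4%:E * H (dcube S) /\
    (~ inside j0 S -> \sum_(i < d) s (j0 + i)%N S <= 2%:E * s j0 S).
  by have [] := h m 0%N.
elim: d j0 => [|d IH] j0.
  by rewrite big_ord0; split => [|_]; rewrite mule_ge0.
have [IH1 IH2] := IH j0.+1.
rewrite big_ord_recl addn0; under eq_bigr do rewrite lift0 addnS -addSn.
have [ins|nin] := pselect (inside j0 S).
  by rewrite s_inside// add0e; split.
have le2 : s j0 S + \sum_(i < d) s (j0.+1 + i)%N S <= 2%:E * s j0 S.
  rewrite (_ : 2%R = 1 + 1)%R// EFinD ge0_muleDl// mul1e leeD2l//.
  apply: le_trans (s_half nin); apply: IH2 => -[P [XP SP SneP]].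
  have [Q XQ PQ] := nested XP; apply: nin; exists Q; split => //.
    exact: dle_trans PQ.
  by move=> SQ; apply: SneP; apply: (@dle_anti R n) => //; rewrite SQ.
split => // ; apply: (le_trans le2).
have -> : 4%:E * H (dcube S) = 2%:E * (2%:E * H (dcube S)).
  by rewrite muleA -EFinM; congr (_%:E * _); ring.
by rewrite lee_pmul2l//; exact: pX.
Qed.

(* [m] truncates the sequence of generations. *)
Definition core (m : nat) (z : nat * dyadic n) : set T :=
  [set x | (dcube z.2 : set T) x /\
    ~ ((z.1.+1 < m)%N /\ exists2 Q, X z.1.+1 Q & (dcube Q : set T) x)].

Definition generations m : set (nat * dyadic n) := `I_m `*`` X.

(** A point of [P] lies in the core of the cube of the last generation below m that contains it;
    nesting and disjointness put that cube inside [P]. *)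
Lemma core_cover m j P : (j < m)%N -> X j P ->
  (dcube P : set T) `<=` \bigcup_(z in generations m `&` [set z | (j <= z.1)%N /\ dle z.2 P]) core m z.
Proof.
move=> jm XP x Px.
pose p i := `[< (i < m)%N /\ exists2 Q, X i Q & (dcube Q : set T) x >].
have pj : p j by apply/asboolP; split => //; exists P.
have pm i : p i -> (i <= m)%N by move=> /asboolP[/ltnW].
have [i /asboolP[im [Q XQ Qx]] imax] := ex_maxnP (ex_intro _ j pj) pm.
have ji := imax _ pj.
exists (i, Q); last first.
  split => // h; have /imax : p i.+1 by exact/asboolP.
  by rewrite ltnn.
split; first by split.
split => //=; have [Q' XQ' QQ'] := nested_le ji XQ.
by rewrite (dX XP XQ' Px (QQ'.2 _ Qx)).
Qed.

(** Uniqueness for superadditivity: if S lies in cubes of two generations, the later cube covers S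
    and so removes S from the core of the earlier one. *)
Lemma core_choquet m F :
  \esum_(z in generations m) I (core m z) F <= (kappa * (4 + 1))%:E * I setT F.
Proof.
apply: (choquet_superadditive_packing delta_gt0 delta_le_n (P := fun z => z.2)) => //.
- move=> S; apply: le_trans (sparse_packing m S).
  rewrite (_ : _ `&` _ = `I_m `*`` (fun j => X j `&` [set Q | dle Q S])); last first.
    by apply/seteqP; split => -[j P] /= [] => [[jm XP] PS|jm [XP PS]]; split.
  rewrite -(@esum_esum _ _ _ `I_m (fun j => X j `&` [set Q | dle Q S]) (fun _ Q => H (dcube Q)))//.
  by rewrite esum_fset -?fsbig_ord//; move=> j _; exact: s0.
- by move=> z _ x [].
- suff h (S : dyadic n) (z w : nat * dyadic n) : generations m z -> generations m w ->
      dle S w.2 -> dcube S `&` core m z !=set0 -> ~ (z.1 < w.1)%N.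
    move=> S [i P] [j Q] zD wD SP SQ zE wE.
    have ij : i = j.
      case: (ltngtP i j) => // ij; exfalso; [exact: (h _ _ _ zD wD SQ zE)|exact: (h _ _ _ wD zD SP wE)].
    by move: zD wD SP SQ => [_ /= XP] [_ /= XQ] SP SQ; subst j; rewrite (disj_dle XP XQ SP SQ).
  move=> [_ Xz] [wm Xw] [_ Sw] [x [Sx [_ xn]]] zw; apply: xn.
  have [Q XQ wQ] := nested_le zw Xw; split; first exact: leq_ltn_trans wm.
  by exists Q => //; apply: wQ.2; exact: Sw.
Qed.
End sparse_families.

(** * Weak type of the weighted maximal operator *)

Section weighted_maximal.
Context {R : realType} {n : nat} (delta : R).
Hypotheses (delta_gt0 : (0 < delta)%R) (delta_le_n : (delta <= n%:R)%R).
Local Notation T := 'rV[R]_n.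
Local Notation I := (@choquet R n delta).
Local Notation dcube := (@dcube R n).
Local Notation dle := (@dle R n).
Local Notation kappa := (@dyadic_ratio R n delta).
Implicit Types (P Q S : dyadic n).

(** Normalizing by edge^delta gives the content maximal operator M_H; normalizing by v(Q), with F =
    g v, gives M_v applied to g. *)
Definition maximal (u : cube R n -> R) (F : T -> \bar R) (x : T) : \bar R :=
  ereal_sup [set (u Q)^-1%:E * I Q F | Q in [set Q : cube R n | (Q : set T) x]].

Lemma maximal_gtP (u : cube R n -> R) F x (t : R) : (forall Q : cube R n, 0 < u Q)%R ->
  t%:E < maximal u F x <->
  exists2 Q : cube R n, (Q : set T) x & (t * u Q)%:E < I Q F.
Proof.
move=> u0; split.
  move=> /ereal_sup_gt[_ [Q Qx <-]]; rewrite lte_pdivlMl// => tQ.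
  by exists Q => //; rewrite mulrC EFinM.
move=> [Q Qx tQ]; apply: (@lt_le_trans _ _ ((u Q)^-1%:E * I Q F)).
  by rewrite lte_pdivlMl// -EFinM mulrC.
by apply: ereal_sup_ubound; exists Q.
Qed.

Lemma exists_cube_mem x : exists Q : cube R n, (Q : set T) x.
Proof. by exists (dcube (cell 0 x)); exact: cell_mem. Qed.

Lemma maximal_ge0 (u : cube R n -> R) F x : (forall Q : cube R n, 0 < u Q)%R -> 0 <= maximal u F x.
Proof.
move=> u0; have [Q Qx] := exists_cube_mem x.
apply: (@le_trans _ _ ((u Q)^-1%:E * I Q F)).
  by rewrite mule_ge0 ?choquet_ge0// lee_fin invr_ge0 ltW.
by apply: ereal_sup_ubound; exists Q.
Qed.

Lemma three_edge_gt0 (Q : cube R n) : (0 < 3 * edge Q)%R.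
Proof. by rewrite mulr_gt0 ?edge_gt0. Qed.

Definition triple (Q : cube R n) : cube R n :=
  Cube (\row_i (corner Q ord0 i - edge Q)%R) (three_edge_gt0 Q).

Lemma sub_triple (Q : cube R n) : (Q : set T) `<=` triple Q.
Proof.
move=> x Qx i; have := Qx i; have := edge_gt0 Q; rewrite /= mxE => e0 /andP[a b].
by apply/andP; split; lra.
Qed.

Lemma choquet_set0 F : I set0 F = 0.
Proof.
apply/eqP; rewrite eq_le choquet_ge0 andbT.
apply: (@le_trans _ _ (I set0 (fun=> 0%:E))); first by apply: le_choquet.
by apply: (le_trans (choquet_cst_le _ _ (lexx 0%R))); rewrite mul0e.
Qed.

Variables (v : T -> \bar R) (rv : regular_weight delta v).
Local Notation Mv := (maximal (fun Q : cube R n => fine (I Q v))).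

Lemma fine_weight_gt0 (Q : cube R n) : (0 < fine (I Q v))%R.
Proof. by rewrite fine_gt0//; exact: weight_cube rv Q. Qed.

(** One of the N dyadic cubes covering [Q] carries a share 1/N of the integral, and doubling
    compares its weight with v(Q); hence zeta = 1/(N B). A dyadic cube above it meets [Q] and is at
    least as large, so its triple contains [Q]. *)
Lemma maximal_level_cover : exists2 zeta : R, (0 < zeta)%R &
  forall F (s : R) x, (0 < s)%R -> s%:E < Mv F x ->
  exists2 P, good delta v F (zeta * s)%R P &
    forall Q, dle P Q -> (triple (dcube Q) : set T) x.
Proof.
(* A dyadic cube meeting [Q] with edge below 2 l lies in [Q] enlarged by 2 l on each side, of edge 5
   l. *)
have [//|B B0 BP] := @weight_doubling _ _ _ delta_gt0 delta_le_n _ rv 5.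
pose N := #|{ffun 'I_n -> bool}|.
have N0 : (0 < N%:R :> R)%R.
  by rewrite ltr0n; apply/card_gt0P; exists [ffun => true].
exists ((N%:R * B)^-1)%R; first by rewrite invr_gt0 mulr_gt0.
move=> F s x s0 /(maximal_gtP _ _ _ fine_weight_gt0)[Q Qx sQ].
have [k [P [/andP[k1 k2] Pk QP]]] := dyadic_cover Q.
have [e Pe] : exists e, (s * fine (I Q v))%:E <= N%:R%:E * I ((Q : set T) `&` dcube (P e)) F.
  apply: contrapT => /forallNP h; move: sQ; apply/negP; rewrite -leNgt.
  apply: (@le_trans _ _ (\sum_(e : {ffun 'I_n -> bool}) (N%:R^-1 * (s * fine (I Q v)))%:E)).
    apply: (@le_trans _ _ (\sum_(e : {ffun 'I_n -> bool}) I ((Q : set T) `&` dcube (P e)) F)).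
      rewrite -esum_finType; last by move=> e; exact: choquet_ge0.
      by apply: choquet_subadditive => y Qy; have [e _ Py] := QP _ Qy; exists e.
    apply: lee_sum => e _; rewrite EFinM lee_pdivlMl//.
    by apply: ltW; rewrite ltNge; apply/negP; exact: h.
  rewrite sumEFin sumr_const lee_fin -[leLHS]mulr_natl mulrA mulfV ?mul1r//.
  by rewrite gt_eqF.
have [y [Qy Py]] : (Q : set T) `&` dcube (P e) !=set0.
  apply/set0P/eqP => E0; move: Pe; rewrite E0 choquet_set0 mule0.
  by rewrite leNgt lte_fin mulr_gt0// fine_weight_gt0.
have PkE : edge (dcube (P e)) = (2 ^ k)%R by rewrite /= Pk.
exists (P e).
  have vP : I (dcube (P e)) v <= B%:E * I Q v.
    have e5 : (0 < 5 * edge Q)%R by rewrite mulr_gt0 ?edge_gt0.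
    pose Q' := Cube (\row_i (corner Q ord0 i - 2 * edge Q)%R) e5.
    apply: (@le_trans _ _ (I Q' v)).
      apply: le_choquet => // z Pz i; have := Pz i; have := Py i; have := Qy i.
      rewrite PkE /= !mxE; set c := ((P e).2 i)%:~R; set J := (2 ^ (P e).1)%R.
      by move=> /andP[? ?] /andP[? ?] /andP[? ?]; apply/andP; split; lra.
    apply: BP => // z Qz i; have := Qz i; have := edge_gt0 Q; rewrite /= mxE.
    by move=> ? /andP[? ?]; apply/andP; split; lra.
  rewrite /good; apply: (@le_trans _ _ (((N%:R * B)^-1 * s)%:E * (B%:E * I Q v))).
    by rewrite lee_wpmul2l// lee_fin mulr_ge0 ?invr_ge0 ?mulr_ge0// ltW.
  rewrite muleA -EFinM (_ : (_ * _ * B = N%:R^-1 * s)%R); last by field; rewrite !gt_eqF.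
  rewrite EFinM -muleA lee_pdivrMl// -(fineK (weight_cube_fin rv Q)) -EFinM.
  apply: (le_trans Pe); rewrite lee_pmul2l//.
  by apply: le_choquet => // z [].
move=> S [PS1 PS] i; have := Qx i; have := Qy i; have := PS _ Py i; rewrite /= mxE.
have : (edge Q <= 2 ^ S.1)%R.
  by apply: (le_trans k1); rewrite -(Pk e) ler_weXz2l ?ler1n.
rewrite !mxE; set J := (2 ^ S.1)%R; set c := (S.2 i)%:~R.
by move=> ? /andP[? ?] /andP[? ?] /andP[? ?]; apply/andP; split; lra.
Qed.

Lemma triple_doubling : exists2 B : R, (0 < B)%R &
  forall Q : cube R n, I (triple Q) v <= B%:E * I Q v.
Proof.
have [//|B B0 BP] := @weight_doubling _ _ _ delta_gt0 delta_le_n _ rv 3.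
by exists B => // Q; apply: BP; [exact: sub_triple|].
Qed.

Theorem weak_type : exists2 K : R, (0 < K)%R & forall F (s : R), (0 < s)%R ->
  s%:E * I [set x | s%:E < Mv F x] v <= K%:E * I setT F.
Proof.
have [zeta z0 cover] := maximal_level_cover.
have [B B0 BP] := triple_doubling.
have [eta /andP[eta0 _] stop] := stopping_cubes delta_gt0 delta_le_n rv.
have k0 := @dyadic_ratio_gt0 R n delta.
have k30 : (0 < kappa * (2 + 1))%R by rewrite mulr_gt0.
have ez0 : (0 < eta * zeta)%R by rewrite mulr_gt0.
have K0 : (0 < B * (eta * zeta)^-1 * (kappa * (2 + 1)))%R.
  by rewrite (mulr_gt0 _ k30)// mulr_gt0// invr_gt0.
exists (B * (eta * zeta)^-1 * (kappa * (2 + 1)))%R => //.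
move=> F s s0; case IF : (I setT F) (choquet_ge0 delta setT F) => [M| |]// _; last first.
  by rewrite gt0_muley ?leey// lte_fin.
have zs0 : (0 < zeta * s)%R by rewrite mulr_gt0.
(* The finite total integral M bounds the weight of all good cubes, as the stopping construction
   requires. *)
have [|X [gX dX pX cX]] := stop F (zeta * s)%R ((eta * (zeta * s))^-1 * M)%R zs0.
  move=> P gP; rewrite EFinM lee_pdivlMl ?mulr_gt0// -IF.
  by apply: (le_trans gP); exact: le_choquet.
have sub : I [set x | s%:E < Mv F x] v <= B%:E * \esum_(P in X) I (dcube P) v.
  rewrite -(esumZl _ (ltW B0)); last by move=> P; exact: choquet_ge0.
  apply: (@le_trans _ _ (\esum_(P in X) I (triple (dcube P)) v)).
    apply: choquet_subadditive => x /= /(cover _ _ _ s0)[P gP Px].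
    have [Q XQ PQ] := cX _ gP; exists Q => //; exact: Px.
  by apply: le_esum => P _; exact: BP.
have sF : (eta * (zeta * s))%:E * (\esum_(P in X) I (dcube P) v) <= (kappa * (2 + 1))%:E * M%:E.
  rewrite -(esumZl _ (ltW (mulr_gt0 eta0 zs0))); last by move=> P; exact: choquet_ge0.
  apply: (@le_trans _ _ (\esum_(P in X) I (dcube P) F)); first by apply: le_esum => P /gX.
  by rewrite -IF; exact: packed_choquet.
apply: (@le_trans _ _ (s%:E * (B%:E * \esum_(P in X) I (dcube P) v))).
  by rewrite lee_pmul2l.
rewrite EFinM -[leRHS]muleA.
have -> : s%:E * (B%:E * \esum_(P in X) I (dcube P) v) = (B * (eta * zeta)^-1)%:E *
    ((eta * (zeta * s))%:E * (\esum_(P in X) I (dcube P) v)).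
  by rewrite !muleA -!EFinM; congr (_%:E * _); field; rewrite !gt_eqF.
by rewrite lee_pmul2l ?lte_fin// mulr_gt0// invr_gt0.
Qed.
End weighted_maximal.

(** * Stopping cubes along geometric levels *)

Section stopping_generations.
Context {R : realType} {n : nat} (delta : R).
Hypotheses (delta_gt0 : (0 < delta)%R) (delta_le_n : (delta <= n%:R)%R).
Local Notation T := 'rV[R]_n.
Local Notation H := (@hausdorff_content R n delta).
Local Notation I := (@choquet R n delta).
Local Notation dcube := (@dcube R n).
Local Notation dle := (@dle R n).
Local Notation kappa := (@dyadic_ratio R n delta).
Implicit Types (P Q S : dyadic n).
Variables (v : T -> \bar R) (rv : regular_weight delta v).

Lemma exists_parent P : exists Q, [/\ Q.1 = (P.1 + 1)%R, dle P Q &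
  edge (dcube Q) = (2 * edge (dcube P))%R].
Proof.
have [x Px] := dcube_nonempty (R := R) P.
exists (cell (P.1 + 1)%R x); split => //.
  by apply: (dle_of_meet _ Px (cell_mem _ _)); rewrite /= lerDl.
by rewrite /= expfzDr// expr1z mulrC.
Qed.

(** Sparseness is by contradiction: F is at most a multiple of t_j v on a cube P of generation j,
    since its parent is not good, while F is at least eta t_{j+1} v on the next generation. If the
    latter filled too much of P, the A_infinity property would contradict the size of a. *)
Lemma generations_of_stopping_cubes : exists eta a : R, [/\ (0 < eta)%R, (1 < a)%R &
  forall (F : T -> \bar R) (tau : R), (0 < tau)%R ->
  (forall s : R, (0 < s)%R -> exists M : R, forall P, good delta v F s P -> I (dcube P) v <= M%:E) ->
  exists X : nat -> set (dyadic n),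
  [/\ forall j P, X j P -> good delta v F (eta * (tau * a ^+ j))%R P,
      forall j, @disjoint_cubes R n (X j) /\ @packed R n delta 2 (X j),
      forall j P, good delta v F (tau * a ^+ j)%R P -> exists2 Q, X j Q & dle P Q,
      forall j P, X j.+1 P -> exists2 Q, X j Q & dle P Q &
      forall j P, X j P ->
        \esum_(Q in X j.+1 `&` [set Q | dle Q P]) H (dcube Q) <= 2^-1%:E * H (dcube P)]].
Proof.
have H0 A : 0 <= H A by exact: hausdorff_content_ge0.
have [eta /andP[eta0 eta1] stop] := stopping_cubes delta_gt0 delta_le_n rv.
have [//|Bp Bp0 BpP] := @weight_doubling _ _ _ delta_gt0 delta_le_n _ rv 2.
have k0 := @dyadic_ratio_gt0 R n delta.
pose C := (kappa * (2 + 1))%R; have C0 : (0 < C)%R by rewrite mulr_gt0.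
(* Packing gives sum H(Q) <= C H(U), so H(U) <= H(P) / (2 C) is what yields the factor 1/2. *)
have [|B B0 BP] := @weight_ainfty _ _ _ _ rv (2 * C)^-1%R.
  by rewrite invr_gt0 mulr_gt0.
(* Ensures eta a > 1 + B C Bp: eta a > 1 gives nesting, because cubes good at eta t_{j+1} are good
   at t_j, and eta a > B C Bp gives the contradiction in [small]. *)
pose a := (2 + (1 + B * C * Bp) / eta)%R.
have BCB0 : (0 < B * C * Bp)%R by exact: mulr_gt0 (mulr_gt0 B0 C0) Bp0.
have q0 : (0 < (1 + B * C * Bp) / eta)%R by rewrite divr_gt0// addr_gt0.
have a1 : (1 < a)%R by rewrite /a; move: q0; lra.
have a0 : (0 < a)%R by lra.
have etaa : (1 + B * C * Bp < eta * a)%R.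
  suff h (x e : R) : (0 < e)%R -> (0 < x)%R -> (1 + x < e * (2 + (1 + x) / e))%R by exact: h.
  by move=> e0 x0; rewrite mulrDr mulrCA mulfV ?gt_eqF// mulr1; lra.
exists eta, a; split => // F tau tau0 bdd.
pose t j := (tau * a ^+ j)%R; have t0 j : (0 < t j)%R by rewrite mulr_gt0 ?exprn_gt0.
have /choice[X XP] : forall j, exists X : set (dyadic n),
    [/\ forall P, X P -> good delta v F (eta * t j)%R P,
    @disjoint_cubes R n X, @packed R n delta 2 X &
    forall P, good delta v F (t j) P -> exists2 Q, X Q & dle P Q].
  move=> j; have [|M hM] := bdd (eta * t j)%R; first by rewrite mulr_gt0.
  exact: stop F (t j) M (t0 j) hM.
have tS j : t j.+1 = (a * t j)%R by rewrite /t exprS mulrCA.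
exists X; split.
- by move=> j P XjP; have [h _ _ _] := XP j; exact: h.
- by move=> j; have [_ h1 h2 _] := XP j.
- by move=> j P gP; have [_ _ _ h] := XP j; exact: h.
- move=> j P XjP; have [h _ _ _] := XP j.+1; have [_ _ _ h'] := XP j; apply: h'.
  apply: le_good (h _ XjP); rewrite tS mulrA ler_peMl ?(ltW (t0 _))//.
  by apply: ltW; apply: lt_trans etaa; lra.
- move=> j P XjP; have [gX dX _ cX] := XP j; have [gX' dX' pX' _] := XP j.+1.
  set Y := _ `&` _.
  have dY : @disjoint_cubes R n Y by move=> ? ? ? [? _] [? _]; exact: dX'.
  have pY : @packed R n delta 2 Y.
    by move=> S; apply: le_trans (pX' S); apply: le_esum_subset => Q [[XQ _] QS].
  have [Ph [Phl PPh Phe]] := exists_parent P.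
  (* A good parent would lie in some cube of generation j, which by disjointness would be P
     itself. *)
  have ng : I (dcube Ph) F < (t j)%:E * I (dcube Ph) v.
    rewrite ltNge; apply/negP => /cX[Q XQ PhQ].
    have PQ : P = Q.
      have [x Px] := dcube_nonempty (R := R) P.
      exact: dX XjP XQ Px (PhQ.2 _ (PPh.2 _ Px)).
    by have := PhQ.1; rewrite -PQ Phl gerDl.
  have IPF : I (dcube P) F <= (t j * Bp)%:E * I (dcube P) v.
    apply: (@le_trans _ _ (I (dcube Ph) F)); first by apply: le_choquet => //; exact: PPh.2.
    apply: (le_trans (ltW ng)); rewrite (EFinM (t j) Bp) -muleA lee_pmul2l//; last exact: t0.
    by apply: BpP; [exact: PPh.2|rewrite Phe].
  have sF : (eta * t j.+1)%:E * (\esum_(Q in Y) I (dcube Q) v) <= C%:E * I (dcube P) F.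
    rewrite -(esumZl _ (ltW (mulr_gt0 eta0 (t0 _)))); last by move=> Q; exact: choquet_ge0.
    apply: (@le_trans _ _ (\esum_(Q in Y) I (dcube Q) F)); first by apply: le_esum => Q [/gX'].
    by apply: packed_choquet => // Q [_ []].
  pose U := \bigcup_(Q in Y) (dcube Q : set T).
  have UY : I U v <= \esum_(Q in Y) I (dcube Q) v by exact: choquet_subadditive.
  have small : ~ ((2 * C)^-1)%:E * H (dcube P) <= H U.
    move=> /BP; have UP : U `<=` dcube P by move=> x [Q [_ [_ QP]] Qx]; exact: QP.
    move=> /(_ UP) BU.
    have : (eta * t j.+1)%:E * I (dcube P) v <= (B * C * (t j * Bp))%:E * I (dcube P) v.
      set y := (eta * t j.+1)%R in sF *; have y0 : (0 < y)%R by exact: mulr_gt0.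
      set S := \esum_(Q in Y) _ in sF UY *.
      apply: (@le_trans _ _ (y%:E * (B%:E * S))).
        by rewrite lee_pmul2l//; apply: (le_trans BU); rewrite lee_pmul2l.
      rewrite muleCA (EFinM (B * C)%R) (EFinM B) -!muleA lee_pmul2l//.
      by apply: (le_trans sF); rewrite lee_pmul2l.
    rewrite -(fineK (weight_cube_fin rv (dcube P))) -!EFinM lee_fin.
    rewrite ler_pM2r; last exact: fine_weight_gt0 rv (dcube P).
    apply/negP; rewrite -ltNge tS; have tj0 := t0 j.
    have : ((1 + B * C * Bp) * t j < eta * a * t j)%R by rewrite ltr_pM2r.
    suff h (y b1 c b2 e d : R) : (0 < y)%R -> ((1 + b1 * c * b2) * y < e * d * y)%R ->
      (b1 * c * (y * b2) < e * (d * y))%R by exact: h.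
    by move=> y0 hy; lra.
  have HY : \esum_(Q in Y) H (dcube Q) <= C%:E * H U.
    apply: le_trans (packed_content delta_gt0 delta_le_n U _ dY pY) => //.
    apply: le_esum => Q YQ; apply: le_hausdorff_content => x Qx; split => //.
    by exists Q.
  apply: (le_trans HY); move/negP: small; rewrite -ltNge => /ltW small.
  apply: (@le_trans _ _ (C%:E * (((2 * C)^-1)%:E * H (dcube P)))).
    by rewrite lee_pmul2l.
  by rewrite muleA -EFinM invfM mulrCA mulfV ?gt_eqF// mulr1.
Qed.
End stopping_generations.

(** * Strong type over a finite range of levels *)

Section window.
Context {R : realType} {n : nat} (delta : R).
Hypotheses (delta_gt0 : (0 < delta)%R) (delta_le_n : (delta <= n%:R)%R).
Local Notation T := 'rV[R]_n.
Local Notation I := (@choquet R n delta).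
Local Notation dcube := (@dcube R n).
Local Notation dle := (@dle R n).
Local Notation kappa := (@dyadic_ratio R n delta).
Implicit Types (P Q S : dyadic n).
Variables (v : T -> \bar R) (rv : regular_weight delta v).
Local Notation Mv := (maximal delta (fun Q : cube R n => fine (I Q v))).
Variables (r : R) (r_gt1 : (1 < r)%R).

(* The only link needed between the integrands [F = g v] and [G = g^r v]; it follows
   from the pointwise bound [g <= lam + lam^(1 - r) g^r]. *)
Definition young (F G : T -> \bar R) := forall (E : set T) (lam : R), (0 < lam)%R ->
  I E F <= (2 * lam)%:E * I E v + (2 * lam `^ (1 - r))%:E * I E G.

(** Substitute for Jensen. With lam = s/4 the first term of [young] is half of s v(P) and is
    absorbed. *)
Lemma young_good F G (s : R) P : young F G -> (0 < s)%R -> good delta v F s P ->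
  (s `^ r)%:E * I (dcube P) v <= (4 `^ r)%:E * I (dcube P) G.
Proof.
move=> FG s0 gP; have r4 : (0 < (4 : R) `^ r)%R by rewrite powR_gt0.
case IG : (I (dcube P) G) (choquet_ge0 delta (dcube P) G) => [g| |]// g0; last first.
  by rewrite gt0_muley ?leey// lte_fin.
have s4 : (0 < s / 4)%R by rewrite divr_gt0.
have := le_trans gP (FG _ _ s4); rewrite IG -(fineK (weight_cube_fin rv (dcube P))).
set V := fine _; rewrite -!EFinM -EFinD !lee_fin.
have L0 : (0 < (s / 4) `^ r)%R by rewrite powR_gt0.
have -> : ((s / 4) `^ (1 - r) = s / 4 / (s / 4) `^ r)%R.
  rewrite powRD; last by rewrite (gt_eqF s4) implybT.
  by rewrite powRN powRr1 ?(ltW s4).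
have -> : (s `^ r = 4 `^ r * (s / 4) `^ r)%R.
  by rewrite -powRM ?(ltW s4)//; congr powR; field.
set L := ((s / 4) `^ r)%R in L0 * => h.
rewrite -mulrA ler_pM2l//.
rewrite mulrC -ler_pdivlMr//.
have h' : (s * V <= s * (g / L))%R.
  have -> : (s * (g / L) = 2 * (2 * (s / 4 / L) * g))%R by field; rewrite gt_eqF.
  by move: h; lra.
by move: h'; rewrite ler_pM2l.
Qed.

Lemma geometric_sum_le (rho : R) (N : nat) : (1 < rho)%R ->
  (\sum_(j < N.+1) rho ^+ j <= rho / (rho - 1) * rho ^+ N)%R.
Proof.
move=> r1; have r0 : (0 < rho - 1)%R by rewrite subr_gt0.
rewrite mulrAC ler_pdivlMr// mulrC -subrX1 exprS; by rewrite gerBl.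
Qed.

(* The sum of [t_j^r v(P)] over the cubes of all generations is bounded by integrals of
   [F] over the cores, which [young] with [lam = eps * t_j] splits into at most half of
   the same sum and an integral of [G]. The finite range of [j] makes the sum finite,
   so that half can be absorbed. *)
Lemma window_estimate : exists a K : R, [/\ (1 < a)%R, (0 < K)%R &
  forall F G, young F G -> I setT G < +oo -> forall (tau : R) (m : nat), (0 < tau)%R ->
  \sum_(j < m) ((tau * a ^+ j) `^ r)%:E * I [set x | (tau * a ^+ j)%:E < Mv F x] v <=
    K%:E * I setT G].
Proof.
have r0 : (0 < r)%R by apply: lt_trans r_gt1.
have r10 : (0 < r - 1)%R by rewrite subr_gt0.
have [zeta z0 cover] := maximal_level_cover delta_gt0 delta_le_n rv.
have [B B0 BP] := triple_doubling delta_gt0 delta_le_n rv.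
have [eta [a [eta0 a1 gen]]] := generations_of_stopping_cubes delta_gt0 delta_le_n rv.
have a0 : (0 < a)%R by apply: lt_trans a1.
have k0 := @dyadic_ratio_gt0 R n delta.
pose rho := (a `^ (r - 1))%R.
have rho1 : (1 < rho)%R.
  by rewrite /rho /powR gt_eqF//= expR_gt1 mulr_gt0// ln_gt0.
pose Cr := (rho / (rho - 1))%R.
have Cr0 : (0 < Cr)%R.
  by apply: divr_gt0; [exact: lt_trans rho1|rewrite subr_gt0].
(* Chosen so that (Cr / eta) t^(r-1) times 2 eps t equals t^r / 2, the half to be absorbed; [Cr]
   sums the progression t_j^(r-1), of ratio [rho]. *)
pose eps := (eta / (4 * Cr))%R; have eps0 : (0 < eps)%R.
  by apply: divr_gt0 => //; exact: mulr_gt0.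
pose D := (2 * (Cr / eta) * eps `^ (1 - r))%R.
have D0 : (0 < D)%R.
  apply: mulr_gt0; last exact: powR_gt0.
  by apply: mulr_gt0 => //; exact: divr_gt0.
pose K1 := (2 * (D * (kappa * (4 + 1))))%R.
have K10 : (0 < K1)%R.
  by apply: mulr_gt0 => //; apply: mulr_gt0 => //; exact: mulr_gt0.
exists a, (zeta `^ (- r) * B * K1)%R; split => //.
  by apply: mulr_gt0 => //; apply: mulr_gt0 => //; exact: powR_gt0.
move=> F G FG IGoo tau m tau0.
have zt0 : (0 < zeta * tau)%R by rewrite mulr_gt0.
have IG0 : 0 <= I setT G by exact: choquet_ge0.
have IGf : I setT G \is a fin_num by rewrite ge0_fin_numE.
have bdd (s : R) : (0 < s)%R -> exists M : R, forall P, good delta v F s P -> I (dcube P) v <= M%:E.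
  move=> s0; exists ((s `^ r)^-1 * (4 `^ r * fine (I setT G)))%R => P gP.
  rewrite EFinM lee_pdivlMl ?powR_gt0// EFinM fineK//.
  apply: (le_trans (young_good FG s0 gP)).
  by rewrite lee_pmul2l ?lte_fin ?powR_gt0//; exact: le_choquet.
have [X [gX dpX cX nX hX]] := gen F (zeta * tau)%R zt0 bdd.
have dX j := (dpX j).1; have pX j := (dpX j).2.
pose t j := (zeta * tau * a ^+ j)%R.
have t0 j : (0 < t j)%R by rewrite mulr_gt0// exprn_gt0.
have tE j : (t j `^ (r - 1) = (zeta * tau) `^ (r - 1) * rho ^+ j)%R.
  rewrite /t (powRM _ (ltW zt0) (exprn_ge0 _ (ltW a0))); congr (_ * _)%R.
  exact: powR_exprn (ltW a0).
have trE j : (t j `^ r = t j `^ (r - 1) * t j)%R.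
  rewrite -{3}(powRr1 (ltW (t0 j))) -powRD; first by rewrite subrK.
  by rewrite (gt_eqF (t0 j)) implybT.
have tz j : t j = (zeta * (tau * a ^+ j))%R by rewrite /t mulrA.
have gXt j P : X j P -> good delta v F (eta * t j)%R P by exact: gX.
have cXt j P : good delta v F (t j) P -> exists2 Q, X j Q & dle P Q by exact: cX.
clearbody t; move: gXt cXt => {gX cX} gX cX.
pose gens := generations X m.
pose Sum := \esum_(z in gens) ((t z.1 `^ r)%:E * I (dcube z.2) v).
have Iv0 (E : set T) : 0 <= I E v by exact: choquet_ge0.
have IG0' (E : set T) : 0 <= I E G by exact: choquet_ge0.
have IF0 (E : set T) : 0 <= I E F by exact: choquet_ge0.
have SumE : Sum = \sum_(j < m) \esum_(P in X j) ((t j `^ r)%:E * I (dcube P) v).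
  rewrite /Sum /gens /generations.
  rewrite -(@esum_esum _ _ _ `I_m X (fun j P => (t j `^ r)%:E * I (dcube P) v)); last first.
    by move=> j P _ _; rewrite mule_ge0// lee_fin powR_ge0.
  rewrite esum_fset -?fsbig_ord// => j _; apply: esum_ge0 => P _.
  by rewrite mule_ge0// lee_fin powR_ge0.
(* Within one generation [young_good] and packing bound the sum by a multiple of the finite integral
   of G. Summed over j this grows with m, so it serves only to justify the absorption. *)
have Sumfin : Sum \is a fin_num.
  rewrite SumE; apply/sum_fin_numP => j _ _.
  rewrite ge0_fin_numE; last by apply: esum_ge0 => P _; rewrite mule_ge0// lee_fin powR_ge0.
  apply: (@le_lt_trans _ _ ((eta `^ (- r) * 4 `^ r)%:E * \esum_(P in X j) I (dcube P) G)).
    rewrite -esumZl ?mulr_ge0 ?powR_ge0//; apply: le_esum => P XP.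
    have := young_good FG (mulr_gt0 eta0 (t0 j)) (gX _ _ XP).
    rewrite powRM ?(ltW eta0) ?(ltW (t0 _))// EFinM -muleA -lee_pdivlMl ?powR_gt0//.
    by rewrite muleA -EFinM powRN.
  apply: (@le_lt_trans _ _ ((eta `^ (- r) * 4 `^ r)%:E * ((kappa * (2 + 1))%:E * I setT G))).
    apply: lee_wpmul2l; first by rewrite lee_fin mulr_ge0 ?powR_ge0.
    exact: packed_choquet.
  by rewrite -(fineK IGf) -!EFinM ltry.
have corefin z : I (core X m z) F \is a fin_num.
  rewrite ge0_fin_numE//.
  apply: (@le_lt_trans _ _ (I (dcube z.2) F)); first by apply: le_choquet => // x [].
  apply: (le_lt_trans (FG _ 1%R ltr01)).
  have vfin := weight_cube_fin rv (dcube z.2).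
  have Gfin : I (dcube z.2) G \is a fin_num.
    by rewrite ge0_fin_numE// (le_lt_trans _ IGoo)//; exact: le_choquet.
  by rewrite -(fineK vfin) -(fineK Gfin) -!EFinM -EFinD ltry.
have chain : Sum <= \esum_(w in gens) ((eta^-1 * (Cr * t w.1 `^ (r - 1)))%:E * I (core X m w) F).
  pose rel (z w : nat * dyadic n) := (z.1 <= w.1)%N /\ dle w.2 z.2.
  pose b (z w : nat * dyadic n) := (eta^-1 * t z.1 `^ (r - 1))%:E * I (core X m w) F.
  have b0 z w : 0 <= b z w by rewrite mule_ge0// lee_fin mulr_ge0 ?invr_ge0 ?powR_ge0 ?(ltW eta0).
  (* Goodness gives t_j^r v(P) <= eta^-1 t_j^(r-1) F(P), and F(P) is split over the cores inside P.
     After exchanging the sums, a core of generation J is counted at most once for each j <= J,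
     which leaves a geometric sum. *)
  apply: (@le_trans _ _ (\esum_(z in gens) \esum_(w in gens `&` [set w | rel z w]) b z w)).
    apply: le_esum => -[j P] [/= jm XP].
    rewrite esumZl ?mulr_ge0 ?invr_ge0 ?powR_ge0 ?(ltW eta0)//.
    rewrite trE EFinM (mulrC eta^-1)%R EFinM -!muleA.
    rewrite lee_wpmul2l ?lee_fin ?powR_ge0// lee_pdivlMl//.
    rewrite muleA -EFinM; apply: (le_trans (gX _ _ XP)).
    apply: choquet_subadditive; exact: core_cover.
  rewrite (@esum_swap_cond _ _ _ gens gens rel b)//.
  apply: le_esum => -[J Q] [/= Jm XQ].
  rewrite /b /= -(fineK (corefin (J, Q))); set f := fine _.
  have f0 : (0 <= f)%R by rewrite fine_ge0.
  rewrite (eq_esum (b := fun z => f%:E * (eta^-1 * t z.1 `^ (r - 1))%:E)); last first.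
    by move=> z _; rewrite muleC.
  rewrite esumZl//; last by move=> z; rewrite lee_fin mulr_ge0 ?invr_ge0 ?powR_ge0 ?(ltW eta0).
  rewrite muleC lee_wpmul2r ?lee_fin//.
  under eq_esum do rewrite EFinM.
  rewrite esumZl ?invr_ge0 ?(ltW eta0)//; last by move=> z; rewrite lee_fin powR_ge0.
  rewrite EFinM lee_wpmul2l ?lee_fin ?invr_ge0 ?(ltW eta0)//.
  apply: (@le_trans _ _ (\esum_(z in `I_J.+1 `*`` (fun j => X j `&` [set P | dle Q P])) (t z.1 `^ (r - 1))%:E)).
    by apply: le_esum_subset => -[j P] [[/= jm XP] [/= jJ QP]]; split.
  rewrite -(@esum_esum _ _ _ `I_J.+1 (fun j => X j `&` [set P | dle Q P]) (fun j P => (t j `^ (r - 1))%:E)); last first.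
    by move=> *; rewrite lee_fin powR_ge0.
  apply: (@le_trans _ _ (\esum_(j in `I_J.+1) (t j `^ (r - 1))%:E)).
    apply: le_esum => j _; apply: esum_le_unique; rewrite ?lee_fin ?powR_ge0//; last first.
      by move=> P _ /=; exact: lexx.
    move=> P P' [XP QP] [XP' QP']; have [x Qx] := dcube_nonempty (R := R) Q.
    exact: dX XP XP' (QP.2 _ Qx) (QP'.2 _ Qx).
  rewrite esum_fset//; last by move=> j _; rewrite lee_fin powR_ge0.
  rewrite -fsbig_ord sumEFin lee_fin; under eq_bigr do rewrite tE.
  rewrite -mulr_sumr tE mulrCA ler_wpM2l ?powR_ge0//.
  exact: geometric_sum_le.
have absorb : Sum <= 2^-1%:E * Sum + D%:E * (\esum_(w in gens) I (core X m w) G).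
  rewrite -!esumZl ?(ltW D0)//; last by move=> z; rewrite mule_ge0// lee_fin powR_ge0.
  rewrite -esumD; first last.
  - by move=> z _; rewrite mule_ge0// lee_fin ltW.
  - by move=> z _; rewrite mule_ge0// mule_ge0// lee_fin powR_ge0.
  apply: (le_trans chain); apply: le_esum => -[J Q] /= [Jm XQ].
  have tJ := t0 J; have et0 : (0 < eps * t J)%R by rewrite mulr_gt0.
  have c0 : (0 < eta^-1 * (Cr * t J `^ (r - 1)))%R.
    by rewrite mulr_gt0 ?invr_gt0// mulr_gt0// powR_gt0.
  apply: (le_trans (lee_wpmul2l _ (FG _ _ et0))); first by rewrite lee_fin ltW.
  rewrite ge0_muleDr; last 2 first.
  - by rewrite mule_ge0// lee_fin mulr_ge0// ltW.
  - by rewrite mule_ge0// lee_fin mulr_ge0// powR_ge0.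
  have core_v : I (core X m (J, Q)) v <= I (dcube Q) v by apply: le_choquet => // x [].
  apply: leeD.
    rewrite !muleA -!EFinM; apply: (@le_trans _ _ ((2^-1 * t J `^ r)%:E * I (core X m (J, Q)) v)).
      rewrite lee_wpmul2r// lee_fin trE /eps le_eqVlt; apply/orP; left; apply/eqP.
      by field; rewrite !gt_eqF.
    by rewrite lee_wpmul2l// lee_fin mulr_ge0// powR_ge0.
  rewrite muleA -EFinM lee_wpmul2r// lee_fin.
  rewrite powRM ?(ltW eps0) ?(ltW tJ)//.
  have -> : (t J `^ (1 - r) = (t J `^ (r - 1))^-1)%R by rewrite -powRN opprB.
  have tr0 : (0 < t J `^ (r - 1))%R by rewrite powR_gt0.
  rewrite /D le_eqVlt; apply/orP; left; apply/eqP.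
  by field; rewrite !gt_eqF.
have SumG : Sum <= K1%:E * I setT G.
  have coreG : \esum_(w in gens) I (core X m w) G <= (kappa * (4 + 1))%:E * I setT G.
    exact: core_choquet.
  have : Sum <= 2^-1%:E * Sum + (D * (kappa * (4 + 1)))%:E * I setT G.
    apply: (le_trans absorb); rewrite leeD2l// (EFinM D) -muleA lee_pmul2l//.
  rewrite -(fineK Sumfin) -(fineK IGf) -!EFinM -EFinD !lee_fin /K1; lra.
apply: (@le_trans _ _ ((zeta `^ (- r) * B)%:E * Sum)); last first.
  rewrite (EFinM (zeta `^ (- r) * B)%R) -muleA lee_pmul2l ?lte_fin//.
  by apply: mulr_gt0 => //; exact: powR_gt0.
rewrite SumE ge0_sume_distrr; last first.
  by move=> j _; apply: esum_ge0 => P _; rewrite mule_ge0// lee_fin powR_ge0.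
apply: lee_sum => j _.
rewrite esumZl ?powR_ge0// muleA -EFinM.
have s0 : (0 < tau * a ^+ j)%R by rewrite mulr_gt0// exprn_gt0.
have -> : (zeta `^ (- r) * B * t j `^ r = (tau * a ^+ j) `^ r * B)%R.
  rewrite tz powRM ?(ltW z0) ?(ltW s0)// powRN.
  have zr0 : (0 < zeta `^ r)%R by rewrite powR_gt0.
  by field; rewrite gt_eqF.
rewrite (EFinM (_ `^ _)%R) -muleA lee_wpmul2l ?lee_fin ?powR_ge0//.
rewrite -(esumZl _ (ltW B0))//.
apply: (@le_trans _ _ (\esum_(P in X j) I (triple (dcube P)) v)); last first.
  by apply: le_esum => P _; exact: BP.
apply: choquet_subadditive => x /= /(cover _ _ _ s0)[P gP Px].
have [|Q XQ PQ] := cX j P; first by rewrite tz.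
by exists Q => //; exact: Px.
Qed.
End window.

Lemma exists_exprz_itv (R : realType) (a y : R) : (1 < a)%R -> (0 < y)%R ->
  exists k : int, (a ^ k < y <= a ^ (k + 1))%R.
Proof.
move=> a1 y0; have lna : (0 < ln a)%R by rewrite ln_gt0.
have a0 : (0 < a)%R by apply: lt_trans a1.
have yE : (y = a `^ (ln y / ln a))%R.
  by rewrite /powR gt_eqF//= divfK ?gt_eqF// lnK.
have /andP[h1 h2] := ceil_itv (ln y / ln a).
exists (Num.ceil (ln y / ln a) - 1)%R; rewrite subrK -!powR_intmul ?(ltW a0)//.
rewrite {2 3}yE ler_powR ?(ltW a1)// andbT /powR gt_eqF//= ltr_expR ltr_pM2r//.
Qed.

Lemma finite_set_int_bound (Y : set int) : finite_set Y ->
  exists N : nat, forall k, Y k -> (- N%:Z <= k <= N%:Z)%R.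
Proof.
move=> /finite_seqP[s ->]; exists (\max_(k <- s) `|k|%N) => k /= ks.
by rewrite -ler_norml -abszE lez_nat; exact: leq_bigmax_seq.
Qed.

(** * Strong type over all levels *)

Section strong_type_bound.
Context {R : realType} {n : nat} (delta : R).
Hypotheses (delta_gt0 : (0 < delta)%R) (delta_le_n : (delta <= n%:R)%R).
Local Notation T := 'rV[R]_n.
Local Notation I := (@choquet R n delta).
Variables (v : T -> \bar R) (rv : regular_weight delta v).
Local Notation Mv := (maximal delta (fun Q : cube R n => fine (I Q v))).
Variables (r : R) (r_gt1 : (1 < r)%R).

(** A finite set of integers lies in some [-N, N], which is the window starting at tau = a^(-N);
    hence the need for a bound uniform in tau and m. *)
Lemma esum_exprz_le (a : R) (b : R -> \bar R) (C : \bar R) : (1 < a)%R ->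
  (forall y, 0 <= b y) -> (0 <= C) ->
  (forall (tau : R) (m : nat), (0 < tau)%R -> \sum_(j < m) b (tau * a ^+ j)%R <= C) ->
  \esum_(k in [set: int]) b (a ^ k)%R <= C.
Proof.
move=> a1 b0 C0 bC; have a0 : (0 < a)%R by apply: lt_trans a1.
apply: ge_ereal_sup => _ [Y [finY _] <-].
have [N YN] := finite_set_int_bound finY.
pose e (j : nat) : int := (j%:Z - N%:Z)%R.
have einj : set_inj `I_(N + N).+1 e by move=> i j _ _ /addIr [].
rewrite -esum_fset//; apply: (@le_trans _ _ (\esum_(k in e @` `I_(N + N).+1) b (a ^ k)%R)).
  apply: le_esum_subset => k /YN /andP[k1 k2].
  have kN : (0 <= k + N%:Z)%R by rewrite -lerBlDr sub0r.
  exists (absz (k + N%:Z)%R); last by rewrite /e gez0_abs// addrK.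
  by rewrite /= ltnS -lez_nat gez0_abs// PoszD lerD2r.
rewrite esum_image// esum_fset// -fsbig_ord.
apply: le_trans (bC (a ^ (- N%:Z))%R (N + N).+1 _); last exact: exprz_gt0.
by apply: lee_sum => j _; rewrite /e expfzDr ?gt_eqF// mulrC.
Qed.

Theorem strong_type : exists2 K : R, (0 < K)%R &
  forall F G, young delta v r F G ->
  I setT (fun x => Mv F x `^ r * v x) <= K%:E * I setT G.
Proof.
have r0 : (0 < r)%R by apply: lt_trans r_gt1.
have [a [K [a1 K0 win]]] := window_estimate delta_gt0 delta_le_n rv r_gt1.
have a0 : (0 < a)%R by apply: lt_trans a1.
have ar0 : (0 < a `^ r)%R by rewrite powR_gt0.
exists (a `^ r * K)%R; first exact: mulr_gt0.
move=> F G FG; have [IGy|IGoo] := eqVneq (I setT G) +oo.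
  by rewrite IGy gt0_muley ?leey// lte_fin mulr_gt0.
rewrite -ltey in IGoo.
have M0 x : 0 <= Mv F x by apply: maximal_ge0 => Q; exact: fine_weight_gt0.
have v0 x : 0 <= v x by exact: weight_ge0 rv x.
apply: (@le_trans _ _ (\esum_(k in [set: int])
    I [set x | (a ^ k)%:E < Mv F x] (fun x => ((a ^ (k + 1)) `^ r)%:E * v x))).
  apply: le_choquet_sup => x t _ t0 tM.
  suff [k k1 k2] : exists2 k : int, (a ^ k)%:E < Mv F x & t%:E < ((a ^ (k + 1)) `^ r)%:E * v x.
    by exists k.
  move: tM (M0 x) (v0 x); case: (Mv F x) => [y| |]//.
    move=> tM; rewrite lee_fin le_eqVlt => /predU1P[y0|y0] vx0.
      by move: tM; rewrite -y0 poweR_EFin powR0 ?gt_eqF// mul0e lte_fin ltNge (ltW t0).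
    have [k /andP[k1 k2]] := exists_exprz_itv a1 y0; exists k => //.
    apply: (lt_le_trans tM); apply: lee_wpmul2r => //.
    rewrite poweR_EFin lee_fin; apply: ge0_ler_powR; rewrite ?nnegrE ?(ltW r0) ?(ltW y0)//.
    by rewrite ltW// exprz_gt0.
  (* Here the maximal function is infinite, so every level is exceeded; as v x >= b > 0, a large k
     makes a^((k+1) r) b exceed t. *)
  move=> tM _; rewrite le_eqVlt => /predU1P[vx0|vx0].
    by move: tM; rewrite -vx0 mule0 lte_fin ltNge (ltW t0).
  have [b b0 bv] : exists2 b : R, (0 < b)%R & b%:E <= v x.
    move: vx0; case: (v x) => [b| |]//; first by rewrite lte_fin => b0; exists b.
    by move=> _; exists 1%R; rewrite ?leey.
  pose y := (((t + 1) / b) `^ r^-1)%R.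
  have tb0 : (0 < (t + 1) / b)%R by rewrite divr_gt0// addr_gt0.
  have y0 : (0 < y)%R by rewrite powR_gt0.
  have [k /andP[k1 k2]] := exists_exprz_itv a1 y0; exists k; first by rewrite ltry.
  apply: (@lt_le_trans _ _ ((y `^ r)%:E * b%:E)).
    rewrite /y -powRrM mulVf ?gt_eqF// powRr1 ?(ltW tb0)// -EFinM lte_fin.
    by rewrite divfK ?gt_eqF// ltrDl.
  apply: lee_pmul => //; rewrite ?lee_fin ?powR_ge0 ?(ltW b0)//.
  apply: ge0_ler_powR; rewrite ?nnegrE ?(ltW r0) ?(ltW y0)//.
  by rewrite ltW// exprz_gt0.
pose b (y : R) := (y `^ r)%:E * I [set x | y%:E < Mv F x] v.
have b0 y : 0 <= b y by rewrite mule_ge0 ?choquet_ge0// lee_fin powR_ge0.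
rewrite (eq_esum (b := fun k : int => (a `^ r)%:E * b (a ^ k)%R)); last first.
  move=> k _; have ak0 : (0 < a ^ k)%R by rewrite exprz_gt0.
  have ak1 : (0 < a ^ (k + 1))%R by rewrite exprz_gt0.
  rewrite choquetZ ?powR_gt0// /b muleA -EFinM; congr (_%:E * _).
  by rewrite expfzDr ?gt_eqF// expr1z powRM ?(ltW ak0) ?(ltW a0)// mulrC.
rewrite esumZl ?(ltW ar0)// (EFinM (a `^ r)%R) -muleA lee_pmul2l//.
apply: esum_exprz_le => //; first by rewrite mule_ge0 ?choquet_ge0// lee_fin ltW.
by move=> tau m tau0; exact: win.
Qed.
End strong_type_bound.

Lemma lee_of_levels (R : realType) (M X : \bar R) : 0 <= X ->
  (forall t : R, (0 < t)%R -> t%:E < M -> t%:E <= X) -> M <= X.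
Proof.
move=> X0 h; rewrite leNgt; apply/negP => XM.
move: X X0 h XM => [x| |]//; last by move=> _ _; rewrite ltNge leey.
rewrite lee_fin => x0 h; case: M h => [m| |]// h.
- rewrite lte_fin => xm; have := h ((x + m) / 2)%R; rewrite !lte_fin lee_fin.
  by move=> /(_ ltac:(lra) ltac:(lra)); lra.
- move=> _; have := h (x + 1)%R; rewrite ltry lee_fin => /(_ ltac:(lra) isT); lra.
Qed.

Lemma muckenhoupt_dual_ineq (R : realType) (a b c K s : R) :
  (0 < s)%R -> (0 <= K)%R -> (0 <= a)%R -> (0 <= b)%R -> (0 <= c)%R ->
  (a * b `^ s^-1 <= K * c `^ (1 + s^-1))%R -> (b * a `^ s <= K `^ s * c `^ (1 + s))%R.
Proof.
move=> s0 K0 a0 b0 c0 h.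
have bs0 : (0 <= b `^ s^-1)%R by exact: powR_ge0.
have cs0 : (0 <= c `^ (1 + s^-1))%R by exact: powR_ge0.
have L0 : (0 <= a * b `^ s^-1)%R by exact: mulr_ge0.
have R0 : (0 <= K * c `^ (1 + s^-1))%R by exact: mulr_ge0.
have := ge0_ler_powR (ltW s0) L0 R0 h.
rewrite (powRM _ a0 bs0) (powRM _ K0 cs0).
have -> : ((b `^ s^-1) `^ s = b)%R by rewrite -powRrM mulVf ?gt_eqF// powRr1.
have -> : ((c `^ (1 + s^-1)) `^ s = c `^ (1 + s))%R.
  by rewrite -powRrM mulrDl mul1r mulVf ?gt_eqF// addrC.
by rewrite mulrC.
Qed.

(** * Muckenhoupt pairs in dual form *)

Section muckenhoupt_pairs.
Context {R : realType} {n : nat} (delta : R).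
Hypotheses (delta_gt0 : (0 < delta)%R) (delta_le_n : (delta <= n%:R)%R).
Local Notation T := 'rV[R]_n.
Local Notation H := (@hausdorff_content R n delta).
Local Notation I := (@choquet R n delta).

(* Symmetric form of the Muckenhoupt condition with exponent [1 + s^-1]: the
   dual of [(s, w, sg)] is [(s^-1, sg, w)]. *)
Record muckenhoupt_pair (s : R) (w sg : T -> \bar R) (K : R) : Prop := {
  mp_s : (0 < s)%R;
  mp_K : (0 < K)%R;
  mp_null : exists2 N : set T, H N = 0 & forall x, ~ N x ->
    exists om : R, [/\ (0 < om)%R, w x = om%:E & sg x = (om `^ (- s))%:E];
  mp_ge0 : forall x, 0 <= w x /\ 0 <= sg x;
  mp_fin : forall Q : cube R n, 0 < I Q w < +oo /\ 0 < I Q sg < +oo;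
  mp_cube : forall Q : cube R n,
    (fine (I Q w) * fine (I Q sg) `^ s^-1 <= K * (edge Q `^ delta) `^ (1 + s^-1))%R }.

Lemma muckenhoupt_pair_sym s w sg K :
  muckenhoupt_pair s w sg K -> muckenhoupt_pair s^-1 sg w (K `^ s).
Proof.
move=> [s0 K0 [N N0 NP] ge0 fi cu]; split; first by rewrite invr_gt0.
- exact: powR_gt0.
- exists N => // x /NP[om [om0 wx sx]]; exists (om `^ (- s))%R; split => //.
    exact: powR_gt0.
  rewrite wx -powRrM mulrNN mulfV ?gt_eqF// powRr1//; exact: ltW.
- by move=> x; have [] := ge0 x.
- by move=> Q; have [] := fi Q.
move=> Q; rewrite invrK; have [/andP[a0 _] /andP[b0 _]] := fi Q; have h := cu Q.
apply: muckenhoupt_dual_ineq => //; rewrite ?fine_ge0 ?powR_ge0 ?(ltW K0) ?(ltW a0) ?(ltW b0)//.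
Qed.

Section one_pair.
Variables (s : R) (w sg : T -> \bar R) (K : R).
Hypothesis mp : muckenhoupt_pair s w sg K.
Let s0 : (0 < s)%R := mp_s mp.
Let K0 : (0 < K)%R := mp_K mp.

(** Substitute for Hölder between w and its dual: outside a null set sg = w^(-s), so lam w > 1/2 or
    lam^(-s) sg > 1/2. Chebyshev at height 1/2 gives the factors 2. *)
Lemma content_le_dual_pair (F : set T) (lam : R) : (0 < lam)%R ->
  H F <= (2 * lam)%:E * I F w + (2 * lam `^ (- s))%:E * I F sg.
Proof.
move=> lam0; have [N N0 NP] := mp_null mp; have ls0 : (0 < lam `^ (- s))%R by rewrite powR_gt0.
rewrite !EFinM -!muleA -(choquetZ delta F w lam0) -(choquetZ delta F sg ls0).
pose A (g : T -> \bar R) := [set x | F x /\ (2^-1)%:E < g x].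
apply: (@le_trans _ _ (H (A (fun x => lam%:E * w x)) + H (A (fun x => (lam `^ (- s))%:E * sg x)))).
  apply: le_trans (hausdorff_contentU _ _ _).
  apply: le_trans (hausdorff_content_null _ N0); apply: le_hausdorff_content => x Fx.
  have [Nx|/NP[om [om0 wx sx]]] := pselect (N x); [by right|left].
  have [h|h] := ltP (2^-1)%R (lam * om)%R.
    by left; split => //; rewrite wx -EFinM lte_fin.
  right; split => //; rewrite sx -EFinM lte_fin -powRM ?(ltW lam0) ?(ltW om0)//.
  have lo0 : (0 < lam * om)%R by rewrite mulr_gt0.
  apply: (@lt_le_trans _ _ 1%R); first by rewrite invf_lt1 ?ltr1n.
  rewrite powRN invf_ge1 ?powR_gt0//; apply: (@le_trans _ _ (1 `^ s)%R); last by rewrite powR1.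
  apply: ge0_ler_powR; rewrite ?nnegrE ?(ltW s0) ?(ltW lo0)//.
  by apply: (le_trans h); rewrite invf_le1 ?ler1n.
have h2 : (0 < 2^-1 :> R)%R by rewrite invr_gt0.
by apply: leeD; rewrite -lee_pdivrMl//; exact: choquet_chebyshev.
Qed.

Lemma muckenhoupt_pair_cubeE (Q : cube R n) :
  [/\ (0 < fine (I Q w))%R, (0 < fine (I Q sg))%R, (0 < edge Q `^ delta)%R,
   I Q w = (fine (I Q w))%:E & I Q sg = (fine (I Q sg))%:E].
Proof.
have [/andP[a0 ay] /andP[b0 by_]] := mp_fin mp Q.
split; rewrite ?fine_gt0 ?a0 ?b0// ?powR_gt0 ?edge_gt0// fineK//.
- by rewrite ge0_fin_numE// ltW.
- by rewrite ge0_fin_numE// ltW.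
Qed.

Lemma muckenhoupt_pair_regular : regular_weight delta w.
Proof.
split; [by move=> x; have [] := mp_ge0 mp x|by move=> Q; have [] := mp_fin mp Q|].
move=> th th0; exists (K * (4 / th) `^ s^-1 * (4 / th))%R.
  by rewrite mulr_gt0 ?divr_gt0// mulr_gt0 ?powR_gt0 ?divr_gt0.
move=> Q F FQ; rewrite hausdorff_content_cube// => thF.
have [a0 b0 c0 aE bE] := muckenhoupt_pair_cubeE Q; rewrite aE.
set a := fine _ in a0 aE *; set b := fine _ in b0 bE *; set c := (edge Q `^ delta)%R in c0 thF *.
(* Makes the dual term at most th c / 2, half of the lower bound for H(F). *)
pose lam := ((4 * b / (th * c)) `^ s^-1)%R.
have q0 : (0 < 4 * b / (th * c))%R by rewrite divr_gt0 ?mulr_gt0.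
have lam0 : (0 < lam)%R by rewrite powR_gt0.
have lamE : (lam `^ (- s) = th * c / (4 * b))%R.
  rewrite powRN -powRrM mulVf ?gt_eqF// powRr1 ?(ltW q0)//.
  by rewrite invf_div.
have := le_trans thF (content_le_dual_pair F lam0); rewrite lamE.
have Fsg : I F sg <= b%:E by rewrite -bE; exact: le_choquet.
case IF : (I F w) (choquet_ge0 delta F w) => [f| |]// f0 h; last first.
  by rewrite gt0_muley ?leey// lte_fin mulr_gt0 ?divr_gt0// mulr_gt0 ?powR_gt0 ?divr_gt0.
have {h} : (th * c)%:E <= (2 * lam * f)%:E + (2 * (th * c / (4 * b)) * b)%:E.
  apply: (le_trans h); rewrite (EFinM (2 * lam) f)%R leeD2l// (EFinM (2 * (th * c / (4 * b))) b)%R.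
  by rewrite lee_wpmul2l// lee_fin mulr_ge0// divr_ge0 ?mulr_ge0 ?ltW.
rewrite -EFinD lee_fin -EFinM lee_fin => h.
have h1 : (th * c / 4 <= lam * f)%R.
  have E : (2 * (th * c / (4 * b)) * b = th * c / 2)%R by field; rewrite gt_eqF.
  by move: h; rewrite E; lra.
have := mp_cube mp Q; rewrite -/a -/b -/c => hab.
have lamc : (lam * c `^ s^-1 = (4 / th) `^ s^-1 * b `^ s^-1)%R.
  rewrite -!powRM ?(ltW q0) ?(ltW c0) ?(ltW b0) ?divr_ge0 ?(ltW th0)//; congr powR.
  by field; rewrite !gt_eqF.
have cE : (c `^ (1 + s^-1) = c * c `^ s^-1)%R.
  by rewrite powRD ?powRr1 ?(ltW c0)// (gt_eqF c0) implybT.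
have bu0 : (0 < b `^ s^-1)%R by rewrite powR_gt0.
have cu0 : (0 < c `^ s^-1)%R by rewrite powR_gt0.
rewrite cE in hab; rewrite -(ler_pM2r bu0); apply: (le_trans hab).
set q := ((4 / th) `^ s^-1)%R in lamc *.
have h3 : (K * (c * c `^ s^-1) <= K * (4 / th * (lam * f) * c `^ s^-1))%R.
  have cL : (c <= 4 / th * (lam * f))%R.
    by rewrite mulrAC ler_pdivlMr// mulrC [leRHS]mulrC -ler_pdivrMr.
  by apply: ler_wpM2l; [exact: ltW|apply: ler_wpM2r; [exact: ltW|exact: cL]].
apply: (le_trans h3); rewrite (_ : (4 / th * (lam * f) * c `^ s^-1 = 4 / th * f * (lam * c `^ s^-1))%R); last by ring.
by rewrite lamc le_eqVlt; apply/orP; left; apply/eqP; ring.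
Qed.

(** Take g = h / sg and r = 1 + 1/s: then g sg = h, and g^r sg = h^r w because sg^(1-r) = w. Either
    h <= lam sg, or the second term dominates. *)
Lemma muckenhoupt_pair_young (h : T -> \bar R) : (forall x, 0 <= h x) ->
  young delta sg (1 + s^-1) h (fun x => h x `^ (1 + s^-1) * w x).
Proof.
move=> h0 E lam lam0; have [N N0 NP] := mp_null mp.
have r0 : (0 < 1 + s^-1 :> R)%R by rewrite addr_gt0 ?invr_gt0.
have rE : (1 - (1 + s^-1) = - s^-1)%R by rewrite opprD addrA subrr sub0r.
have ls0 : (0 < lam `^ (- s^-1))%R by rewrite powR_gt0.
rewrite rE !EFinM -!muleA -(choquetZ delta E sg lam0) -(choquetZ delta E _ ls0).
apply: le_trans (choquetD _ _ _); last 2 first.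
- by move=> x _; rewrite mule_ge0 ?lee_fin ?(ltW lam0)//; have [] := mp_ge0 mp x.
- move=> x _; rewrite mule_ge0 ?lee_fin ?(ltW ls0)// mule_ge0 ?poweR_ge0//.
  by have [] := mp_ge0 mp x.
apply: (le_choquet_ae N0) => x Ex /NP[om [om0 wx sx]]; split => //; rewrite wx sx.
case: (h x) (h0 x) => [g| |]//; last first.
  by move=> _; rewrite poweRyr ?gt_eqF// gt0_mulye ?lte_fin// gt0_muley ?lte_fin// addey ?leey.
rewrite lee_fin => g0; rewrite poweR_EFin -!EFinM -EFinD lee_fin.
have [hle|hgt] := leP g (lam * om `^ (- s))%R.
  by apply: (le_trans hle); rewrite lerDl !mulr_ge0 ?powR_ge0 ?ltW.
have los : (0 < lam * om `^ (- s))%R by rewrite mulr_gt0 ?powR_gt0.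
have g0' : (0 < g)%R by apply: lt_trans hgt.
apply: (@le_trans _ _ (lam `^ (- s^-1) * (g `^ (1 + s^-1) * om))%R); last first.
  by rewrite lerDr ltW.
have -> : (g `^ (1 + s^-1) = g * g `^ s^-1)%R.
  by rewrite powRD ?powRr1// (gt_eqF g0') implybT.
have : ((lam * om `^ (- s)) `^ s^-1 <= g `^ s^-1)%R.
  by apply: ge0_ler_powR; rewrite ?nnegrE ?invr_ge0 ?(ltW s0) ?(ltW los) ?(ltW hgt).
have lu0 : (0 < lam `^ s^-1)%R by rewrite powR_gt0.
rewrite powRM ?powR_ge0 ?(ltW lam0)// -powRrM mulNr mulfV ?gt_eqF//.
rewrite (powRN om) powRr1 ?(ltW om0)// ler_pdivrMr// => hh.
rewrite powRN; set L := (lam `^ s^-1)%R in lu0 hh *; set G := (g `^ s^-1)%R in hh *.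
rewrite -ler_pdivrMl ?invr_gt0// invrK.
rewrite (_ : (g * G * om = g * (G * om))%R); last by ring.
by rewrite mulrC ler_wpM2l.
Qed.
End one_pair.
End muckenhoupt_pairs.

(** * The content maximal operator for a Muckenhoupt pair *)

Section content_maximal_bound.
Context {R : realType} {n : nat} (delta : R).
Hypotheses (delta_gt0 : (0 < delta)%R) (delta_le_n : (delta <= n%:R)%R).
Local Notation T := 'rV[R]_n.
Local Notation I := (@choquet R n delta).
Local Notation MH := (maximal delta (fun Q : cube R n => edge Q `^ delta)%R).
Local Notation Mw w := (maximal delta (fun Q : cube R n => fine (I Q w))).

Lemma edge_powR_gt0 (Q : cube R n) : (0 < edge Q `^ delta)%R.
Proof. by rewrite powR_gt0// edge_gt0. Qed.

(* Lerner's argument: on a cube Q with average of h larger than t,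
   the [sg]-weighted maximal function of h exceeds t c(Q) / sg(Q), so the Muckenhoupt
   condition bounds [t^(r-1)] by a [w]-average of [(M_sg h)^(r-1)]. *)
Lemma lerner_bound s w sg K (h : T -> \bar R) x : muckenhoupt_pair delta s w sg K ->
  MH h x <= ((4 * K)%:E * Mw w (fun y => Mw sg h y `^ s^-1) x) `^ s.
Proof.
move=> mp; have s0 := mp_s mp; have K0 := mp_K mp; have p0 : (0 < s^-1)%R by rewrite invr_gt0.
have rw := muckenhoupt_pair_regular delta_gt0 delta_le_n mp.
have rsg := muckenhoupt_pair_regular delta_gt0 delta_le_n (muckenhoupt_pair_sym mp).
apply: lee_of_levels; first exact: poweR_ge0.
move=> t t0 /(maximal_gtP _ _ _ _ edge_powR_gt0)[Q Qx tQ].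
have [a0 b0 c0 aE bE] := muckenhoupt_pair_cubeE mp Q.
set a := fine (I Q w) in a0 aE; set b := fine (I Q sg) in b0 bE.
set c := (edge Q `^ delta)%R in c0 tQ.
have tc0 : (0 < t * c / b)%R by rewrite divr_gt0// mulr_gt0.
(* The factor 1/2 gives the strict inequality needed for Chebyshev; a second factor 2 makes [level]
   strict, hence 4 K. *)
pose tau := (2^-1 * (t * c / b) `^ s^-1)%R.
have tau0 : (0 < tau)%R by rewrite mulr_gt0 ?invr_gt0 ?powR_gt0.
pose G y := Mw sg h y `^ s^-1.
have GQ y : (Q : set T) y -> tau%:E < G y.
  move=> Qy; have /ltW tA : (t * c / b)%:E < Mw sg h y.
    apply/(maximal_gtP _ _ _ _ (fine_weight_gt0 rsg)); exists Q => //.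
    by rewrite -/b divfK ?gt_eqF.
  have := le_poweR (ltW p0) _ tA; rewrite lee_fin (ltW tc0) => /(_ isT).
  apply: lt_le_trans; rewrite poweR_EFin lte_fin /tau.
  have : (0 < (t * c / b) `^ s^-1)%R by rewrite powR_gt0.
  by lra.
have tauc : (tau * c)%:E <= I Q G.
  apply: le_trans (choquet_chebyshev _ _ _ tau0).
  rewrite EFinM lee_pmul2l// -(hausdorff_content_cube delta_gt0 delta_le_n Q).
  by apply: le_hausdorff_content => y Qy; split => //; exact: GQ.
have level : (t `^ s^-1 / (4 * K))%:E < Mw w G x.
  apply/(maximal_gtP _ _ _ _ (fine_weight_gt0 rw)); exists Q => //.
  apply: lt_le_trans tauc; rewrite lte_fin -/a.
  have hab := mp_cube mp Q; rewrite -/a -/b -/c in hab.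
  have cE : (c `^ (1 + s^-1) = c * c `^ s^-1)%R.
    by rewrite powRD ?powRr1 ?(ltW c0)// (gt_eqF c0) implybT.
  have bu0 : (0 < b `^ s^-1)%R by rewrite powR_gt0.
  have tu0 : (0 < t `^ s^-1)%R by rewrite powR_gt0.
  have tauE : (tau * b `^ s^-1 = 2^-1 * (t `^ s^-1 * c `^ s^-1))%R.
    rewrite /tau -mulrA -!powRM ?(ltW tc0) ?(ltW b0) ?(ltW t0) ?(ltW c0)//.
    by rewrite divfK ?gt_eqF.
  rewrite -(ltr_pM2r bu0) [ltRHS]mulrAC tauE.
  rewrite cE in hab.
  suff gen (u v q z k al be : R) : (0 < u)%R -> (0 < k)%R -> (0 < al)%R -> (0 < be)%R ->
      (al * be <= k * (z * q))%R -> (u / (4 * k) * al * be < 2^-1 * (u * q) * z)%R.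
    exact: gen.
  move=> u0 k0 al0 be0 hh.
  apply: (@lt_le_trans _ _ (u / (2 * k) * (al * be))%R).
    rewrite -mulrA ltr_pM2r ?mulr_gt0// ltr_pM2l// ltf_pV2 ?posrE ?mulr_gt0//.
    by rewrite ltr_pM2r// ltr_nat.
  apply: (@le_trans _ _ (u / (2 * k) * (k * (z * q)))%R).
    by rewrite ler_pM2l// divr_gt0// mulr_gt0.
  rewrite le_eqVlt; apply/orP; left; apply/eqP; field.
  by rewrite gt_eqF.
have -> : t%:E = (t `^ s^-1)%:E `^ s.
  by rewrite poweR_EFin -powRrM mulVf ?gt_eqF// powRr1// ltW.
apply: le_poweR; [exact: ltW|by rewrite lee_fin powR_ge0|].
rewrite -lee_pdivrMl ?mulr_gt0// -EFinM mulrC; exact: ltW.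
Qed.

(** With G = (M_sg h)^(1/s), the strong type for w at exponent 1 + s bounds the integral of (M_w
    G)^(1+s) w by that of G^(1+s) sg = (M_sg h)^(1+1/s) sg; the strong type for sg at exponent 1 +
    1/s then returns h^(1+1/s) w. *)
Lemma strong_type_muckenhoupt_pair s w sg K : muckenhoupt_pair delta s w sg K ->
  exists2 C : R, (0 < C)%R & forall h, (forall x, 0 <= h x) ->
  I setT (fun x => MH h x `^ (1 + s^-1) * w x) <=
    C%:E * I setT (fun x => h x `^ (1 + s^-1) * w x).
Proof.
move=> mp; have s0 := mp_s mp; have K0 := mp_K mp; have p0 : (0 < s^-1)%R by rewrite invr_gt0.
have mp' := muckenhoupt_pair_sym mp.
have rw := muckenhoupt_pair_regular delta_gt0 delta_le_n mp.
have rsg := muckenhoupt_pair_regular delta_gt0 delta_le_n mp'.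
have r1 : (1 < 1 + s^-1)%R by rewrite ltrDl.
have r1' : (1 < 1 + s^-1^-1)%R by rewrite invrK ltrDl.
have [K1 K10 st1] := strong_type delta_gt0 delta_le_n rsg r1.
have [K2 K20 st2] := strong_type delta_gt0 delta_le_n rw r1'.
have K40 : (0 < 4 * K)%R by rewrite mulr_gt0.
have c0 : (0 < (4 * K) `^ (1 + s))%R by rewrite powR_gt0.
exists ((4 * K) `^ (1 + s) * (K2 * K1))%R; first by rewrite !mulr_gt0.
move=> h h0.
have Msg0 x : 0 <= Mw sg h x by apply: maximal_ge0 => Q; exact: fine_weight_gt0.
pose G x := Mw sg h x `^ s^-1.
have G0 x : 0 <= G x by exact: poweR_ge0.
have B0 x : 0 <= Mw w G x by apply: maximal_ge0 => Q; exact: fine_weight_gt0.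
have MH0 x : 0 <= MH h x by apply: maximal_ge0 => Q; exact: edge_powR_gt0.
have h1 := st1 _ _ (muckenhoupt_pair_young mp h0).
have h2 := st2 _ _ (muckenhoupt_pair_young mp' G0).
have GE x : G x `^ (1 + s^-1^-1) = Mw sg h x `^ (1 + s^-1).
  by rewrite /G -poweRrM invrK mulrDr mulr1 mulVf ?gt_eqF// addrC.
apply: (@le_trans _ _ (I setT (fun x => ((4 * K) `^ (1 + s))%:E * (Mw w G x `^ (1 + s^-1^-1) * w x)))).
  apply: le_choquet => // x _; rewrite muleA lee_wpmul2r//; first by have [] := mp_ge0 mp x.
  apply: (le_trans (le_poweR _ (MH0 x) (lerner_bound h x mp))); first by rewrite addr_ge0 ?ltW.
  rewrite -poweRrM invrK mulrDr mulr1 mulfV ?gt_eqF// addrC.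
  by rewrite poweRM// ?lee_fin ?ltW// poweR_EFin.
rewrite choquetZ// !EFinM -!muleA lee_pmul2l//.
apply: (le_trans h2); rewrite lee_pmul2l//.
apply: le_trans h1; rewrite le_eqVlt; apply/orP; left; apply/eqP; congr choquet.
by apply/funext => x; rewrite GE.
Qed.
End content_maximal_bound.

(** * From the capacitary A_p conditions to pairs and regular weights *)

Section capacitary_weights.
Context {R : realType} {n : nat} (delta : R).
Hypotheses (delta_gt0 : (0 < delta)%R) (delta_le_n : (delta <= n%:R)%R).
Local Notation T := 'rV[R]_n.
Local Notation H := (@hausdorff_content R n delta).
Local Notation I := (@choquet R n delta).
Local Notation MH := (maximal delta (fun Q : cube R n => edge Q `^ delta)%R).
Local Notation Mw w := (maximal delta (fun Q : cube R n => fine (I Q w))).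

Lemma choquet_cube_gt0 (N : set T) (g : T -> \bar R) (Q : cube R n) :
  H N = 0 -> (forall x, ~ N x -> 0 < g x) -> 0 < I Q g.
Proof.
move=> N0 gN; rewrite lt_neqAle choquet_ge0 andbT eq_sym; apply/eqP => /choquet_eq0 g0.
have : H Q <= 0.
  rewrite -[leRHS]g0; apply: le_trans (hausdorff_content_null _ N0).
  apply: le_hausdorff_content => x Qx; have [Nx|Nx] := pselect (N x); [by right|left].
  by split => //; exact: gN.
by rewrite hausdorff_content_cube// leNgt lte_fin edge_powR_gt0.
Qed.

Lemma capacitary_weight_null w : capacitary_weight delta w ->
  exists2 N : set T, H N = 0 & forall x, ~ N x -> exists2 om : R, (0 < om)%R & w x = om%:E.
Proof.
move=> [w0 _ ae]; exists [set x | ~ (0 < w x < +oo)] => // x /= /contrapT.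
by case: (w x) => [om| |]//; rewrite ?ltxx ?andbF// => /andP[om0 _]; exists om.
Qed.

(* The exponents [s <= q] stand for [(r - 1)^-1 <= (p - 1)^-1]. *)
Lemma powR_le_interpolation (u mu s q : R) : (0 < u)%R -> (0 < mu)%R -> (0 <= s <= q)%R ->
  (u `^ s <= mu `^ s + mu `^ (s - q) * u `^ q)%R.
Proof.
move=> u0 mu0 /andP[s0 sq]; have [umu|muu] := leP u mu.
  apply: (@le_trans _ _ (mu `^ s)%R); last by rewrite lerDl mulr_ge0 ?powR_ge0.
  by apply: ge0_ler_powR; rewrite ?nnegrE ?(ltW u0) ?(ltW mu0).
apply: (@le_trans _ _ (mu `^ (s - q) * u `^ q)%R); last by rewrite lerDr powR_ge0.
have E (z : R) : (0 < z)%R -> (z `^ (s - q) = (z `^ (q - s))^-1)%R.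
  by move=> z0; rewrite -powRN opprB.
have -> : (u `^ s = u `^ (s - q) * u `^ q)%R.
  by rewrite -powRD ?subrK// (gt_eqF u0) implybT.
rewrite ler_wpM2r ?powR_ge0// !E// lef_pV2 ?posrE ?powR_gt0//.
by apply: ge0_ler_powR; rewrite ?nnegrE ?subr_ge0 ?(ltW u0) ?(ltW mu0) ?(ltW muu).
Qed.

Lemma muckenhoupt_power_ineq (a x mu c K u : R) : (0 < u)%R -> (0 <= a)%R -> (0 <= x)%R ->
  (0 <= mu)%R -> (0 < c)%R -> (x <= 4 * mu `^ u^-1 * c)%R -> (a / c * mu <= K)%R ->
  (a * x `^ u <= 4 `^ u * K * c `^ (1 + u))%R.
Proof.
move=> u0 a0 x0 mu0 c0 xle hK.
have muu0 : (0 <= mu `^ u^-1)%R by exact: powR_ge0.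
have m0 : (0 <= 4 * mu `^ u^-1)%R by exact: mulr_ge0.
have mc0 : (0 <= 4 * mu `^ u^-1 * c)%R by exact: mulr_ge0 m0 (ltW c0).
have := ge0_ler_powR (ltW u0) x0 mc0 xle.
have E1 : ((4 * mu `^ u^-1 * c) `^ u = 4 `^ u * mu * c `^ u)%R.
  rewrite (powRM _ m0 (ltW c0)) (powRM _ (ler0n _ 4) muu0).
  by rewrite -(powRrM mu) mulVf ?gt_eqF// powRr1.
rewrite E1 => h1.
have -> : (c `^ (1 + u) = c * c `^ u)%R.
  by rewrite powRD ?powRr1 ?(ltW c0)// (gt_eqF c0) implybT.
apply: (le_trans (ler_wpM2l a0 h1)).
have h2 : (a * mu <= K * c)%R by rewrite -ler_pdivrMr// mulrAC.
have k0 : (0 <= 4 `^ u * c `^ u)%R by rewrite mulr_ge0// powR_ge0.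
have := ler_wpM2l k0 h2.
rewrite (_ : 4 `^ u * c `^ u * (a * mu) = a * (4 `^ u * mu * c `^ u))%R; last by ring.
by rewrite (_ : 4 `^ u * c `^ u * (K * c) = 4 `^ u * K * (c * c `^ u))%R; last by ring.
Qed.

Lemma inve_powR_dual (om s : R) : (0 < om)%R ->
  (om%:E)^-1 `^ s = (om `^ (- s))%:E.
Proof.
move=> om0; rewrite inver gt_eqF// poweR_EFin; congr EFin.
by rewrite -powR_inv1 ?(ltW om0)// -powRrM mulN1r.
Qed.

Definition dual_weight (p : R) (w : T -> \bar R) (x : T) : \bar R := (w x)^-1 `^ (p - 1)^-1.

(** Both integrals are positive because the weight is positive and finite outside a null set; a
    bounded product of positive factors then forces both to be finite. *)
Lemma capacitary_Ap_cube w p (sg := dual_weight p w) : (1 < p)%R -> capacitary_Ap delta p w ->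
  exists2 K : R, (0 < K)%R & forall Q : cube R n,
  [/\ 0 < I Q w < +oo, 0 < I Q sg < +oo &
    (fine (I Q w) / edge Q `^ delta * (fine (I Q sg) / edge Q `^ delta) `^ (p - 1) <= K)%R].
Proof.
move=> p1 [cw]; rewrite /Ap_const gt_eqF// => Aoo.
have [N N0 NP] := capacitary_weight_null cw; have [w0 _ _] := cw.
have p10 : (0 < p - 1)%R by rewrite subr_gt0.
set S := ereal_sup _ in Aoo.
have [K K0 SK] : exists2 K : R, (0 < K)%R & S <= K%:E.
  case: S Aoo => [k| |]// _; last by exists 1%R; rewrite ?leNye.
  by exists (`|k| + 1)%R; rewrite ?ltr_wpDl// lee_fin (le_trans (ler_norm k))// lerDl.
exists K => // Q; set c := (edge Q `^ delta)%R.
have c0 : (0 < c)%R by exact: edge_powR_gt0.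
have : choquet_avg delta Q w * choquet_avg delta Q sg `^ (p - 1) <= K%:E.
  by apply: le_trans SK; apply: ereal_sup_ubound; exists Q.
rewrite /choquet_avg hausdorff_content_cube// -/c inver gt_eqF//.
have a0 : 0 < I Q w by apply: choquet_cube_gt0 N0 _ => x /NP[om om0 ->]; rewrite lte_fin.
have b0 : 0 < I Q sg.
  apply: choquet_cube_gt0 N0 _ => x /NP[om om0 wx].
  by rewrite /sg /dual_weight wx inve_powR_dual// lte_fin powR_gt0.
have ci0 : 0 < (c^-1)%:E :> \bar R by rewrite lte_fin invr_gt0.
have fin_prod (x y : \bar R) : 0 < x -> 0 < y -> x * y <= K%:E -> x < +oo /\ y < +oo.
  case: x => [x| |]//; case: y => [y| |]// x0 y0.
  - by rewrite !ltry.
  - by rewrite gt0_muley.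
  - by rewrite gt0_mulye.
move=> h; have x0 : 0 < (c^-1)%:E * I Q w by exact: mule_gt0.
have y0 : 0 < ((c^-1)%:E * I Q sg) `^ (p - 1) by rewrite poweR_gt0// mule_gt0.
have [aoo boo] := fin_prod _ _ x0 y0 h.
have {}boo : (c^-1)%:E * I Q sg < +oo by apply: lty_poweRy boo; rewrite gt_eqF.
have fin_fac (x : \bar R) : 0 < x -> (c^-1)%:E * x < +oo -> x < +oo.
  by case: x => [x| |]//; rewrite ?ltry// gt0_muley.
have {}aoo := fin_fac _ a0 aoo; have {}boo := fin_fac _ b0 boo.
split; rewrite ?a0 ?b0//; move: h.
have af : I Q w \is a fin_num by rewrite ge0_fin_numE// ltW.
have bf : I Q sg \is a fin_num by rewrite ge0_fin_numE// ltW.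
rewrite -{1}(fineK af) -{1}(fineK bf) -!EFinM lee_fin.
by rewrite !(mulrC (c^-1)%R).
Qed.

(** The inclusion of A_p in A_r, with [powR_le_interpolation] in the role of Jensen. The parameter
    (r - 1)^-1 makes the exponent of the pair equal to r. *)
Lemma capacitary_Ap_pair w p r : (1 < p)%R -> (p <= r)%R -> capacitary_Ap delta p w ->
  exists (sg : T -> \bar R) (K : R), muckenhoupt_pair delta (r - 1)^-1 w sg K.
Proof.
move=> p1 pr Apw; have [K K0 KP] := capacitary_Ap_cube p1 Apw.
have [cw _] := Apw; have [N N0 NP] := capacitary_weight_null cw; have [w0 _ _] := cw.
have p10 : (0 < p - 1)%R by rewrite subr_gt0.
have r10 : (0 < r - 1)%R by rewrite subr_gt0 (lt_le_trans p1).
have s0 : (0 < (r - 1)^-1)%R by rewrite invr_gt0.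
have q0 : (0 < (p - 1)^-1)%R by rewrite invr_gt0.
have sq : (0 <= (r - 1)^-1 <= (p - 1)^-1)%R.
  by rewrite (ltW s0)/= lef_pV2 ?posrE// lerD2r.
pose sp := dual_weight p w; pose sr := dual_weight r w.
have srle (Q : cube R n) : I Q sr <=
    (4 * ((fine (I Q sp) / edge Q `^ delta) `^ (p - 1)) `^ (r - 1)^-1 * edge Q `^ delta)%:E.
  have [_ /andP[b0 boo] _] := KP Q; set b := fine _; set c := (edge Q `^ delta)%R.
  have c0 : (0 < c)%R by exact: edge_powR_gt0.
  have bE : I Q sp = b%:E by rewrite fineK// ge0_fin_numE// ltW.
  have fb0 : (0 < b)%R by rewrite -lte_fin -bE.
  (* mu^(1/(p-1)) is the content average of the dual weight, which balances the two interpolation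
     terms; each integrates to 2 mu^(1/(r-1)) c, hence the 4. *)
  set mu := ((b / c) `^ (p - 1))%R; have mu0 : (0 < mu)%R by rewrite powR_gt0// divr_gt0.
  have k0 : (0 < mu `^ ((r - 1)^-1 - (p - 1)^-1))%R by rewrite powR_gt0.
  apply: (@le_trans _ _ (I Q (fun x => (mu `^ (r - 1)^-1)%:E +
      (mu `^ ((r - 1)^-1 - (p - 1)^-1))%:E * sp x))).
    apply: (le_choquet_ae N0) => x Qx /NP[om om0 wx]; split => //.
    rewrite /sr /sp /dual_weight wx inver gt_eqF// !poweR_EFin -EFinM -EFinD lee_fin.
    by apply: powR_le_interpolation; rewrite ?invr_gt0.
  apply: (le_trans (choquetD _ _ _)).
  - by move=> x _; rewrite lee_fin powR_ge0.
  - by move=> x _; rewrite mule_ge0 ?poweR_ge0// lee_fin ltW.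
  rewrite choquetZ// bE.
  apply: (@le_trans _ _ (2%:E * ((mu `^ (r - 1)^-1)%:E * c%:E) +
      2%:E * ((mu `^ ((r - 1)^-1 - (p - 1)^-1))%:E * b%:E))).
    rewrite leeD2r// lee_pmul2l//; apply: (le_trans (choquet_cst_le _ _ (powR_ge0 _ _))).
    by rewrite hausdorff_content_cube.
  rewrite -!EFinM -EFinD lee_fin.
  have muq : (mu `^ (p - 1)^-1 = b / c)%R.
    by rewrite -powRrM mulfV ?gt_eqF// powRr1// divr_ge0 ?ltW.
  have -> : (mu `^ ((r - 1)^-1 - (p - 1)^-1) = mu `^ (r - 1)^-1 * (b / c)^-1)%R.
    by rewrite powRD ?powRN ?muq// (gt_eqF mu0) implybT.
  rewrite le_eqVlt; apply/orP; left; apply/eqP; field.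
  by rewrite !gt_eqF.
exists sr, (4 `^ (r - 1) * K)%R; split => //.
- by rewrite mulr_gt0// powR_gt0.
- by exists N => // x /NP[om om0 wx]; exists om; split => //; rewrite /sr /dual_weight wx inve_powR_dual.
- by move=> x; split; rewrite ?w0 ?poweR_ge0.
- move=> Q; have [-> _ _] := KP Q; split => //; apply/andP; split.
    apply: choquet_cube_gt0 N0 _ => x /NP[om om0 wx].
    by rewrite /sr /dual_weight wx inve_powR_dual// lte_fin powR_gt0.
  by apply: (le_lt_trans (srle Q)); rewrite ltry.
move=> Q; rewrite invrK; have [/andP[a0 aoo] /andP[b0 boo] hab] := KP Q.
move: (srle Q) hab; rewrite -/sp; set b := fine (I Q sp); set c := (edge Q `^ delta)%R.
have c0 : (0 < c)%R by exact: edge_powR_gt0.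
set mu := ((b / c) `^ (p - 1))%R => bmu hab.
have br0 : (0 <= fine (I Q sr))%R by rewrite fine_ge0// choquet_ge0.
have mu0 : (0 <= mu)%R by exact: powR_ge0.
have fa0 : (0 <= fine (I Q w))%R by rewrite fine_ge0// ltW.
have brle : (fine (I Q sr) <= 4 * mu `^ (r - 1)^-1 * c)%R.
  rewrite -lee_fin fineK//; rewrite ge0_fin_numE; last exact: choquet_ge0.
  by apply: (le_lt_trans bmu); rewrite ltry.
exact: (muckenhoupt_power_ineq r10 fa0 br0 mu0 c0 brle hab).
Qed.

Lemma capacitary_A1_lower w : capacitary_Ap delta 1 w ->
  exists2 K : R, (0 < K)%R & exists2 N : set T, H N = 0 & forall x, ~ N x ->
  exists om : R, [/\ (0 < om)%R, w x = om%:E &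
    forall Q : cube R n, (Q : set T) x -> I Q w <= (K * edge Q `^ delta * om)%:E].
Proof.
move=> [cw]; rewrite /Ap_const eqxx => /ereal_inf_lt[_ [K [K0 ae] <-] _].
have [N N0 NP] := capacitary_weight_null cw; have [w0 _ _] := cw.
exists K => //; exists (N `|` [set x | ~ (content_maximal delta w x <= K%:E * w x)]).
  apply/eqP; rewrite eq_le hausdorff_content_ge0 andbT.
  by apply: (le_trans (hausdorff_contentU _ _ _)); rewrite N0 ae adde0.
move=> x nx; have [om om0 wx] : exists2 om : R, (0 < om)%R & w x = om%:E.
  by apply: NP => Nx; apply: nx; left.
have Mx : content_maximal delta w x <= K%:E * w x.
  by apply: contrapT => h; apply: nx; right.
exists om; split => // Q Qx; have c0 := edge_powR_gt0 delta Q.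
have : choquet_avg delta Q (fun y => `|w y|) <= K%:E * w x.
  by apply: le_trans Mx; apply: ereal_sup_ubound; exists Q.
rewrite wx /choquet_avg hausdorff_content_cube// inver gt_eqF// lee_pdivrMl// => h.
rewrite -mulrA mulrCA EFinM (EFinM K); apply: le_trans h.
by apply: le_choquet => // y _; rewrite gee0_abs.
Qed.

(** A cube has positive content, so it contains a point where the A_1 bound holds, which gives
    finiteness. Almost everywhere on Q, w >= w(Q) / (K c), so Chebyshev at half that height gives
    the A_infinity property. *)
Lemma capacitary_A1_regular (w : T -> \bar R) : capacitary_Ap delta 1 w -> regular_weight delta w.
Proof.
move=> Aw; have [K K0 [N N0 NP]] := capacitary_A1_lower Aw.
have [[w0 _ _] _] := Aw.
have fin (Q : cube R n) : 0 < I Q w < +oo.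
  apply/andP; split; first by apply: choquet_cube_gt0 N0 _ => x /NP[om [om0 -> _]]; rewrite lte_fin.
  have [x Qx Nx] : exists2 x, (Q : set T) x & ~ N x.
    apply: contrapT => h; have : H Q <= H N.
      by apply: le_hausdorff_content => x Qx; apply: contrapT => Nx; apply: h; exists x.
    by rewrite N0 hausdorff_content_cube// leNgt lte_fin edge_powR_gt0.
  by have [om [_ _ h]] := NP _ Nx; apply: (le_lt_trans (h _ Qx)); rewrite ltry.
split => // th th0; exists (2 * K / th)%R; first by rewrite divr_gt0// mulr_gt0.
move=> Q F FQ; rewrite hausdorff_content_cube// => thF.
have /andP[a0 aoo] := fin Q; have c0 := edge_powR_gt0 delta Q.
set c := (edge Q `^ delta)%R in c0 thF.
have af : I Q w \is a fin_num by rewrite ge0_fin_numE// ltW.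
set a := fine (I Q w); have fa0 : (0 < a)%R by rewrite fine_gt0// a0.
have m0 : (0 < a / (2 * K * c))%R by rewrite divr_gt0// !mulr_gt0.
have : (a / (2 * K * c))%:E * H F <= I F w.
  apply: le_trans (choquet_chebyshev _ _ _ m0); rewrite lee_pmul2l//.
  apply: le_trans (hausdorff_content_null _ N0); apply: le_hausdorff_content => x Fx.
  have [Nx|/NP[om [om0 wx h]]] := pselect (N x); [by right|left; split => //].
  rewrite wx lte_fin; have := h _ (FQ _ Fx); rewrite -/c -(fineK af) lee_fin -/a => h'.
  rewrite ltr_pdivrMr ?mulr_gt0//; apply: (le_lt_trans h').
  have : (0 < K * c * om)%R by rewrite !mulr_gt0.
  lra.
move=> h; rewrite -lee_pdivrMl ?divr_gt0 ?mulr_gt0//; apply: le_trans h.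
apply: (@le_trans _ _ ((a / (2 * K * c))%:E * (th * c)%:E)); last by rewrite lee_pmul2l.
rewrite -(fineK af) -/a -!EFinM lee_fin le_eqVlt; apply/orP; left; apply/eqP.
by field; rewrite !gt_eqF.
Qed.

Lemma capacitary_A1_maximal w : capacitary_Ap delta 1 w ->
  exists2 K : R, (0 < K)%R & forall h x, (forall y, 0 <= h y) ->
    MH h x <= K%:E * Mw w (fun y => h y * w y) x.
Proof.
move=> Aw; have [K K0 [N N0 NP]] := capacitary_A1_lower Aw; exists K => // h x h0.
have rw := capacitary_A1_regular Aw.
apply: ge_ereal_sup => _ [Q /= Qx <-]; have c0 := edge_powR_gt0 delta Q.
have a0 : (0 < fine (I Q w))%R by exact: fine_weight_gt0.
have af := weight_cube_fin rw Q.
rewrite -lee_pdivrMl//; apply: (@le_trans _ _ ((fine (I Q w))^-1%:E * I Q (fun y => h y * w y))); last first.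
  by apply: ereal_sup_ubound; exists Q.
rewrite muleA -EFinM lee_pdivlMl// muleA -EFinM -choquetZ; last first.
  by rewrite mulr_gt0// mulr_gt0 ?invr_gt0.
apply: (le_choquet_ae N0) => y Qy /NP[om [om0 wy hQ]]; split => //.
rewrite wy muleC lee_wpmul2l// lee_fin.
have := hQ _ Qy; rewrite -(fineK af) lee_fin => hh.
by rewrite -invfM ler_pdivrMr ?mulr_gt0// [leRHS]mulrC.
Qed.
End capacitary_weights.

(** * Layer sums for the Choquet and Lebesgue integrals *)

Section lebesgue_levels.
Context {R : realType} {n : nat} (delta : R).
Hypotheses (delta_gt0 : (0 < delta)%R) (delta_le_n : (delta <= n%:R)%R).
Local Notation T := 'rV[R]_n.
Local Notation H := (@hausdorff_content R n delta).
Local Notation I := (@choquet R n delta).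

(** The content at height 2^k is a lower bound on the interval from 2^(k-1) to 2^k, of length 2^k /
    2; these intervals are disjoint. *)
Lemma esum_level_le_choquet (E : set T) (F : T -> \bar R) :
  \esum_(k in [set: int]) ((2 ^ k)%:E * H [set x | E x /\ (2 ^ k)%:E < F x]) <= 2%:E * I E F.
Proof.
have H0 A : 0 <= H A by exact: hausdorff_content_ge0.
pose J k : set R := `](2 ^ (k - 1))%R, (2 ^ k)%R]%classic.
pose phi (t : R) := H [set x | E x /\ t%:E < F x].
have phi0 t : 0 <= phi t by exact: H0.
have mphi (D : set R) : measurable D -> measurable_fun D phi.
  by move=> mD; exact: measurable_hausdorff_content_level.
have mJ k : measurable (J k) by exact: measurable_itv.
pose g k : R -> \bar R := phi \_ (J k).
have g0 k t : 0 <= g k t by rewrite /g patchE; case: ifP.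
have mg k : measurable_fun setT (g k) by apply/(measurable_restrictT _ _).1; [exact: mJ|exact: mphi (mJ k)].
apply: (@le_trans _ _ (\esum_(k in [set: int]) (2%:E * \int[lebesgue_measure]_(t in (`]0%R, +oo[%classic : set R)) g k t))).
  apply: le_esum => k _; have k0 : (0 < (2 : R) ^ (k - 1))%R by exact: exp2z_gt0.
  have kE : ((2 : R) ^ k = 2 * 2 ^ (k - 1))%R.
    by rewrite -{2}(expr1z (2 : R)) -expfzDr// addrC subrK.
  rewrite {1}kE EFinM -muleA lee_pmul2l//.
  have -> : \int[lebesgue_measure]_(t in (`]0%R, +oo[%classic : set R)) g k t =
      \int[lebesgue_measure]_(t in J k) phi t.
    rewrite [RHS]integral_mkcond [LHS]integral_mkcond; apply: eq_integral => t _.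
    rewrite patchE; case: ifPn => // tn; rewrite patchE; case: ifPn => // /set_mem.
    rewrite /J /= in_itv/= => /andP[tk _]; exfalso; move/negP: tn; apply; apply/mem_set.
    by rewrite /= in_itv/= andbT (lt_trans k0).
  have le12 : ((2 : R) ^ (k - 1) <= 2 ^ k)%R by rewrite kE; lra.
  apply: (@le_trans _ _ (\int[lebesgue_measure]_(t in J k) phi (2 ^ k)%R)).
    rewrite integral_itv_oc_cst// (_ : 2 ^ k - 2 ^ (k - 1) = 2 ^ (k - 1))%R//.
    by rewrite kE; ring.
  apply: ge0_le_integral; [exact: mJ|by move=> t _; exact: phi0|exact: measurable_cst|exact: (mphi _ (mJ k))|].
  by move=> t; rewrite /J /= in_itv/= => /andP[_ tk]; exact: hausdorff_content_level_le.
rewrite esumZl//; last by move=> k; exact: integral_ge0.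
rewrite lee_pmul2l// -integral_esum//; last by move=> k; apply: measurable_funTS; exact: mg.
apply: ge0_le_integral => //.
- by move=> t _; exact: esum_ge0.
- by apply: measurable_esum => // k; apply: measurable_funTS; exact: mg.
- exact: (mphi _ (measurable_itv _)).
move=> t _; rewrite (_ : \esum_(k in [set: int]) g k t =
    \esum_(k in [set: int] `&` [set k | J k t]) phi t); last first.
  rewrite esum_mkcondr; apply: eq_esum => k _; rewrite /g patchE.
  by rewrite (_ : (k \in _) = (t \in J k))//; apply/idP/idP => /set_mem h; apply/mem_set.
apply: esum_le_unique => // [k l [_ /=] + [_ /=]|k _]; last by rewrite phi0 lexx.
have h (k' l' : int) : J k' t -> J l' t -> ~ (k' < l')%R.
  rewrite /J /= !in_itv/= => /andP[_ tk] /andP[lt _] kl; have := lt_le_trans lt tk.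
  rewrite ltNge ler_weXz2l ?ler1n//.
  by rewrite lerBrDr lezD1.
move=> Jk Jl; apply/eqP; case: (ltgtP k l) => // kl; exfalso; [exact: h Jk Jl kl|exact: h Jl Jk kl].
Qed.

Import HBNNSimple.

(** The integral is a supremum over simple functions below F. The level sets of these are measurable
    and contained in those of F, so outer measures suffice on the right. *)
Lemma integral_le_esum_levels (b : R) (F : lebesgue_Rn R n -> \bar R) : (1 < b)%R ->
  (forall x, 0 <= F x) ->
  \int[@lebesgue_measure_Rn R n]_x F x <=
  \esum_(k in [set: int]) ((b ^ (k + 1))%:E * lebesgue_outer [set x : T | (b ^ k)%:E < F x]).
Proof.
move=> b1 F0; rewrite ge0_integralTE//; apply: ge_ereal_sup => _ [h /= hF <-].
have b0 : (0 < b)%R by apply: lt_trans b1.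
have bk0 k : (0 < b ^ k)%R by exact: exprz_gt0.
pose A k := [set x | (b ^ k < h x)%R].
have mA k : measurable (A k).
  have := measurable_funPT h measurableT _ (measurable_itv `](b ^ k)%R, +oo[).
  rewrite setTI; congr measurable; apply/seteqP.
  by split => x; rewrite /A /= in_itv/= andbT.
rewrite -integralT_nnsfun.
pose g k x := (b ^ (k + 1))%:E * (\1_(A k) x)%:E : \bar R.
have g0 k x : 0 <= g k x by rewrite mule_ge0// lee_fin ltW.
have mg k : measurable_fun setT (g k).
  by apply: measurable_funeM; apply/measurable_EFinP; exact: measurable_indic.
apply: (@le_trans _ _ (\int[@lebesgue_measure_Rn R n]_x \esum_(k in [set: int]) g k x)).
  have h0 x : [set: T] x -> 0 <= (h x)%:E by move=> _; rewrite lee_fin.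
  have mh : measurable_fun [set: lebesgue_Rn R n] (EFin \o h) by exact/measurable_EFinP.
  apply: ge0_le_integral; [exact: measurableT|exact: h0|exact: mh|exact: measurable_esum|].
  move=> x _; have [hx|hx] := ltP 0%R (h x); last first.
    by apply: (@le_trans _ _ 0); [rewrite lee_fin|apply: esum_ge0].
  have [k /andP[k1 k2]] := exists_exprz_itv b1 hx.
  apply: le_trans (esum_ge_term (a := fun k => g k x) (i := k) _ _) => //.
  rewrite /g indicE mem_set// mule1 lee_fin//.
rewrite integral_esum//; apply: le_esum => k _.
rewrite ge0_integralZl_EFin//; last 2 first.
- by apply/measurable_EFinP; exact: measurable_indic.
- by rewrite ltW.
rewrite integral_indic// setIT lee_pmul2l//; last by rewrite lte_fin.
rewrite -[leLHS]/(lebesgue_outer (A k : set T)); apply: le_cube_content => x /= kx.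
by apply: lt_le_trans (hF x); rewrite lte_fin.
Qed.
End lebesgue_levels.

(** * From the content maximal operator to the Hardy-Littlewood operator *)

Section transfer.
Context {R : realType} {n : nat} (delta : R).
Hypotheses (delta_gt0 : (0 < delta)%R) (delta_le_n : (delta <= n%:R)%R).
Local Notation T := 'rV[R]_n.
Local Notation H := (@hausdorff_content R n delta).
Local Notation I := (@choquet R n delta).
Local Notation MH := (maximal delta (fun Q : cube R n => edge Q `^ delta)%R).
Local Notation d := (n%:R / delta)%R.
Local Notation HL := (@HL_maximal_Rn R n).

Let d_ge1 : (1 <= d)%R. Proof. by rewrite ler_pdivlMr// mul1r. Qed.
Let d_gt0 : (0 < d)%R. Proof. exact: lt_le_trans d_ge1. Qed.
Let n_gt0 : (0 < n%:R :> R)%R. Proof. exact: lt_le_trans delta_le_n. Qed.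

Lemma lebesgue_measure_cube (Q : cube R n) : @lebesgue_measure_Rn R n Q = (edge Q ^+ n)%:E.
Proof. exact: lebesgue_outer_cube. Qed.

(* Over dyadic levels, the Lebesgue measure of a level set is at most the power
   [n / delta >= 1] of its content, and a sum of powers is at most the power of the sum. *)
Lemma integral_cube_le_choquet (f : T -> \bar R) (Q : cube R n) :
  \int[@lebesgue_measure_Rn R n]_(y in Q) `|f y| <=
  (2 `^ d)%:E * (2%:E * I Q (fun y => `|f y| `^ d^-1)) `^ d.
Proof.
have H0 A : 0 <= H A by exact: hausdorff_content_ge0.
(* With ratio b = 2^d the levels b^k of |f| are exactly the dyadic levels 2^k of |f|^(1/d). *)
pose h y := `|f y| `^ d^-1; pose b : R := (2 `^ d)%R.
have b1 : (1 < b)%R by rewrite /b /powR pnatr_eq0/= expR_gt1 mulr_gt0// ln_gt0// ltr1n.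
have b0 : (0 < b)%R by apply: lt_trans b1.
have bk (k : int) : (b ^ k = (2 ^ k) `^ d)%R.
  by rewrite -!powR_intmul ?(ltW b0)// /b -!powRrM mulrC.
have k0 (k : int) : (0 < (2 : R) ^ k)%R by exact: exp2z_gt0.
pose E (k : int) : set T := [set x | (Q : set T) x /\ (2 ^ k)%:E < h x].
have Efin k : H (E k) \is a fin_num.
  rewrite ge0_fin_numE//; apply: (@le_lt_trans _ _ (H Q)).
    by apply: le_hausdorff_content => x [].
  by rewrite hausdorff_content_cube// ltry.
pose x (k : int) := (2 ^ k * fine (H (E k)))%R.
have x0 k : (0 <= x k)%R by rewrite mulr_ge0 ?fine_ge0// ltW.
rewrite integral_mkcond.
apply: (le_trans (integral_le_esum_levels b1 _)).
  by move=> y; rewrite patchE; case: ifP.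
apply: (@le_trans _ _ (\esum_(k in [set: int]) (b%:E * (x k `^ d)%:E))).
  apply: le_esum => k _.
  apply: (@le_trans _ _ ((b ^ (k + 1))%:E * H (E k) `^ d)).
    apply: lee_wpmul2l; first by rewrite lee_fin ltW// exprz_gt0.
    apply: le_trans (lebesgue_outer_le_hausdorff delta_gt0 delta_le_n _).
    apply: le_cube_content => y /=; rewrite patchE; case: ifPn => [/set_mem Qy|_]; last first.
      by rewrite lte_fin ltNge ltW// exprz_gt0.
    move=> bf; split => //; rewrite ltNge; apply/negP => hle.
    have := le_poweR (ltW d_gt0) (poweR_ge0 _ _) hle.
    by rewrite /h poweRVK// poweR_EFin -bk leNgt bf.
  rewrite -(fineK (Efin k)) poweR_EFin -!EFinM lee_fin.
  rewrite /x (powRM _ (ltW (k0 k)) (fine_ge0 (H0 _))) -bk expfzDr ?gt_eqF// expr1z.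
  by rewrite mulrA (mulrC b)%R.
rewrite esumZl ?(ltW b0)//; last by move=> k; rewrite lee_fin powR_ge0.
rewrite lee_pmul2l//; apply: (le_trans (esum_powR_le _ x0 d_ge1)).
apply: le_poweR; [exact: ltW|by apply: esum_ge0 => k _; rewrite lee_fin|].
apply: le_trans (esum_level_le_choquet _ _ _).
by apply: le_esum => k _; rewrite EFinM fineK.
Qed.

(** One factor 2^d is the ratio of consecutive levels, the other the d-th power of the 2 in
    [esum_level_le_choquet]. *)
Lemma HL_maximal_le (f : T -> \bar R) x :
  HL f x <= (2 `^ d * 2 `^ d)%:E * MH (fun y => `|f y| `^ d^-1) x `^ d.
Proof.
apply: ge_ereal_sup => _ [Q /= Qx <-]; pose h y := `|f y| `^ d^-1.
have c0 := edge_powR_gt0 delta Q; set c := (edge Q `^ delta)%R in c0 *.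
have l0 := edge_gt0 Q.
have cd : (c `^ d = edge Q ^+ n)%R.
  by rewrite /c -powRrM mulrCA mulfV ?gt_eqF// mulr1 powR_mulrn// ltW.
have Mle : (c^-1)%:E * I Q h <= MH h x by apply: ereal_sup_ubound; exists Q.
rewrite lebesgue_measure_cube inver gt_eqF ?exprn_gt0//.
rewrite lee_pdivrMl ?exprn_gt0//; apply: (le_trans (integral_cube_le_choquet f Q)).
rewrite -cd; set X := I Q _; rewrite -/X in Mle; have X0 : 0 <= X by exact: choquet_ge0.
have d20 : (0 < (2 : R) `^ d)%R by exact: powR_gt0.
have dE : (2%:E * X) `^ d = (2 `^ d)%:E * X `^ d.
  by rewrite (@poweRM _ 2%:E X) ?lee_fin.
rewrite dE muleA -EFinM muleCA lee_pmul2l; [|by []|by rewrite lte_fin mulr_gt0].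
have -> : X = c%:E * ((c^-1)%:E * X) by rewrite muleA -EFinM mulfV ?gt_eqF// mul1e.
rewrite poweRM ?lee_fin ?(ltW c0)//; last by rewrite mule_ge0// lee_fin invr_ge0 ltW.
rewrite poweR_EFin lee_pmul2l//; last by rewrite lte_fin powR_gt0.
apply: le_poweR => //; first exact: ltW.
by rewrite mule_ge0// lee_fin invr_ge0 ltW.
Qed.

Lemma HL_maximal_ge0 (f : T -> \bar R) x : 0 <= HL f x.
Proof.
have [Q Qx] := exists_cube_mem x.
apply: (@le_trans _ _ ((lebesgue_measure_Rn Q)^-1 * \int[@lebesgue_measure_Rn R n]_(y in Q) `|f y|)).
  rewrite mule_ge0 ?integral_ge0// lebesgue_measure_cube inver gt_eqF ?exprn_gt0 ?edge_gt0//.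
  by rewrite lee_fin invr_ge0 exprn_ge0// ltW// edge_gt0.
by apply: ereal_sup_ubound; exists Q.
Qed.

Variables (w : T -> \bar R) (q : R).
Hypotheses (w_ge0 : forall x, 0 <= w x) (q_gt0 : (0 < q)%R).

Let powE (f : T -> \bar R) : I setT (fun x => (`|f x| `^ d^-1) `^ (d * q) * w x) =
  I setT (fun x => `|f x| `^ q * w x).
Proof.
congr choquet; apply/funext => x; congr (_ * _).
by rewrite -poweRrM mulrA mulVf ?gt_eqF// mul1r.
Qed.

Lemma HL_strong_of_content : (exists2 K : R, (0 < K)%R & forall h, (forall x, 0 <= h x) ->
    I setT (fun x => MH h x `^ (d * q) * w x) <= K%:E * I setT (fun x => h x `^ (d * q) * w x)) ->
  exists2 K : R, (0 < K)%R & forall f,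
    I setT (fun x => `|HL f x| `^ q * w x) <= K%:E * I setT (fun x => `|f x| `^ q * w x).
Proof.
move=> [K K0 KP]; set C := (2 `^ d * 2 `^ d : R)%R.
have C0 : (0 < C)%R by rewrite mulr_gt0// powR_gt0.
exists (C `^ q * K)%R; first by rewrite mulr_gt0// powR_gt0.
move=> f; pose h y := `|f y| `^ d^-1.
have MH0 x : 0 <= MH h x by apply: maximal_ge0 => Q; exact: edge_powR_gt0.
apply: (@le_trans _ _ (I setT (fun x => (C `^ q)%:E * (MH h x `^ (d * q) * w x)))).
  apply: le_choquet => // x _; rewrite muleA lee_wpmul2r// gee0_abs ?HL_maximal_ge0//.
  apply: (le_trans (le_poweR (ltW q_gt0) (HL_maximal_ge0 f x) (HL_maximal_le f x))).
  by rewrite poweRM ?lee_fin ?(ltW C0) ?poweR_ge0// poweR_EFin -poweRrM.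
rewrite choquetZ ?powR_gt0// EFinM -muleA lee_pmul2l ?lte_fin ?powR_gt0//.
by rewrite -powE; apply: KP => y; exact: poweR_ge0.
Qed.

Lemma HL_weak_of_content : (exists2 K : R, (0 < K)%R & forall h (t : R), (forall x, 0 <= h x) ->
    (0 < t)%R ->
    (t `^ (d * q))%:E * I [set x | t%:E < MH h x] w <=
      K%:E * I setT (fun x => h x `^ (d * q) * w x)) ->
  exists2 K : R, (0 < K)%R & forall f (t : R), (0 < t)%R ->
    I [set x | t%:E < HL f x] w <= (K / t `^ q)%:E * I setT (fun x => `|f x| `^ q * w x).
Proof.
move=> [K K0 KP]; set C := (2 `^ d * 2 `^ d : R)%R.
have C0 : (0 < C)%R by rewrite mulr_gt0// powR_gt0.
exists (C `^ q * K)%R; first by rewrite mulr_gt0// powR_gt0.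
move=> f t t0; pose h y := `|f y| `^ d^-1.
have tC0 : (0 < t / C)%R by rewrite divr_gt0.
pose u := ((t / C) `^ d^-1)%R; have u0 : (0 < u)%R by rewrite powR_gt0.
have MH0 x : 0 <= MH h x by apply: maximal_ge0 => Q; exact: edge_powR_gt0.
have sub : [set x | t%:E < HL f x] `<=` [set x | u%:E < MH h x].
  move=> x /= tx; rewrite ltNge; apply/negP => Mu.
  have := le_trans (HL_maximal_le f x) (lee_wpmul2l _ (le_poweR (ltW d_gt0) (MH0 x) Mu)).
  rewrite lee_fin (ltW C0) => /(_ isT).
  rewrite poweR_EFin /u -powRrM mulVf ?gt_eqF// powRr1 ?(ltW tC0)// -EFinM.
  by rewrite -/C mulrC divfK ?gt_eqF// leNgt tx.
apply: (@le_trans _ _ (I [set x | u%:E < MH h x] w)); first exact: le_choquet.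
have h0 y : 0 <= h y by exact: poweR_ge0.
have := KP h u h0 u0; rewrite powE.
have -> : (u `^ (d * q) = t `^ q / C `^ q)%R.
  rewrite /u -powRrM mulrA mulVf ?gt_eqF// mul1r.
  have -> : (t `^ q = (t / C) `^ q * C `^ q)%R.
    by rewrite -powRM ?(ltW tC0) ?(ltW C0)// divfK// gt_eqF.
  by rewrite mulfK// gt_eqF// powR_gt0.
have tq0 : (0 < t `^ q)%R by rewrite powR_gt0.
have Cq0 : (0 < C `^ q)%R by rewrite powR_gt0.
rewrite -lee_pdivlMl ?divr_gt0//; move=> /le_trans; apply.
rewrite muleA -EFinM le_eqVlt; apply/orP; left; apply/eqP; congr (_%:E * _).
by field; rewrite !gt_eqF.
Qed.

Lemma weak_of_strong_content (r : R) : (0 < r)%R ->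
  (exists2 K : R, (0 < K)%R & forall h, (forall x, 0 <= h x) ->
    I setT (fun x => MH h x `^ r * w x) <= K%:E * I setT (fun x => h x `^ r * w x)) ->
  exists2 K : R, (0 < K)%R & forall h (t : R), (forall x, 0 <= h x) -> (0 < t)%R ->
    (t `^ r)%:E * I [set x | t%:E < MH h x] w <= K%:E * I setT (fun x => h x `^ r * w x).
Proof.
move=> r0 [K K0 KP]; exists K => // h t h0 t0; apply: le_trans (KP _ h0).
rewrite -choquetZ ?powR_gt0//; apply: le_choquet => // x /= tM.
rewrite lee_wpmul2r// -poweR_EFin; apply: le_poweR; rewrite ?lee_fin; exact: ltW.
Qed.
End transfer.

(** * Bounds for the content maximal operator under the capacitary conditions *)

Section content_bounds.
Context {R : realType} {n : nat} (delta : R).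
Hypotheses (delta_gt0 : (0 < delta)%R) (delta_le_n : (delta <= n%:R)%R).
Local Notation T := 'rV[R]_n.
Local Notation I := (@choquet R n delta).
Local Notation MH := (maximal delta (fun Q : cube R n => edge Q `^ delta)%R).
Local Notation Mw w := (maximal delta (fun Q : cube R n => fine (I Q w))).

Lemma content_strong_Ap (w : T -> \bar R) (p r : R) : (1 < p)%R -> (p <= r)%R ->
  capacitary_Ap delta p w ->
  exists2 K : R, (0 < K)%R & forall h, (forall x, 0 <= h x) ->
    I setT (fun x => MH h x `^ r * w x) <= K%:E * I setT (fun x => h x `^ r * w x).
Proof.
move=> p1 pr Apw.
have [sg [K mp]] := capacitary_Ap_pair delta_gt0 delta_le_n p1 pr Apw.
have := strong_type_muckenhoupt_pair delta_gt0 delta_le_n mp.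
by rewrite invrK subrKC.
Qed.

(** [strong_type] is applied to F = h w and G = h^r w; [young] holds since h <= lam, or h <=
    lam^(1-r) h^r. *)
Lemma content_strong_A1 (w : T -> \bar R) (r : R) : (1 < r)%R -> capacitary_Ap delta 1 w ->
  exists2 K : R, (0 < K)%R & forall h, (forall x, 0 <= h x) ->
    I setT (fun x => MH h x `^ r * w x) <= K%:E * I setT (fun x => h x `^ r * w x).
Proof.
move=> r1 Aw; have r0 : (0 < r)%R by apply: lt_trans r1.
have [[w0 _ _] _] := Aw; have [N N0 NP] := capacitary_weight_null Aw.1.
have rw := capacitary_A1_regular delta_gt0 delta_le_n Aw.
have [K1 K10 MP] := capacitary_A1_maximal delta_gt0 delta_le_n Aw.
have [K2 K20 st] := strong_type delta_gt0 delta_le_n rw r1.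
have K1r : (0 < K1 `^ r)%R by exact: powR_gt0.
exists (K1 `^ r * K2)%R; first exact: mulr_gt0.
move=> h h0; pose F y := h y * w y.
have MH0 x : 0 <= MH h x by apply: maximal_ge0 => Q; exact: edge_powR_gt0.
have Mw0 x : 0 <= Mw w F x by apply: maximal_ge0 => Q; exact: fine_weight_gt0.
apply: (@le_trans _ _ (I setT (fun x => (K1 `^ r)%:E * (Mw w F x `^ r * w x)))).
  apply: le_choquet => // x _; rewrite muleA lee_wpmul2r//.
  apply: (le_trans (le_poweR (ltW r0) (MH0 x) (MP h x h0))).
  by rewrite poweRM ?lee_fin ?(ltW K10)// poweR_EFin.
rewrite choquetZ// EFinM -muleA lee_pmul2l//; apply: st.
move=> E lam lam0; have l0 : (0 < lam `^ (1 - r))%R by exact: powR_gt0.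
rewrite !EFinM -!muleA -(choquetZ delta E w lam0) -(choquetZ delta E _ l0).
apply: le_trans (choquetD _ _ _); last 2 first.
- by move=> x _; rewrite mule_ge0// lee_fin ltW.
- by move=> x _; rewrite mule_ge0 ?lee_fin ?(ltW l0)// mule_ge0 ?poweR_ge0.
apply: (le_choquet_ae N0) => x Ex /NP[om om0 wx]; split => //; rewrite /F wx.
case: (h x) (h0 x) => [g| |]//; last first.
  by move=> _; rewrite poweRyr ?gt_eqF// !gt0_mulye ?lte_fin// gt0_muley ?lte_fin// addey ?leey.
rewrite lee_fin => g0; rewrite poweR_EFin -!EFinM -EFinD lee_fin.
have [gl|lg] := leP g lam.
  apply: (@le_trans _ _ (lam * om)%R); first by rewrite ler_wpM2r// ltW.
  by rewrite lerDl !mulr_ge0 ?powR_ge0// ltW.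
have g0' : (0 < g)%R by apply: lt_trans lg.
apply: (@le_trans _ _ (lam `^ (1 - r) * (g `^ r * om))%R); last by rewrite lerDr mulr_ge0 ?ltW.
rewrite mulrA ler_pM2r//.
have -> : (lam `^ (1 - r) = (lam `^ (r - 1))^-1)%R by rewrite -powRN opprB.
have -> : (g `^ r = g * g `^ (r - 1))%R.
  by rewrite -{2}(powRr1 g0) -powRD ?subrKC// (gt_eqF g0') implybT.
rewrite mulrC -mulrA ler_peMr// ler_pdivlMr ?powR_gt0// mul1r.
by apply: ge0_ler_powR; rewrite ?nnegrE ?subr_ge0 ?(ltW r1) ?(ltW lam0) ?(ltW lg).
Qed.

(** The endpoint r = 1, which [strong_type] excludes and [weak_type] supplies. *)
Lemma content_weak_A1 (w : T -> \bar R) : capacitary_Ap delta 1 w ->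
  exists2 K : R, (0 < K)%R & forall h (t : R), (forall x, 0 <= h x) -> (0 < t)%R ->
    t%:E * I [set x | t%:E < MH h x] w <= K%:E * I setT (fun x => h x * w x).
Proof.
move=> Aw; have [[w0 _ _] _] := Aw.
have rw := capacitary_A1_regular delta_gt0 delta_le_n Aw.
have [K1 K10 MP] := capacitary_A1_maximal delta_gt0 delta_le_n Aw.
have [K2 K20 wk] := weak_type delta_gt0 delta_le_n rw.
exists (K1 * K2)%R; first exact: mulr_gt0.
move=> h t h0 t0; have tK : (0 < t / K1)%R by rewrite divr_gt0.
have sub : I [set x | t%:E < MH h x] w <=
    I [set x | (t / K1)%:E < Mw w (fun y => h y * w y) x] w.
  apply: le_choquet; last by move=> x _; exact: lexx.
  move=> x tM; have tMw := lt_le_trans tM (MP h x h0); clear wk MP tM.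
  by move: tMw; rewrite -lte_pdivrMl// -EFinM (mulrC _ t).
have tE : t%:E = K1%:E * (t / K1)%:E.
  by rewrite -EFinM; congr EFin; rewrite mulrC divfK// gt_eqF.
apply: (le_trans (lee_wpmul2l _ sub)); first by rewrite lee_fin ltW.
rewrite tE (EFinM K1 K2) -[leLHS]muleA -[leRHS]muleA; apply: lee_wpmul2l; first by rewrite lee_fin ltW.
by apply: (wk _ _ tK).
Qed.
End content_bounds.

Theorem corollary1p6 (R : realType) (n : nat) (delta : R)
    (delta_gt0 : (0 < delta)%R) (delta_le_n : (delta <= n%:R)%R) :
  [/\ forall (w : 'rV[R]_n -> \bar R) (p q : R),
        (1 < p)%R -> capacitary_Ap delta p w ->
        (p * delta / n%:R <= q)%R ->
        exists2 K : R, (0 < K)%R &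
          forall f : 'rV[R]_n -> \bar R, L1loc f ->
            choquet delta [set: 'rV[R]_n]
              (fun x => `|HL_maximal_Rn f x| `^ q * w x)
            <= K%:E * choquet delta [set: 'rV[R]_n]
                        (fun x => `|f x| `^ q * w x),
      forall (w : 'rV[R]_n -> \bar R) (q : R),
        capacitary_Ap delta 1 w ->
        (delta / n%:R < q)%R ->
        exists2 K : R, (0 < K)%R &
          forall f : 'rV[R]_n -> \bar R, L1loc f ->
            choquet delta [set: 'rV[R]_n]
              (fun x => `|HL_maximal_Rn f x| `^ q * w x)
            <= K%:E * choquet delta [set: 'rV[R]_n]
                        (fun x => `|f x| `^ q * w x)
    & forall (w : 'rV[R]_n -> \bar R) (p q : R),
        (1 <= p)%R -> capacitary_Ap delta p w ->
        (p * delta / n%:R <= q)%R ->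
        exists2 K : R, (0 < K)%R &
          forall (f : 'rV[R]_n -> \bar R) (t : R), L1loc f -> (0 < t)%R ->
            weighted_content delta w [set x | t%:E < HL_maximal_Rn f x]
            <= (K / t `^ q)%:E * choquet delta [set: 'rV[R]_n]
                                   (fun x => `|f x| `^ q * w x)].
Proof.
have n0 : (0 < n%:R :> R)%R by exact: lt_le_trans delta_le_n.
have dn0 : (0 < delta / n%:R)%R by rewrite divr_gt0.
have exponent (p q : R) : (p * delta / n%:R <= q)%R -> (p <= n%:R / delta * q)%R.
  rewrite ler_pdivrMr// -ler_pdivlMr//.
  by rewrite (_ : n%:R / delta * q = q * n%:R / delta)%R//; ring.
have q_pos (p q : R) : (1 <= p)%R -> (p * delta / n%:R <= q)%R -> (0 < q)%R.
  by move=> p1; apply: lt_le_trans; rewrite divr_gt0// mulr_gt0// (lt_le_trans ltr01).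
split.
- move=> w p q p1 Apw pq; have [[w0 _ _] _] := Apw.
  have q0 := q_pos _ _ (ltW p1) pq.
  have [|K K0 KP] := HL_strong_of_content delta_gt0 delta_le_n w0 q0.
    exact: content_strong_Ap p1 (exponent _ _ pq) Apw.
  by exists K.
- move=> w q Aw dq; have [[w0 _ _] _] := Aw.
  have q0 : (0 < q)%R by exact: lt_trans dq.
  have [|K K0 KP] := HL_strong_of_content delta_gt0 delta_le_n w0 q0.
    apply: content_strong_A1 => //.
    by rewrite mulrAC ltr_pdivlMr// mul1r mulrC -ltr_pdivrMr.
  by exists K.
- move=> w p q p1 Apw pq; have [[w0 _ _] _] := Apw.
  have q0 := q_pos _ _ p1 pq; have pr := exponent _ _ pq.
  have [|K K0 KP] := @HL_weak_of_content _ _ _ delta_gt0 delta_le_n w q; last by exists K => // f t _; exact: KP.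
  have r0 : (0 < n%:R / delta * q)%R by rewrite mulr_gt0// divr_gt0.
  (* If p > 1 or r > 1 the weak bound follows from the strong one by Chebyshev; only p = r = 1
     remains. *)
  move: p1 pr Apw; rewrite le_eqVlt => /predU1P[<-|p1] pr Apw; last first.
    by apply: weak_of_strong_content => //; exact: content_strong_Ap p1 pr Apw.
  move: pr; rewrite le_eqVlt => /predU1P[r1|r1]; last first.
    by apply: weak_of_strong_content => //; exact: content_strong_A1 r1 Apw.
  have [K K0 KP] := content_weak_A1 delta_gt0 delta_le_n Apw.
  exists K => // h t h0 t0; rewrite -r1 powRr1 ?(ltW t0)//.
  apply: (le_trans (KP h t h0 t0)); rewrite lee_pmul2l//.
  by apply: le_choquet => // x _; rewrite poweRe1.
Qed.
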